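(* Let $M$ be an oriented closed $n$-dimensional manifold and let $f:M\rightarrow S^{n+1}\subset\mathbb{R}^{n+2}$ be an embedded closed minimal hypersurface which is symmetric under the $(n+2)$ coordinate hyperplane reflections and which is not totally geodesic. Then $$\bar S\geq n,$$ with equality holding if and only if $f$ is congruent to some Clifford minimal torus $C_{m,n-m}$ $(1\leq m\leq n-1)$.
   Context: $S^{n+1}$ is the unit sphere in $\mathbb{R}^{n+2}$, and $M$ carries the metric induced by $f$, with volume element $\mathrm{d}M$ and $Vol(M)=\int_M \mathrm{d}M$. Writing the second fundamental form of $f$ in a local orthonormal coframe as $II=\sum_{i,j}h_{ij}\omega^i\omega^j$, set $S=\sum_{i,j}(h_{ij})^2$ (the square of the length of the second fundamental form), and $\bar S=\frac{1}{Vol(M)}\int_M S\,\mathrm{d}M$. Minimal means $H=\frac1n\sum_i h_{ii}\equiv 0$. ''Symmetric under the $(n+2)$ coordinate hyperplane reflections'' means that $f(M)$ is invariant under each reflection $x_i\mapsto -x_i$ of $\mathbb{R}^{n+2}$, $1\le i\le n+2$. The Clifford minimal tori are $C_{m,n-m}=S^m\left(\sqrt{m/n}\right)\times S^{n-m}\left(\sqrt{(n-m)/n}\right)\subset S^{n+1}$, $1\leq m\leq n-1$, where $S^k(r)$ is the round $k$-sphere of radius $r$ centered at the origin of $\mathbb{R}^{k+1}$. Congruent means equal up to an isometry of $S^{n+1}$. *)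

(* Defs.v *)
From HB Require Import structures.
From mathcomp Require Import all_boot all_order all_algebra.
From mathcomp Require Import all_classical all_reals all_analysis.
From mathcomp Require Import measurable_realfun.
Set Implicit Arguments.
Unset Strict Implicit.
Unset Printing Implicit Defensive.
Import Order.TTheory GRing.Theory Num.Theory.
Import numFieldNormedType.Exports.
Local Open Scope classical_set_scope.
Local Open Scope ring_scope.

Fixpoint Ck_on (R : realType) (n m k : nat) (U : set 'rV[R]_n)
    (F : 'rV[R]_n -> 'rV[R]_m) : Prop :=
  if k is k'.+1 then
    (forall x, U x -> differentiable F x) /\
    (forall v : 'rV[R]_n, Ck_on k' U (fun x => 'D_v F x))
  else forall x, U x -> {for x, continuous F}.

Definition smooth_on (R : realType) (n m : nat) (U : set 'rV[R]_n)
    (F : 'rV[R]_n -> 'rV[R]_m) : Prop := forall k, Ck_on k U F.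

(* The total maps [mcoord a] and [param a] are meaningful only on [dom a] and on
   the open set [mcoord a @` dom a], where they are inverse homeomorphisms. *)
Record oriented_atlas (R : realType) (n : nat) (M : topologicalType) :=
  OrientedAtlas {
    chart : Type;
    dom : chart -> set M;
    mcoord : chart -> M -> 'rV[R]_n;
    param : chart -> 'rV[R]_n -> M;
    chart_at : M -> chart;
    dom_chart_at : forall p, dom (chart_at p) p;
    dom_open : forall a, open (dom a);
    coord_open : forall a, open (mcoord a @` dom a);
    coordK : forall a p, dom a p -> param a (mcoord a p) = p;
    coord_continuous : forall a p, dom a p -> {for p, continuous (mcoord a)};
    param_continuous : forall a x, (mcoord a @` dom a) x ->
      {for x, continuous (param a)};
    transition_smooth : forall a b,
      smooth_on (mcoord a @` (dom a `&` dom b)) (mcoord b \o param a);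
    transition_oriented : forall a b x, (mcoord a @` (dom a `&` dom b)) x ->
      0 < \det ('J (mcoord b \o param a) x)
  }.

Definition closed_manifold (M : topologicalType) : Prop :=
  hausdorff_space M /\ compact [set: M].

Definition dotv (R : realType) (N : nat) (x y : 'rV[R]_N) : R :=
  \sum_(i < N) x 0 i * y 0 i.

(* [usphere R n.+2] is S^{n+1}. *)
Definition usphere (R : realType) (N : nat) : set 'rV[R]_N :=
  [set x | dotv x x = 1].
Arguments usphere : clear implicits.

(* Geodesic distance on the unit sphere. *)
Definition sphere_dist (R : realType) (N : nat) (x y : 'rV[R]_N) : R :=
  acos (dotv x y).

(* Only the restriction of [T] to the sphere matters. *)
Definition sphere_isometry (R : realType) (N : nat)
    (T : 'rV[R]_N -> 'rV[R]_N) : Prop :=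
  T @` usphere R N = usphere R N /\
  (forall x y, usphere R N x -> usphere R N y ->
     sphere_dist (T x) (T y) = sphere_dist x y).

Definition congruent (R : realType) (N : nat) (A B : set 'rV[R]_N) : Prop :=
  exists T, sphere_isometry T /\ T @` A = B.

Definition coord_reflection (R : realType) (N : nat) (i : 'I_N)
    (x : 'rV[R]_N) : 'rV[R]_N :=
  \row_j (if j == i then - x 0 j else x 0 j).

Definition reflection_symmetric (R : realType) (N : nat)
    (A : set 'rV[R]_N) : Prop :=
  forall i : 'I_N, coord_reflection i @` A = A.

(* S^m(sqrt(m/n)) x S^{n-m}(sqrt((n-m)/n)) in R^{m+1} x R^{n-m+1} = R^{n+2}:
   the first factor consists of the coordinates 0, ..., m. *)
Definition clifford_torus (R : realType) (n m : nat) : set 'rV[R]_n.+2 :=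
  [set x | \sum_(i < n.+2 | (i <= m)%N) x 0 i ^+ 2
             = Num.sqrt (m%:R / n%:R) ^+ 2
        /\ \sum_(i < n.+2 | (m < i)%N) x 0 i ^+ 2
             = Num.sqrt ((n - m)%:R / n%:R) ^+ 2].
Arguments clifford_torus : clear implicits.

Section Hypersurface.
Variables (R : realType) (n : nat) (M : topologicalType).
Variables (A : oriented_atlas R n M) (f : M -> 'rV[R]_n.+2).

Definition embedded_hypersurface : Prop :=
  [/\ forall p, usphere R n.+2 (f p),
      forall a : chart A, smooth_on (mcoord a @` dom a) (f \o param a),
      forall (a : chart A) x, (mcoord a @` dom a) x ->
        row_free ('J (f \o param a) x),
      injective f
    & forall U : set M, open U ->
        exists2 V : set 'rV[R]_n.+2, open V & U = f @^-1` V].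

(* The rows of [tangent a x] are the coordinate tangent vectors. *)
Definition tangent (a : chart A) (x : 'rV[R]_n) : 'M[R]_(n, n.+2) :=
  'J (f \o param a) x.

(* The induced metric g_ij in the chart [a]. *)
Definition metric (a : chart A) (x : 'rV[R]_n) : 'M[R]_n :=
  tangent a x *m (tangent a x)^T.

(* The unit vector tangent to the sphere and normal to the hypersurface, with
   (position, normal, positively oriented tangent frame) a positive basis of
   R^{n+2}. *)
Definition unit_normal (a : chart A) (x : 'rV[R]_n) : 'rV[R]_n.+2 :=
  let y := f (param a x) in
  xget 0 [set v : 'rV[R]_n.+2 |
    [/\ dotv v v = 1, dotv v y = 0, tangent a x *m v^T = 0
      & 0 < \det (col_mx y (col_mx v (tangent a x)) : 'M[R]_n.+2)]].

(* II in the coordinate frame; the component of the second derivative along the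
   position vector is orthogonal to [unit_normal]. *)
Definition sff_coord (a : chart A) (x : 'rV[R]_n) : 'M[R]_n :=
  \matrix_(i, j)
    dotv ('D_(delta_mx 0 i) (fun y => 'D_(delta_mx 0 j) (f \o param a) y) x)
         (unit_normal a x).

(* A g-orthonormal basis of the tangent space; the rows are the components in
   the coordinate frame. *)
Definition orthonormal_frame (a : chart A) (x : 'rV[R]_n) : 'M[R]_n :=
  xget 0 [set E : 'M[R]_n | E *m metric a x *m E^T = 1%:M].

(* The matrix (h_ij) of II at [p] in an orthonormal frame. It depends on the
   frame only up to orthogonal conjugation, so the quantities below do not. *)
Definition sff (p : M) : 'M[R]_n :=
  let a := chart_at A p in
  let x := mcoord a p in
  let E := orthonormal_frame a x in
  E *m sff_coord a x *m E^T.

Definition mean_curvature (p : M) : R := n%:R^-1 * \sum_(i < n) sff p i i.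

Definition minimal : Prop := forall p, mean_curvature p = 0.

Definition totally_geodesic : Prop := forall p, sff p = 0.

Definition sff_sqnorm (p : M) : R :=
  \sum_(i < n) \sum_(j < n) sff p i j ^+ 2.

End Hypersurface.

(* Lebesgue integral over R^n of a nonnegative Borel function, as an iterated
   integral (Tonelli). *)
Fixpoint lebesgue_integral_rV (R : realType) (n : nat) :
    ('rV[R]_n -> \bar R) -> \bar R :=
  match n with
  | 0 => fun F => F 0
  | n'.+1 => fun F =>
      (\int[@lebesgue_measure R]_(t in [set: R])
         lebesgue_integral_rV (fun y : 'rV[R]_n' => F (row_mx t%:M y)))%E
  end.

Notation borel M := (g_sigma_algebraType (@open M)).

(* dM = sqrt(det g) dx^1 ... dx^n in every chart. As the chart domains are open
   and cover M, this determines [dM] uniquely when M is compact. *)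
Definition volume_element (R : realType) (n : nat) (M : ptopologicalType)
    (A : oriented_atlas R n M) (f : M -> 'rV[R]_n.+2)
    (dM : {measure set (borel M) -> \bar R}) : Prop :=
  forall (a : chart A) (u : borel M -> \bar R),
    measurable_fun [set: borel M] u -> (forall p, 0 <= u p)%E ->
    (\int[dM]_(p in (dom a : set (borel M))) u p =
     lebesgue_integral_rV
       ((fun x => u (param a x) * (Num.sqrt (\det (metric f a x)))%:E)
          \_ (mcoord a @` dom a)))%E.

Definition volume (R : realType) (M : ptopologicalType)
    (dM : {measure set (borel M) -> \bar R}) : R := fine (dM [set: borel M]).

Definition average (R : realType) (M : ptopologicalType)
    (dM : {measure set (borel M) -> \bar R}) (u : M -> R) : R :=
  (volume dM)^-1 * (\int[dM]_(p in [set: borel M]) u p)%R.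

(* Main.v *)
(** Let nu be the unit normal, so that sum_i |grad nu_i|^2 = S. Reflection
    symmetry forces nu_i = 0 wherever f_i = 0: otherwise the hypersurface would
    lie in the hyperplane x_i = 0 near such a point, and would be a great
    sphere. Dividing by f_i (Barta's trick) and using Delta f_i = - n f_i,
      |grad nu_i|^2 = |grad nu_i - (nu_i / f_i) grad f_i|^2 + n nu_i^2
                      + div ((nu_i^2 / f_i) grad f_i).
    Integrating and summing over i gives int S >= n Vol. To make the quotient
    C^1, nu_i is truncated at height d, and d -> 0.

    In the equality case f_i grad nu_i = nu_i grad f_i. Where all f_i are
    nonzero, C = diag (nu_i / f_i) satisfies C^2 = 1 + b C and tr C = b, so it
    is one of finitely many matrices, each attached to a set [I] of
    coordinates. The corresponding pieces of M are open and closed, and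
    maximizing linear functions shows that each nonempty one covers the torus
    of its index set; as any two of these tori meet, there is only one piece.
    Conversely a Clifford torus lies in the quadric x B x^T = 0 with
    B^2 = 1 + b B and tr B = b, so nu = +- f B and S = n pointwise. *)
Require Import Defs.
From mathcomp Require Import all_boot all_order all_algebra.
From mathcomp Require Import fingroup perm.
From mathcomp Require Import all_classical all_reals all_analysis.
From mathcomp Require Import measurable_realfun.
From mathcomp Require Import ring lra zify.
Set Implicit Arguments.
Unset Strict Implicit.
Unset Printing Implicit Defensive.
Import Order.TTheory GRing.Theory Num.Theory.
Import numFieldNormedType.Exports.
Local Open Scope classical_set_scope.
Local Open Scope ring_scope.

(** Everything analytic goes through [weak_laplace], the divergence theorem for psi grad f_i with
    psi merely C^1. This fixes the regularity used throughout ([C1at]) and lets bumps and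
    truncations be built from squares of positive parts. The theorem itself rests on translation
    invariance of the integral on R^n: a derivative is a uniform limit of difference quotients. The
    truncation at height d makes the numerator of nu_i^2 / f_i vanish on a whole neighbourhood of
    the zeros of f_i, where nu_i = 0 alone would not show that the quotient is C^1. The completed
    square still contains 1 / f_i and d; it is bounded below, up to d^2, by half of |f_i grad nu_i -
    nu_i grad f_i|^2, which contains neither and can be kept as d -> 0 for the equality case. M may
    be disconnected, so a great sphere could be one component among others; it is then excluded by
    testing f_j against the locally constant sign of f_j on the rest of M. In the equality case C^2
    = 1 + b C comes from differentiating |nu|^2 = 1 with grad nu = C grad f, and tr C = b from
    minimality. *)

(** * Gram matrices and orthonormal frames *)

Section LinearAlgebra.
Variable R : realType.

Lemma dotvE (N : nat) (x y : 'rV[R]_N) : dotv x y = (x *m y^T) 0 0.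
Proof. by rewrite /dotv mxE; apply: eq_bigr => i _; rewrite !mxE. Qed.

Lemma mx11_dotv (N : nat) (x y : 'rV[R]_N) : x *m y^T = (dotv x y)%:M.
Proof. by rewrite dotvE [LHS]mx11_scalar. Qed.

Lemma dotvC (N : nat) (x y : 'rV[R]_N) : dotv x y = dotv y x.
Proof. by rewrite /dotv; apply: eq_bigr => i _; rewrite mulrC. Qed.

Lemma dotvDl (N : nat) (x y z : 'rV[R]_N) : dotv (x + y) z = dotv x z + dotv y z.
Proof. by rewrite !dotvE mulmxDl mxE. Qed.

Lemma dotvZl (N : nat) (a : R) (x z : 'rV[R]_N) : dotv (a *: x) z = a * dotv x z.
Proof. by rewrite !dotvE -scalemxAl mxE. Qed.

Lemma dotvNl (N : nat) (x z : 'rV[R]_N) : dotv (- x) z = - dotv x z.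
Proof. by rewrite !dotvE mulNmx mxE. Qed.

Lemma dotvBl (N : nat) (x y z : 'rV[R]_N) : dotv (x - y) z = dotv x z - dotv y z.
Proof. by rewrite dotvDl dotvNl. Qed.

Lemma dotvDr (N : nat) (x y z : 'rV[R]_N) : dotv z (x + y) = dotv z x + dotv z y.
Proof. by rewrite !(dotvC z) dotvDl. Qed.

Lemma dotvZr (N : nat) (a : R) (x z : 'rV[R]_N) : dotv z (a *: x) = a * dotv z x.
Proof. by rewrite !(dotvC z) dotvZl. Qed.

Lemma dotvBr (N : nat) (x y z : 'rV[R]_N) : dotv z (x - y) = dotv z x - dotv z y.
Proof. by rewrite !(dotvC z) dotvBl. Qed.

Lemma dotv0l (N : nat) (z : 'rV[R]_N) : dotv 0 z = 0.
Proof. by rewrite dotvE mul0mx mxE. Qed.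

Lemma dotv_delta (N : nat) (x : 'rV[R]_N) i : dotv x (delta_mx 0 i) = x 0 i.
Proof.
rewrite /dotv (bigD1 i) //= big1 ?addr0 ?mxE ?eqxx ?mulr1 // => j ji.
by rewrite mxE (negbTE ji) andbF mulr0.
Qed.

Lemma dotvv_ge0 (N : nat) (x : 'rV[R]_N) : 0 <= dotv x x.
Proof. by rewrite /dotv sumr_ge0 // => i _; rewrite -expr2 sqr_ge0. Qed.

Lemma dotvv_eq0 (N : nat) (x : 'rV[R]_N) : (dotv x x == 0) = (x == 0).
Proof.
apply/eqP/eqP => [|->]; last by rewrite dotv0l.
move=> x0; apply/rowP => i; rewrite mxE.
have /eqP := psumr_eq0P (fun i _ => sqr_ge0 (x 0 i)) x0 (erefl true : xpredT i).
by rewrite sqrf_eq0 => /eqP.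
Qed.

Lemma dotvv_gt0 (N : nat) (x : 'rV[R]_N) : x != 0 -> 0 < dotv x x.
Proof. by move=> x0; rewrite lt_def dotvv_eq0 x0 dotvv_ge0. Qed.

Definition posdef n (G : 'M[R]_n) :=
  G^T = G /\ forall x : 'rV_n, x != 0 -> 0 < (x *m G *m x^T) 0 0.

Lemma posdef_gram n m (F : 'M[R]_(n, m)) : row_free F -> posdef (F *m F^T).
Proof.
move=> Ffree; split; first by rewrite trmx_mul trmxK.
move=> x x0; rewrite mulmxA -mulmxA -trmx_mul -dotvE dotvv_gt0 //.
by apply: contraNneq x0 => xF; rewrite -(mul0mx _ F) in xF; rewrite (row_free_inj Ffree xF).
Qed.

(* Cholesky: eliminate the first row and column and recurse on the Schur
   complement. *)
Lemma posdef_frame n (G : 'M[R]_n) : posdef G ->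
  exists E : 'M[R]_n, E *m G *m E^T = 1%:M.
Proof.
elim: n G => [|n IH] G [Gsym Gpos].
  by exists 0; apply/matrixP => -[].
pose a := G 0 0.
have a0 : 0 < a.
  have := Gpos (delta_mx 0 0); rewrite -rowE trmx_delta -colE !mxE; apply.
  by apply/eqP => /matrixP /(_ 0 0) /eqP; rewrite !mxE !eqxx oner_eq0.
change 'M[R]_(1 + n) in G.
change (exists E : 'M[R]_(1 + n), E *m G *m E^T = 1%:M).
have {}Gpos : forall x : 'rV[R]_(1 + n), x != 0 -> 0 < (x *m G *m x^T) 0 0 by [].
pose b := ursubmx G : 'M[R]_(1, n).
pose D := drsubmx G : 'M[R]_n.
have GE : G = block_mx a%:M b b^T D.
  rewrite -[G in LHS]submxK; congr block_mx.
    by apply/matrixP => i j; rewrite !ord1 !mxE /a; congr (G _ _); apply/val_inj.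
  by rewrite /b trmx_ursub Gsym.
have DT : D^T = D by rewrite /D trmx_drsub Gsym.
have schur : posdef (D - a^-1 *: (b^T *m b)).
  split; first by rewrite linearB linearZ /= trmx_mul trmxK DT.
  move=> x x0.
  pose y : 'rV_(1 + n) := row_mx (- a^-1 *: (x *m b^T)) x.
  have y0 : y != 0.
    apply: contraNneq x0 => y0; rewrite -[x](row_mxKr (- a^-1 *: (x *m b^T))).
    by rewrite -/y y0 linear0.
  have := Gpos _ y0.
  rewrite GE /y mul_row_block tr_row_mx mul_row_col.
  rewrite mul_mx_scalar scalerA mulrN divff ?gt_eqF // scaleN1r addNr mul0mx add0r.
  by rewrite mulmxBr -scalemxAl -scalemxAr mulmxA scaleNr addrC.
have [E' E'P] := IH _ schur.
pose s := (Num.sqrt a)^-1.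
have s2 : s * s * a = 1.
  by rewrite /s -invfM -expr2 sqr_sqrtr ?ltW // mulVf // gt_eqF.
exists (block_mx s%:M 0 (- a^-1 *: (E' *m b^T)) E' : 'M[R]_(1 + n)).
rewrite GE tr_block_mx !mulmx_block !tr_scalar_mx !trmx0 !mul0mx !mulmx0 !addr0.
rewrite linearZ /= trmx_mul trmxK.
rewrite !mul_scalar_mx.
have -> : (- a^-1 *: (E' *m b^T)) *m a%:M + E' *m b^T = 0.
  by rewrite mul_mx_scalar scalerA mulrN divff ?gt_eqF // scaleN1r addNr.
rewrite !mul0mx !add0r scalar_mx_block -E'P; congr block_mx.
- by rewrite mul_mx_scalar !scale_scalar_mx mulrA s2.
- rewrite scale_scalar_mx mul_scalar_mx scalerA mulrN mulfK ?gt_eqF //.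
  by rewrite -scalemxAl scaleNr addNr.
- by rewrite mulmxBr -scalemxAl -scalemxAr mulmxA scaleNr addrC.
Qed.

Lemma posdef_det n (G : 'M[R]_n) : posdef G -> 0 < \det G.
Proof.
move=> /posdef_frame [E /(congr1 determinant)].
rewrite !det_mulmx det_tr det1 => EG.
have : 0 < \det G * (\det E) ^+ 2 by rewrite (_ : _ * _ = 1) // -EG; ring.
move=> h; rewrite -(pmulr_lgt0 _ (_ : 0 < \det E ^+ 2)) // lt_def sqr_ge0 andbT.
by apply: contraTneq h => ->; rewrite mulr0 ltxx.
Qed.

Lemma posdef_unit n (G : 'M[R]_n) : posdef G -> G \in unitmx.
Proof. by move=> /posdef_det G0; rewrite unitmxE unitfE gt_eqF. Qed.

(** Used to replace the orthonormal frame chosen by [xget] in [sff] by the inverse metric, so that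
    the choice leaves the computations. *)
Lemma frame_inv n (G E : 'M[R]_n) : E *m G *m E^T = 1%:M -> E^T *m E = invmx G.
Proof.
move=> EGE; have := EGE; rewrite -mulmxA => /mulmx1C EE.
have Gu : G \in unitmx.
  by apply: (proj1 (mulmx1_unit (_ : G *m (E^T *m E) = 1%:M))); rewrite mulmxA.
by rewrite -[LHS](mulKmx Gu) (mulmxA G) EE mulmx1.
Qed.

Lemma invmxT n (G : 'M[R]_n) : G^T = G -> (invmx G)^T = invmx G.
Proof. by move=> Gs; rewrite trmx_inv Gs. Qed.

End LinearAlgebra.

(** * Frames made of position, normal and tangent vectors *)

Record adapted_frame (R : realType) n (y v : 'rV[R]_n.+2) (F : 'M[R]_(n, n.+2)) : Prop :=
  AdaptedFrame {
    af_yy : dotv y y = 1;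
    af_vv : dotv v v = 1;
    af_yv : dotv v y = 0;
    af_Fy : F *m y^T = 0;
    af_Fv : F *m v^T = 0;
    af_free : row_free F }.

Section AdaptedFrame.
Variables (R : realType) (n : nat) (y v : 'rV[R]_n.+2) (F : 'M[R]_(n, n.+2)).
Hypothesis afr : adapted_frame y v F.
Let G := F *m F^T.

Lemma af_posdef : posdef G.
Proof. exact: posdef_gram (af_free afr). Qed.

Lemma af_unit : G \in unitmx.
Proof. exact: posdef_unit af_posdef. Qed.

(** The square matrix [B] with rows [y], [v], [F] has the explicit right inverse [K], which is then
    also a left inverse. [K *m B = 1%:M] splits the identity into the position, normal and
    tangential projections. *)
Lemma af_proj : F^T *m invmx G *m F = 1%:M - y^T *m y - v^T *m v.
Proof.
case: afr => yy vv vy Fy Fv _.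
have yF : y *m F^T = 0 by rewrite -[LHS]trmxK trmx_mul trmxK Fy trmx0.
have vF : v *m F^T = 0 by rewrite -[LHS]trmxK trmx_mul trmxK Fv trmx0.
pose B : 'M[R]_(1 + (1 + n)) := col_mx y (col_mx v F).
pose K : 'M[R]_(1 + (1 + n)) := row_mx y^T (row_mx v^T (F^T *m invmx G)).
have BK : B *m K = 1%:M.
  rewrite /B /K mul_col_row mul_mx_row mul_col_mx mul_col_row.
  rewrite !mx11_dotv yy vv vy dotvC vy Fy Fv !mulmxA yF vF !mul0mx.
  by rewrite mulmxV ?af_unit // raddf0 row_mx0 col_mx0 -!scalar_mx_block.
have /mulmx1C := BK.
rewrite /K /B mul_row_col mul_row_col => <-.
by rewrite [X in X - _ - _]addrC addrK addrC addKr.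
Qed.

Lemma af_decomp (w : 'rV[R]_n.+2) :
  w = dotv w y *: y + dotv w v *: v + w *m F^T *m invmx G *m F.
Proof.
rewrite -!mulmxA (mulmxA F^T) af_proj !mulmxBr mulmx1 !mulmxA !mx11_dotv.
by rewrite !mul_scalar_mx -[X in _ + X]addrA -opprD addrCA subrr addr0.
Qed.

Lemma af_eq (w w' : 'rV[R]_n.+2) : dotv w y = dotv w' y -> dotv w v = dotv w' v ->
  w *m F^T = w' *m F^T -> w = w'.
Proof. by move=> h1 h2 h3; rewrite (af_decomp w) h1 h2 h3 -af_decomp. Qed.

End AdaptedFrame.

(** * Iterated integration of compactly supported functions on R^n *)

Section IteratedIntegral.
Variable R : realType.
Local Notation leb := (@lebesgue_measure R).

Definition Cc n (B : R) (F : 'rV[R]_n -> R) :=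
  continuous F /\ forall x, B < `|x| -> F x = 0.

Lemma continuous_comb (T : topologicalType) (F G : T -> R) (a : R) :
  continuous F -> continuous G -> continuous (fun x => a * F x + G x).
Proof.
move=> cF cG x; apply: cvgD; last exact: cG.
by apply: cvgM; [exact: cvg_cst|exact: cF].
Qed.

Lemma continuous_addr (V : normedModType R) (T : topologicalType) (F : V -> T) (v : V) :
  continuous F -> continuous (fun x => F (x + v)).
Proof.
move=> cF x; apply: (@continuous_comp _ _ _ (fun x => x + v) F); last exact: cF.
by apply: cvgD; [exact: cvg_id|exact: cvg_cst].
Qed.

Lemma Cc_le n (B B' : R) (F : 'rV[R]_n -> R) : B <= B' -> Cc B F -> Cc B' F.
Proof.
by move=> BB [cF F0]; split=> // x Bx; apply: F0; exact: le_lt_trans Bx.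
Qed.

Lemma closed_ball_compact n (B : R) : compact [set x : 'rV[R]_n | `|x| <= B].
Proof.
apply: bounded_closed_compact.
  by exists B; split; [exact: num_real|move=> M BM x /= /le_trans; apply; exact: ltW].
apply: (@preimage_closed _ _ (fun x : 'rV[R]_n => `|x|) [set x | x <= B]).
  by move=> x _; exact: norm_continuous.
exact: closed_le.
Qed.

(** Heine's theorem on the closed ball of radius [B]. If only one of the two points lies in the
    ball, symmetry applies; if neither does, both values are 0. *)
Lemma Cc_unif n (B : R) (F : 'rV[R]_n -> R) : Cc B F -> forall e, 0 < e ->
  exists2 d, 0 < d & forall x y, `|x - y| < d -> `|F x - F y| < e.
Proof.
move=> [cF F0] e e0.
have := @closed_ball_compact n B; rewrite compact_near_coveringP.
move=> /(_ _ (0 : R)^'+ (fun d x => forall y, `|x - y| < d -> `|F x - F y| < e)).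
case.
  move=> x _.
  have /cvgrPdist_lt /(_ (e / 2)) := cF x; rewrite divr_gt0 // => /(_ isT).
  move=> /nbhs_ballP [r /= r0 rF].
  exists (ball x (r / 2), [set d | 0 < d < r / 2]) => /=.
    split; first exact: nbhsx_ballx (divr_gt0 _ _).
    have r2 : 0 < r / 2 by rewrite divr_gt0.
    by near=> d; apply/andP; split; near: d;
      [exact: nbhs_right_gt|exact: nbhs_right_lt].
  move=> [x' d] /= [xx' /andP[d0 dr]] y x'y.
  have h1 : ball x r x' by apply: le_ball xx'; rewrite ler_pdivrMr // ler_peMr ?ler1n // ltW.
  have h2 : ball x r y.
    rewrite [r]splitr; apply: (ball_triangle xx').
    by rewrite -ball_normE /=; exact: lt_trans dr.
  have := rF _ h1; have := rF _ h2 => /= a b.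
  rewrite (_ : F x' - F y = (F x - F y) - (F x - F x')); last by ring.
  by apply: le_lt_trans (ler_normB _ _) _; rewrite [e]splitr ltrD.
move=> d0 /= d00 H.
pose d := d0 / 2.
have dd : 0 < d by rewrite divr_gt0.
have {}H : forall x, `|x| <= B -> forall y, `|x - y| < d -> `|F x - F y| < e.
  move=> x xB; apply: (H d) => //=.
  by rewrite sub0r normrN gtr0_norm // ltr_pdivrMr // ltr_pMr // ltr1n.
exists d => // x y xy.
have [xB|Bx] := leP `|x| B; first exact: H.
have [yB|By] := leP `|y| B; first by rewrite distrC; apply: H => //; rewrite distrC.
by rewrite !F0 // subrr normr0.
Unshelve. all: by end_near. Qed.

Lemma norm_row_mx n (t : R) (y : 'rV[R]_n) :
  `|row_mx t%:M y : 'rV[R]_(1 + n)| = Num.max `|t| `|y|.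
Proof.
have rowE k (z : 'rV[R]_k) (c : R) : 0 <= c -> (`|z| <= c) = [forall i, `|z 0 i| <= c].
  move=> c0; rewrite [`|z|]mx_normrE; apply/bigmax_leP/forallP.
    by move=> [_ h] i; exact: (h (0, i)).
  by move=> h; split=> // -[i j] _; rewrite ord1 h.
apply/eqP; rewrite eq_le; apply/andP; split.
  rewrite rowE ?le_max ?normr_ge0 //; apply/forallP => i; rewrite mxE.
  case: splitP => j _; first by rewrite !mxE ord1 eqxx mulr1n le_max lexx.
  rewrite le_max; apply/orP; right.
  by move: (lexx `|y|); rewrite {1}rowE // => /forallP.
rewrite ge_max; have := lexx `|row_mx t%:M y : 'rV[R]_(1 + n)|.
rewrite {1}rowE // => /forallP h; apply/andP; split.
  by have := h (lshift _ 0); rewrite row_mxEl !mxE eqxx mulr1n.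
by rewrite rowE //; apply/forallP => i; have := h (rshift _ i); rewrite row_mxEr.
Qed.

Lemma rV_split n (v : 'rV[R]_(1 + n)) : v = row_mx (v 0 0)%:M (rsubmx v).
Proof.
rewrite -[LHS]hsubmxK; congr row_mx.
by apply/rowP => i; rewrite !mxE ord1 eqxx mulr1n; congr (v _ _); apply/val_inj.
Qed.

Lemma row_mxB n (t s : R) (y z : 'rV[R]_n) :
  row_mx t%:M y - row_mx s%:M z = row_mx (t - s)%:M (y - z) :> 'rV_(1 + n).
Proof. by rewrite opp_row_mx add_row_mx raddfB. Qed.

Lemma Cc_slice n (B : R) (F : 'rV[R]_n.+1 -> R) t : Cc B F ->
  Cc B (fun y : 'rV[R]_n => F (row_mx t%:M y)).
Proof.
move=> cF; split=> [|x Bx]; last first.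
  by apply: cF.2; rewrite norm_row_mx lt_max Bx orbT.
move=> x; apply/(@cvgrPdist_lt _ _ _ (nbhs (x : 'rV[R]_n))) => e /(Cc_unif cF) [d d0 H].
apply/nbhs_ballP; exists d => //= y; rewrite -ball_normE /= => xy.
by apply: H; rewrite row_mxB norm_row_mx subrr normr0 gt_max d0.
Qed.

Lemma Cc_slice_gt n (B : R) (F : 'rV[R]_n.+1 -> R) t (y : 'rV_n) : Cc B F -> B < `|t| ->
  F (row_mx t%:M y) = 0.
Proof. by move=> [_ F0] Bt; apply: F0; rewrite norm_row_mx lt_max Bt. Qed.

Definition Cc1 (B : R) (g : R -> R) := continuous g /\ forall t, B < `|t| -> g t = 0.

Lemma Cc1Z (B a : R) g : Cc1 B g -> Cc1 B (fun t => a * g t).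
Proof.
move=> [cg g0]; split=> [t|t /g0 ->]; last by rewrite mulr0.
by apply: cvgM; [exact: cvg_cst|exact: cg].
Qed.

Lemma Cc1_restrict B g : Cc1 B g -> g = g \_ `[-B, B].
Proof.
move=> [_ g0]; apply/funext => t; rewrite patchE; case: ifPn => // /negP h.
apply: g0; rewrite ltNge; apply/negP => tB; apply: h.
by rewrite inE /= in_itv /= -ler_norml.
Qed.

Lemma continuous_itv_integrable (a b : R) g : continuous g ->
  leb.-integrable `[a, b] (EFin \o g).
Proof.
move=> cg; apply: continuous_compact_integrable; first exact: segment_compact.
exact: continuous_subspaceT.
Qed.

Lemma Cc1_integrable B g : Cc1 B g -> leb.-integrable setT (EFin \o g).
Proof.
move=> cg; have -> : EFin \o g = (EFin \o g) \_ `[-B, B].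
  by rewrite {1}(Cc1_restrict cg) restrict_EFin.
rewrite -integrable_mkcond; last exact: measurable_itv.
exact: continuous_itv_integrable cg.1.
Qed.

Lemma Rint_bound (B C : R) g : 0 <= B -> Cc1 B g -> (forall t, `|g t| <= C) ->
  `|\int[leb]_t g t| <= 2 * B * C.
Proof.
move=> B0 cg gC.
apply: le_trans (le_normr_Rintegral measurableT (Cc1_integrable cg)) _.
have -> : \int[leb]_t `|g t| = \int[leb]_(t in `[-B, B]) `|g t|.
  rewrite [RHS]Rintegral_mkcond; apply: eq_Rintegral => t _.
  rewrite {1}(Cc1_restrict cg) !patchE; case: ifP => // _; exact: normr0.
have lebB : leb `[-B, B] = (2 * B)%:E.
  rewrite lebesgue_measure_itv /= lte_fin.
  have [B1|B1] := ltP (- B) B; first by rewrite -EFinB; congr EFin; ring.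
  have -> : B = 0 by apply/eqP; rewrite eq_le B0 andbT; lra.
  by rewrite mulr0.
have -> : 2 * B * C = \int[leb]_(t in `[-B, B]) C.
  rewrite Rintegral_cst ?measurable_itv //.
  by rewrite mulrC; congr (_ * _); exact: (congr1 fine (esym lebB)).
apply: le_Rintegral => //.
- apply: continuous_itv_integrable => t; apply: continuous_comp; first exact: cg.1.
  exact: norm_continuous.
- by apply: continuous_itv_integrable => t; exact: cst_continuous.
Qed.

(** Uniqueness of Lebesgue measure: its image under the translation gives half-open intervals the
    same length, hence is the same measure. *)
Lemma Rint_shift (B : R) g s : Cc1 B g -> \int[leb]_t g (t + s) = \int[leb]_t g t.
Proof.
move=> cg.
pose phi := (fun t : R => t + s) : measurableTypeR R -> measurableTypeR R.
have cphi : continuous (fun t : R => t + s).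
  by move=> t; apply: cvgD; [exact: cvg_id|exact: cvg_cst].
have mphi : measurable_fun setT phi by exact: continuous_measurable_fun.
have cgs : Cc1 (B + `|s|) (fun t => g (t + s)).
  split=> [t|t Bt]; first by apply: continuous_comp; [exact: cphi|exact: cg.1].
  apply: cg.2; rewrite -(ltrD2r `|s|); apply: lt_le_trans Bt _.
  by rewrite -{1}(addrK s t); exact: ler_normB.
have pE : forall A, measurable A -> leb A = pushforward leb phi A.
  apply: lebesgue_measure_unique => _ [[a b] _ <-] /=.
  rewrite /pushforward /=.
  have -> : phi @^-1` `]a, b] = `]a - s, b - s]%classic.
    by apply/seteqP; split=> t; rewrite /= !in_itv /= lerBrDr ltrBlDr.
  rewrite !lebesgue_measure_itv /= !lte_fin ltrD2r.
  by case: ifP => // _; rewrite -!EFinB; congr EFin; ring.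
rewrite /Rintegral; congr fine.
have h := @integral_pushforward _ _ _ _ R phi mphi leb setT (EFin \o g).
rewrite preimage_setT in h.
have -> : (\int[leb]_t (g (t + s))%:E = \int[leb]_t ((EFin \o g) \o phi) t)%E by [].
rewrite -h //; last 2 first.
- by apply/measurable_EFinP; exact: continuous_measurable_fun cg.1.
- exact: Cc1_integrable cgs.
by apply: eq_measure_integral => A mA _; exact: esym (pE A mA).
Qed.

Lemma Rint_pos (B : R) g t0 : Cc1 B g -> (forall t, 0 <= g t) -> 0 < g t0 ->
  0 < \int[leb]_t g t.
Proof.
move=> cg g0 gt0.
have /cvgrPdist_lt /(_ (g t0 / 2)) := cg.1 t0; rewrite divr_gt0 // => /(_ isT).
move=> /nbhs_ballP [r /= r0 rF].
pose D := `[t0 - r / 2, t0 + r / 2]%classic.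
have r2 : 0 < r / 2 by rewrite divr_gt0.
have gD t : D t -> g t0 / 2 <= g t.
  rewrite /D /= in_itv /= => /andP[h1 h2].
  have /rF /= : ball t0 r t.
    by rewrite -ball_normE /= ltr_norml; apply/andP; split; lra.
  by rewrite ltr_norml => /andP[_ h]; lra.
have lebD : leb D = r%:E.
  rewrite lebesgue_measure_itv /= lte_fin ifT; last by lra.
  by rewrite -EFinB; congr EFin; field.
have ig := Cc1_integrable cg.
have iD : leb.-integrable D (EFin \o g) by exact: continuous_itv_integrable cg.1.
have igD : leb.-integrable setT (EFin \o (g \_ D)).
  by rewrite -restrict_EFin -integrable_mkcond //; exact: measurable_itv.
apply: (@lt_le_trans _ _ (\int[leb]_(t in D) (g t0 / 2))).
  rewrite Rintegral_cst; last exact: measurable_itv.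
  suff -> : forall x, x = leb D -> fine x = r by rewrite ?mulr_gt0 ?divr_gt0.
  by move=> x ->; rewrite lebD.
apply: (@le_trans _ _ (\int[leb]_(t in D) g t)).
  apply: le_Rintegral => //; first exact: measurable_itv.
  by apply: continuous_itv_integrable => t; exact: cst_continuous.
rewrite Rintegral_mkcond; apply: le_Rintegral => // t _.
by rewrite patchE; case: ifP.
Qed.

(* The signed counterpart of [lebesgue_integral_rV]. *)
Fixpoint itint n : ('rV[R]_n -> R) -> R :=
  match n with
  | 0 => fun F => F 0
  | n'.+1 => fun F => \int[leb]_t itint (fun y : 'rV[R]_n' => F (row_mx t%:M y))
  end.

(** Linearity and the sup bound have to be proved together by induction on [n]: integrating a slice
    integral requires its continuity ([slice_itint]), and continuity compares two slices through
    linearity and the bound in one dimension less. *)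
Let linear_itint n := forall (B : R) (F G : 'rV[R]_n -> R) a, Cc B F -> Cc B G ->
  itint (fun x => a * F x + G x) = a * itint F + itint G.

Let bound_itint n := forall (B C : R) (F : 'rV[R]_n -> R), 0 <= B -> Cc B F ->
  (forall x, `|F x| <= C) -> `|itint F| <= (2 * B) ^+ n * C.

Let slice_itint n : linear_itint n -> bound_itint n ->
  forall (B : R) (F : 'rV[R]_n.+1 -> R), 0 <= B -> Cc B F ->
    Cc1 B (fun t => itint (fun y : 'rV[R]_n => F (row_mx t%:M y))).
Proof.
move=> IH1 IH2 B F.
move=> B0 cF; split=> [t|t Bt]; last first.
  have := IH2 B 0 (fun y : 'rV_n => F (row_mx t%:M y)) B0 (Cc_slice t cF).
  rewrite mulr0 normr_le0 => h; apply/eqP/h => x.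
  by rewrite (Cc_slice_gt _ cF Bt) normr0.
apply/cvgrPdist_lt => e e0.
pose K := (2 * B) ^+ n + 1.
have K0 : 0 < K by rewrite ltr_wpDl // exprn_ge0 // mulr_ge0.
have [d d0 H] := Cc_unif cF (divr_gt0 e0 K0).
apply/nbhs_ballP; exists d => //= s ts.
have -> : itint (fun y : 'rV[R]_n => F (row_mx t%:M y)) -
          itint (fun y : 'rV[R]_n => F (row_mx s%:M y)) =
          itint (fun y : 'rV[R]_n => -1 * F (row_mx s%:M y) + F (row_mx t%:M y)).
  by rewrite (IH1 B) ?mulN1r 1?addrC //; exact: Cc_slice.
have cc : Cc B (fun y : 'rV[R]_n => -1 * F (row_mx s%:M y) + F (row_mx t%:M y)).
  have [[c1 z1] [c2 z2]] := (Cc_slice s cF, Cc_slice t cF).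
  split=> [|x Bx]; last by rewrite z1 // z2 // mulr0 addr0.
  exact: continuous_comb.
have := IH2 B (e / K) _ B0 cc.
move=> /(_ _)/le_lt_trans; apply.
  move=> x; rewrite mulN1r addrC ltW // H // row_mxB norm_row_mx subrr normr0.
  by rewrite gt_max ts.
rewrite mulrCA gtr_pMr // ltr_pdivrMr // mul1r /K ltrDl.
by [].
Qed.

Let itint_facts n : linear_itint n /\ bound_itint n.
Proof.
elim: n => [|n [IH1 IH2]]; first by split=> [B F G a //|B C F _ _ h]; rewrite expr0 mul1r; exact: h.
have slice := slice_itint IH1 IH2.
split=> [B F G a cF cG|B C F B0 cF FC].
  wlog B0 : B cF cG / 0 <= B.
    by move=> h; apply: (h (Num.max B 0)); rewrite ?le_max ?lexx ?orbT //;
      (apply: Cc_le; last eassumption); rewrite le_max lexx.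
  have [sF sG] := (slice _ _ B0 cF, slice _ _ B0 cG).
  rewrite /=.
  transitivity (\int[leb]_t (a * itint (fun y : 'rV[R]_n => F (row_mx t%:M y)) +
                          itint (fun y : 'rV[R]_n => G (row_mx t%:M y)))).
    by apply: eq_Rintegral => t _; rewrite (IH1 B) //; exact: Cc_slice.
  rewrite RintegralD //; last 2 first.
  - exact: Cc1_integrable (Cc1Z a sF).
  - exact: Cc1_integrable sG.
  by rewrite RintegralZl //; exact: Cc1_integrable sF.
rewrite /= exprS -mulrA; apply: Rint_bound => //; first exact: slice.
by move=> t; apply: IH2 => //; exact: Cc_slice.
Qed.

Lemma itint_slice n (B : R) (F : 'rV[R]_n.+1 -> R) : 0 <= B -> Cc B F ->
  Cc1 B (fun t => itint (fun y : 'rV[R]_n => F (row_mx t%:M y))).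
Proof. by have [h1 h2] := itint_facts n; exact: slice_itint. Qed.

Lemma itint_lin n (B : R) (F G : 'rV[R]_n -> R) a : Cc B F -> Cc B G ->
  itint (fun x => a * F x + G x) = a * itint F + itint G.
Proof. by have [h _] := itint_facts n; exact: h. Qed.

Lemma itint_bound n (B C : R) (F : 'rV[R]_n -> R) : 0 <= B -> Cc B F ->
  (forall x, `|F x| <= C) -> `|itint F| <= (2 * B) ^+ n * C.
Proof. by have [_ h] := itint_facts n; exact: h. Qed.

Lemma itint_ge0 n (F : 'rV[R]_n -> R) : (forall x, 0 <= F x) -> 0 <= itint F.
Proof.
elim: n F => [|n IH] F F0 /=; first exact: F0.
by apply: Rintegral_ge0 => t _; apply: IH => y; exact: F0.
Qed.

(** The bridge to [volume_element], which is stated with extended real integrals of nonnegative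
    functions, while the computations use the real and linear [itint]. *)
Lemma itint_EFin n (B : R) (F : 'rV[R]_n -> R) : 0 <= B -> Cc B F -> (forall x, 0 <= F x) ->
  lebesgue_integral_rV (EFin \o F) = (itint F)%:E.
Proof.
move=> B0; elim: n F => [|n IH] F cF F0 //=.
transitivity (\int[leb]_t (itint (fun y : 'rV[R]_n => F (row_mx t%:M y)))%:E)%E.
  by apply: eq_integral => t _; rewrite -IH //; exact: Cc_slice.
rewrite /Rintegral fineK //; apply: integrable_fin_num => //.
exact: Cc1_integrable (itint_slice B0 cF).
Qed.

Lemma Cc_shift n (B : R) (F : 'rV[R]_n -> R) v : Cc B F -> Cc (B + `|v|) (fun x => F (x + v)).
Proof.
move=> [cF F0]; split=> [|x Bx]; first exact: continuous_addr.
apply: F0; rewrite -(ltrD2r `|v|); apply: lt_le_trans Bx _.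
by rewrite -{1}(addrK v x); exact: ler_normB.
Qed.

Lemma itint_shift n (B : R) (F : 'rV[R]_n -> R) v : 0 <= B -> Cc B F ->
  itint (fun x => F (x + v)) = itint F.
Proof.
move=> B0; elim: n F v => [|n IH] F v cF /=.
  by congr F; apply/rowP => -[].
pose s := v 0 0; pose w : 'rV[R]_n := rsubmx (v : 'rV[R]_(1 + n)).
have vE : v = row_mx s%:M w :> 'rV[R]_(1 + n) by exact: rV_split.
rewrite -[RHS](@Rint_shift B _ s); last exact: itint_slice.
apply: eq_Rintegral => t _.
rewrite -(IH (fun y => F (row_mx (t + s)%:M y)) w); last exact: Cc_slice.
congr itint; apply/funext => y; congr F.
have : row_mx t%:M y + (v : 'rV[R]_(1 + n)) = row_mx (t + s)%:M (y + w) :> 'rV[R]_(1 + n).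
  by rewrite vE add_row_mx raddfD.
exact.
Qed.

Lemma itint_gt0 n (B : R) (F : 'rV[R]_n -> R) x0 : 0 <= B -> Cc B F -> (forall x, 0 <= F x) ->
  0 < F x0 -> 0 < itint F.
Proof.
move=> B0; elim: n F x0 => [|n IH] F x0 cF F0 Fx0 /=.
  by rewrite (_ : 0 = x0) //; apply/rowP => -[].
apply: (@Rint_pos B _ (x0 0 0)); first exact: itint_slice.
  by move=> t; apply: itint_ge0 => y.
apply: (IH _ (rsubmx (x0 : 'rV[R]_(1 + n)))) => //; first exact: Cc_slice.
by have := Fx0; rewrite {1}(@rV_split n x0).
Qed.

End IteratedIntegral.

(** * Functions of class C^1 at a point *)

Section Lines.
Variables (R : realType) (V : normedModType R).
Implicit Types (g : V -> R) (x v : V).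

Lemma derive_line (g : V -> R) (x v : V) (t : R) : derivable g (x + t *: v) v ->
  is_derive t 1 (fun s => g (x + s *: v)) ('D_v g (x + t *: v)).
Proof.
move=> dg.
have E : (fun h : R => h^-1 *: (((fun s => g (x + s *: v)) \o shift t) (h *: (1 : R)) -
                        g (x + t *: v))) =
         (fun h : R => h^-1 *: ((g \o shift (x + t *: v)) (h *: v) - g (x + t *: v))).
  apply/funext => h /=; congr (_ *: (g _ - _)).
  by rewrite [h *: 1]mulr1 scalerDl addrCA addrA.
apply: DeriveDef; first by rewrite /derivable E.
by rewrite /derive E.
Qed.

Lemma mvt_line g x v : (forall t, 0 <= t <= 1 -> derivable g (x + t *: v) v) ->
  exists2 c, 0 < c < 1 & g (x + v) - g x = 'D_v g (x + c *: v).
Proof.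
move=> dg.
have [|||c] := @MVT R (fun s => g (x + s *: v)) (fun s => 'D_v g (x + s *: v)) 0 1.
- exact: ltr01.
- move=> t; rewrite in_itv /= => /andP[t0 t1]; apply: derive_line.
  by apply: dg; rewrite !ltW.
- apply: derivable_within_continuous => t; rewrite in_itv /= => t01.
  by have [] := derive_line (dg t t01).
rewrite in_itv /= => c01; rewrite scale1r scale0r addr0 subr0 mulr1 => E.
by exists c.
Qed.

(** Differentiability is asked near [x], continuity of the derivatives only at [x]. The condition is
    attached to a single point, is stable under the algebraic operations and suffices for mean value
    estimates around [x]. *)
Definition C1at (g : V -> R) (x : V) :=
  (\forall y \near x, differentiable g y) /\ forall v, {for x, continuous ('D_v g)}.

Lemma C1at_diff g x : C1at g x -> differentiable g x.
Proof. by move=> [/nbhs_singleton]. Qed.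

Lemma C1at_cont g x : C1at g x -> {for x, continuous g}.
Proof. by move=> /C1at_diff /differentiable_continuous. Qed.

Lemma C1at_derivable g x v : C1at g x -> derivable g x v.
Proof. by move=> /C1at_diff /diff_derivable. Qed.

Lemma near_eq_D f g x v : (\forall y \near x, f y = g y) -> 'D_v f x = 'D_v g x.
Proof.
have [->|v0] := eqVneq v 0; first by rewrite !derive0.
by move=> fg; apply: near_eq_derive.
Qed.

Lemma near_eq_differentiable (W : normedModType R) (f g : V -> W) x :
  (\forall y \near x, f y = g y) -> differentiable f x -> differentiable g x.
Proof.
move=> fg df.
have gx := nbhs_singleton fg.
have cdf := diff_continuous df.
have H : g \o shift x = cst (g x) + 'd f x +o_ 0 id.
  apply/eqaddoP => e e0.
  have /eqaddoP /(_ e e0) fH := diff_locally df.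
  have fg0 : \forall h \near (0 : V), f (h + x) = g (h + x).
    by move: fg; rewrite (near_shift 0) /=; apply: filterS => h /=; rewrite subr0.
  near=> h.
  have fgh : f (h + x) = g (h + x) by near: h.
  have : `|(f \o shift x - (cst (f x) + 'd f x)) h| <= e * `|id h| by near: h.
  by rewrite !fctE /= fgh gx.
have E : 'd g x = 'd f x :> (V -> W) by apply: diff_unique.
by apply/diff_locallyP; rewrite E.
Unshelve. all: by end_near. Qed.

Lemma C1at_near_eq f g x : (\forall y \near x, f y = g y) -> C1at f x -> C1at g x.
Proof.
move=> fg [df cf]; have fg2 := near_join fg; split.
  near=> y; have fgy : \forall z \near y, f z = g z by near: y.
  by apply: near_eq_differentiable fgy _; near: y.
move=> v; apply: cvg_trans; last first.
  rewrite -(near_eq_D v fg); exact: (cf v).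
apply: near_eq_cvg; near=> y.
by apply: near_eq_D; near: y.
Unshelve. all: by end_near. Qed.

Lemma C1at_near g x : C1at g x -> (forall v, \forall y \near x, derivable g y v).
Proof. by move=> [d _] v; apply: filterS d => y; exact: diff_derivable. Qed.

Lemma C1at_intro g (D : V -> V -> R) x :
  (\forall y \near x, differentiable g y) ->
  (forall v, \forall y \near x, 'D_v g y = D v y) ->
  (forall v, {for x, continuous (D v)}) -> C1at g x.
Proof.
move=> dg gD cD; split=> // v; have h := gD v.
rewrite /prop_for /continuous_at (nbhs_singleton h).
apply: cvg_trans; last exact: cD.
by apply: near_eq_cvg; apply: filterS h => y ->.
Qed.

Lemma C1at_cst (c : R) x : C1at (cst c) x.
Proof.
apply: (@C1at_intro _ (fun _ _ => 0)) => [|v|v].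
- by near=> y; exact: differentiable_cst.
- by near=> y; exact: derive_cst.
- exact: cst_continuous.
Unshelve. all: by end_near. Qed.

Lemma C1atD f g x : C1at f x -> C1at g x -> C1at (fun y => f y + g y) x.
Proof.
move=> cf cg; apply: (@C1at_intro _ (fun v y => 'D_v f y + 'D_v g y)) => [|v|v].
- by near=> y; apply: differentiableD; near: y; [exact: cf.1|exact: cg.1].
- by apply: filterS2 (C1at_near cf v) (C1at_near cg v) => y; exact: deriveD.
- by apply: cvgD; [exact: cf.2|exact: cg.2].
Unshelve. all: by end_near. Qed.

Lemma C1atM f g x : C1at f x -> C1at g x -> C1at (fun y => f y * g y) x.
Proof.
move=> cf cg.
apply: (@C1at_intro _ (fun v y => f y * 'D_v g y + g y * 'D_v f y)) => [|v|v].
- by near=> y; apply: differentiableM; near: y; [exact: cf.1|exact: cg.1].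
- by apply: filterS2 (C1at_near cf v) (C1at_near cg v) => y; exact: deriveM.
- apply: cvgD; apply: cvgM.
  + exact: C1at_cont.
  + exact: cg.2.
  + exact: C1at_cont.
  + exact: cf.2.
Unshelve. all: by end_near. Qed.

Lemma C1atZ f (c : R) x : C1at f x -> C1at (fun y => c * f y) x.
Proof. by move=> cf; exact: (@C1atM (cst c) f x (C1at_cst c x) cf). Qed.

Lemma C1atN f x : C1at f x -> C1at (fun y => - f y) x.
Proof.
move=> cf; rewrite (_ : (fun y => - f y) = (fun y => -1 * f y)); first exact: C1atZ.
by apply/funext => y; rewrite mulN1r.
Qed.

Lemma C1atB f g x : C1at f x -> C1at g x -> C1at (fun y => f y - g y) x.
Proof. by move=> cf cg; exact: C1atD cf (C1atN cg). Qed.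

Lemma C1at_sum (I : Type) (r : seq I) (P : pred I) (f : I -> V -> R) x :
  (forall i, P i -> C1at (f i) x) -> C1at (fun y => \sum_(i <- r | P i) f i y) x.
Proof.
move=> cf; elim: r => [|i r IH].
  rewrite (_ : (fun _ => _) = cst 0); first exact: C1at_cst.
  by apply/funext => y; rewrite big_nil.
rewrite (_ : (fun _ => _) = (fun y => (if P i then f i y else 0) +
  \sum_(i <- r | P i) f i y)); last first.
  by apply/funext => y; rewrite big_cons; case: ifP; rewrite ?add0r.
by apply: C1atD IH; case: (boolP (P i)) => Pi; [exact: cf|exact: C1at_cst].
Qed.

Lemma C1at_prod (I : Type) (r : seq I) (P : pred I) (f : I -> V -> R) x :
  (forall i, P i -> C1at (f i) x) -> C1at (fun y => \prod_(i <- r | P i) f i y) x.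
Proof.
move=> cf; elim: r => [|i r IH].
  rewrite (_ : (fun _ => _) = cst 1); first exact: C1at_cst.
  by apply/funext => y; rewrite big_nil.
rewrite (_ : (fun _ => _) = (fun y => (if P i then f i y else 1) *
  \prod_(i <- r | P i) f i y)); last first.
  by apply/funext => y; rewrite big_cons; case: ifP; rewrite ?mul1r.
by apply: C1atM IH; case: (boolP (P i)) => Pi; [exact: cf|exact: C1at_cst].
Qed.

Lemma C1at_det n (A : V -> 'M[R]_n) x :
  (forall i j, C1at (fun y => A y i j) x) -> C1at (fun y => \det (A y)) x.
Proof.
move=> cA; rewrite /determinant; apply: C1at_sum => s _; apply: C1atZ.
by apply: C1at_prod => i _; exact: cA.
Qed.

Lemma is_derive_comp1 g (phi : R -> R) (d : R) x v : differentiable g x ->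
  is_derive (g x) 1 phi d ->
  differentiable (phi \o g) x /\ 'D_v (phi \o g) x = d * 'D_v g x.
Proof.
move=> dg [dphi phiE].
have dphi' : differentiable phi (g x) by exact/derivable1_diffP.
have dc : differentiable (phi \o g) x by exact: differentiable_comp.
split=> //; rewrite deriveE // diff_comp //= deriveE //.
have -> : 'd g x v = 'd g x v *: (1 : R) by rewrite [_ *: _]mulr1.
by rewrite linearZ /= -['d phi (g x) 1]deriveE // phiE [_ *: 1]mulr1 [LHS]mulrC.
Qed.

Lemma C1at_comp g (phi dphi : R -> R) x : C1at g x ->
  (\forall t \near g x, is_derive (t : R) 1 phi (dphi t)) ->
  {for g x, continuous dphi} -> C1at (phi \o g) x.
Proof.
move=> cg dp cp.
have dp' : \forall y \near x, is_derive (g y) 1 phi (dphi (g y)).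
  have := C1at_cont cg; move=> /(_ _ dp) h.
  exact: h.
apply: (@C1at_intro _ (fun v y => dphi (g y) * 'D_v g y)) => [|v|v].
- near=> y; apply: (proj1 (@is_derive_comp1 g phi (dphi (g y)) y 0 _ _)).
    by near: y; exact: cg.1.
  by near: y.
- near=> y; apply: (proj2 (@is_derive_comp1 g phi (dphi (g y)) y v _ _)).
    by near: y; exact: cg.1.
  by near: y.
- apply: cvgM; last exact: cg.2.
  apply: (@continuous_comp _ _ _ g dphi) => //; exact: C1at_cont.
Unshelve. all: by end_near. Qed.

Lemma C1atV g x : C1at g x -> g x != 0 -> C1at (fun y => (g y)^-1) x.
Proof.
move=> cg g0; apply: (@C1at_comp g (@GRing.inv R) (fun t => - (t ^- 2))) => //.
  have : \forall t \near g x, t != 0.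
    by apply: open_nbhs_nbhs; split => //; exact: open_neq.
  apply: filterS => t t0.
  have := @is_deriveV R id t 1 1 t0 (is_derive_id _ _).
  by rewrite [_ *: 1]mulr1.
apply: cvgN; apply: cvgV; first by rewrite expf_neq0.
exact: exprn_continuous.
Qed.

Lemma C1at_sqrt g x : C1at g x -> 0 < g x -> C1at (fun y => Num.sqrt (g y)) x.
Proof.
move=> cg g0; apply: (@C1at_comp g Num.sqrt (fun t => (2 * Num.sqrt t)^-1)) => //.
  have : \forall t \near g x, 0 < t.
    by apply: open_nbhs_nbhs; split => //; exact: open_gt.
  by apply: filterS => t t0; exact: is_derive1_sqrt.
apply: cvgV; first by rewrite mulf_neq0 // sqrtr_eq0 -ltNge.
apply: cvgM; [exact: cvg_cst|exact: sqrt_continuous].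
Qed.

End Lines.

(** * The squared positive part *)

Section PositivePart.
Variable R : realType.

(** A one-sided cutoff with exactly one continuous derivative, enough both for bumps and for
    truncating the normal. *)
Definition sqpos (t : R) := Num.max t 0 ^+ 2.

Lemma sqpos_derive (t : R) : is_derive t 1 sqpos (2 * Num.max t 0).
Proof.
have [t0|t0|t0] := ltgtP t 0.
- rewrite mulr0; apply: (@near_eq_is_derive _ _ _ (cst 0)).
  have : \forall s \near t, s < 0 by apply: open_nbhs_nbhs; split => //; exact: open_lt.
  by apply: filterS => s s0; rewrite /sqpos max_r ?ltW // expr0n.
- have d2 : is_derive t 1 (fun s : R => s ^+ 2) (2 * t).
    have := @is_deriveX R R id 2 t 1 1 (is_derive_id _ _).
    by rewrite /= expr1 [_ *: 1]mulr1 -mulr_natl.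
  apply: near_eq_is_derive d2.
  have : \forall s \near t, 0 < s by apply: open_nbhs_nbhs; split => //; exact: open_gt.
  by apply: filterS => s s0; rewrite /sqpos max_l ?ltW.
- rewrite t0 mulr0.
  have E : (fun h : R => h^-1 *: ((sqpos \o shift 0) (h *: (1 : R)) - sqpos 0)) @ 0^' --> (0 : R).
    apply/cvgrPdist_lt => e e0; near=> h.
    rewrite /sqpos /= addr0 [h *: 1]mulr1 maxxx expr0n subr0 sub0r normrN.
    have h0 : h != 0 by near: h; exact: nbhs_dnbhs_neq.
    have he : `|h| < e by near: h; exact: dnbhs0_lt.
    apply: le_lt_trans he; rewrite normrZ normrX normfV.
    rewrite -ler_pdivlMl ?invr_gt0 ?normr_gt0 // invrK -expr2.
    rewrite lerXn2r ?nnegrE ?normr_ge0 //.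
    by case: (leP h 0) => _; rewrite ?normr0.
  by apply: DeriveDef; [apply/cvg_ex; exists 0|apply: cvg_lim].
Unshelve. all: by end_near. Qed.

End PositivePart.

(** * Derivatives of matrix-valued functions *)

Section MatrixCalculus.
Variables (R : realType) (V : normedModType R).

Definition dermx m n (v : V) (A : V -> 'M[R]_(m, n)) (x : V) : 'M[R]_(m, n) :=
  \matrix_(i, j) 'D_v (fun y => A y i j) x.

Definition derivmx m n (v : V) (A : V -> 'M[R]_(m, n)) (x : V) :=
  forall i j, derivable (fun y => A y i j) x v.

Lemma derive_suml (I : Type) (r : seq I) (f : I -> V -> R) (x v : V) :
  (forall i, derivable (f i) x v) ->
  derivable (fun y => \sum_(i <- r) f i y) x v /\
  'D_v (fun y => \sum_(i <- r) f i y) x = \sum_(i <- r) 'D_v (f i) x.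
Proof.
move=> df; elim: r => [|i r [IH1 IH2]].
  rewrite big_nil (_ : (fun _ => _) = cst 0).
    by split; [exact: derivable_cst|exact: derive_cst].
  by apply/funext => y; rewrite big_nil.
rewrite big_cons (_ : (fun _ => _) = f i \+ (fun y => \sum_(j <- r) f j y)).
  by split; [exact: derivableD (df i) IH1|rewrite (deriveD (df i) IH1) IH2].
by apply/funext => y; rewrite big_cons.
Qed.

Lemma dermxM m n p (A : V -> 'M[R]_(m, n)) (B : V -> 'M[R]_(n, p)) x v :
  derivmx v A x -> derivmx v B x ->
  derivmx v (fun y => A y *m B y) x /\
  dermx v (fun y => A y *m B y) x = dermx v A x *m B x + A x *m dermx v B x.
Proof.
move=> dA dB.
have E i j : (fun y => (A y *m B y) i j) = fun y => \sum_k (A y i k * B y k j).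
  by apply/funext => y; rewrite mxE.
have dk i j k : derivable (fun y => A y i k * B y k j) x v by exact: derivableM.
have H i j := derive_suml (index_enum 'I_n) (dk i j).
split=> [i j|]; first by rewrite E; exact: (H i j).1.
apply/matrixP => i j; rewrite !mxE E (H i j).2 -big_split /=.
apply: eq_bigr => k _; rewrite !mxE (deriveM (dA i k) (dB k j)) addrC; congr (_ + _).
exact: mulrC.
Qed.

Lemma dermx_trmx m n (A : V -> 'M[R]_(m, n)) x v :
  dermx v (fun y => (A y)^T) x = (dermx v A x)^T.
Proof.
by apply/matrixP => i j; rewrite !mxE; congr ('D_v _ x); apply/funext => y; rewrite mxE.
Qed.

Lemma derivmx_trmx m n (A : V -> 'M[R]_(m, n)) x v :
  derivmx v A x -> derivmx v (fun y => (A y)^T) x.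
Proof.
move=> dA i j; rewrite (_ : (fun y => _) = fun y => A y j i) //.
by apply/funext => y; rewrite mxE.
Qed.

Lemma dermx_near m n (A B : V -> 'M[R]_(m, n)) x v :
  (\forall y \near x, A y = B y) -> dermx v A x = dermx v B x.
Proof.
move=> AB; apply/matrixP => i j; rewrite !mxE; apply: near_eq_D.
by apply: filterS AB => y ->.
Qed.

Lemma dermx_cst m n (A : 'M[R]_(m, n)) x v : dermx v (fun=> A) x = 0.
Proof. by apply/matrixP => i j; rewrite !mxE derive_cst. Qed.

Lemma dermx_scalar n (a : V -> R) x v : dermx v (fun y => (a y)%:M : 'M[R]_n) x = ('D_v a x)%:M.
Proof.
apply/matrixP => i j; rewrite !mxE; case: eqVneq => ij.
  by rewrite mulr1n; congr ('D_v _ x); apply/funext => y; rewrite !mxE ij eqxx mulr1n.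
rewrite mulr0n -[RHS](derive_cst (0 : R) x v); congr ('D_v _ x).
by apply/funext => y; rewrite !mxE (negbTE ij) mulr0n.
Qed.

Lemma derive_prod (I : eqType) (r : seq I) (f : I -> V -> R) (x v : V) : uniq r ->
  (forall i, derivable (f i) x v) ->
  derivable (fun y => \prod_(i <- r) f i y) x v /\
  'D_v (fun y => \prod_(i <- r) f i y) x =
  \sum_(i <- r) \prod_(k <- r) (if k == i then 'D_v (f k) x else f k x).
Proof.
move=> ur df; elim: r ur => [_|i r IH /= /andP[ir ur]].
  rewrite big_nil (_ : (fun _ => _) = cst 1).
    by split; [exact: derivable_cst|exact: derive_cst].
  by apply/funext => y; rewrite big_nil.
have [IH1 IH2] := IH ur.
rewrite (_ : (fun _ => _) = (fun y => f i y * \prod_(j <- r) f j y)); last first.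
  by apply/funext => y; rewrite big_cons.
split; first exact: derivableM (df i) IH1.
rewrite (deriveM (df i) IH1) IH2 !big_cons eqxx addrC; congr (_ + _).
  rewrite [LHS]mulrC; congr (_ * _); apply: eq_big_seq => k kr.
  by case: eqP kr ir => // -> ->.
rewrite [LHS]mulr_sumr; apply: eq_big_seq => k kr; rewrite big_cons.
by case: eqP kr ir => // -> ->.
Qed.

(** Jacobi's formula. Leibniz' expansion is differentiated one row at a time; each resulting
    determinant is expanded along the differentiated row, whose cofactors are those of [A x]. *)
Lemma derive_det n (A : V -> 'M[R]_n) x v : derivmx v A x ->
  'D_v (fun y => \det (A y)) x = \tr (\adj (A x) *m dermx v A x).
Proof.
move=> dA.
have H (s : 'S_n) := @derive_prod _ (index_enum 'I_n) (fun i y => A y i (s i)) x v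
  (index_enum_uniq _) (fun i => dA i (s i)).
have H2 (s : 'S_n) : derivable (fun y => (-1) ^+ s * \prod_i A y i (s i)) x v.
  by apply: derivableM => //; exact: (H s).1.
rewrite /determinant.
have [_ ->] := derive_suml (index_enum _) H2.
transitivity (\sum_(s : 'S_n) \sum_i (-1) ^+ s * \prod_k
    (if k == i then dermx v A x k (s k) else A x k (s k))).
  apply: eq_bigr => s _.
  have -> : 'D_v (fun y => (-1) ^+ s * \prod_i A y i (s i)) x =
            (-1) ^+ s * 'D_v (fun y => \prod_i A y i (s i)) x.
    by rewrite deriveMl //; exact: (H s).1.
  rewrite (H s).2 mulr_sumr; apply: eq_bigr => i _; congr (_ * _).
  by apply: eq_bigr => k _; case: eqP => // _; rewrite mxE.
rewrite exchange_big /= mxtrace_mulC /mxtrace; apply: eq_bigr => i _.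
pose B := \matrix_(k, j) (if k == i then dermx v A x k j else A x k j).
transitivity (\det B).
  by apply: eq_bigr => s _; congr (_ * _); apply: eq_bigr => k _; rewrite [RHS]mxE.
rewrite (expand_det_row _ i) mxE; apply: eq_bigr => j _.
rewrite /B mxE eqxx; congr (_ * _); rewrite mxE /cofactor; congr (_ * \det _).
by apply/matrixP => k l; rewrite !mxE eq_sym (negbTE (neq_lift i k)).
Qed.

Lemma derive_sqrt (g : V -> R) x v : differentiable g x -> 0 < g x ->
  'D_v (fun y => Num.sqrt (g y)) x = (2 * Num.sqrt (g x))^-1 * 'D_v g x.
Proof.
by move=> dg g0; have [_] := is_derive_comp1 v dg (is_derive1_sqrt g0).
Qed.

End MatrixCalculus.

(** * Symmetry of second derivatives *)

Section Schwarz.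
Variables (R : realType) (V : normedModType R).

Lemma derive_translate (F : V -> R) (u x v : V) : derivable F (x + u) v ->
  derivable (fun y => F (y + u)) x v /\ 'D_v (fun y => F (y + u)) x = 'D_v F (x + u).
Proof.
move=> dF.
have E : (fun h : R => h^-1 *: (((fun y => F (y + u)) \o shift x) (h *: v) - F (x + u))) =
         (fun h : R => h^-1 *: ((F \o shift (x + u)) (h *: v) - F (x + u))).
  by apply/funext => h /=; rewrite addrA.
by split; [rewrite /derivable E|rewrite /derive E].
Qed.

(** The mean value theorem is applied twice: along [v] to the increment of [F] in the direction [w],
    then along [w] to the derivative of [F] along [v]. So [z] is the mixed derivative at a nearby
    point. *)
Let mixed_quotient (F : V -> R) (x v w : V) : C1at F x -> C1at ('D_v F) x ->
  forall e, 0 < e -> exists2 r, 0 < r & forall t, 0 < t < r -> exists z,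
   `|'D_w ('D_v F) x - z| < e /\
   F (x + t *: v + t *: w) - F (x + t *: v) - F (x + t *: w) + F x = t ^+ 2 * z.
Proof.
move=> cF cDF e e0.
have /cvgrPdist_lt /(_ e e0) : {for x, continuous ('D_w ('D_v F))} by exact: cDF.2.
move=> n1.
have /nbhs_ballP [r0 /= r00 H] : \forall y \near x,
    [/\ `|'D_w ('D_v F) x - 'D_w ('D_v F) y| < e, differentiable F y
      & differentiable ('D_v F) y].
  near=> y; split; near: y; [exact: n1|exact: cF.1|exact: cDF.1].
pose K := `|v| + `|w| + 1.
have K0 : 0 < K by rewrite /K ltr_wpDl // addr_ge0.
exists (r0 / K); first by rewrite divr_gt0.
move=> t /andP[t0 tr].
have inb a b : 0 <= a <= 1 -> 0 <= b <= 1 -> ball x r0 (x + a *: (t *: v) + b *: (t *: w)).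
  move=> /andP[a0 a1] /andP[b0 b1]; rewrite -ball_normE /= -addrA opprD addrA subrr sub0r normrN.
  apply: le_lt_trans (ler_normD _ _) _; rewrite !normrZ !ger0_norm // ?ltW //.
  apply: (@le_lt_trans _ _ (t * (`|v| + `|w|))).
    rewrite mulrDr lerD // !mulrA ler_wpM2r // ler_piMl // ltW //.
  move: tr; rewrite ltr_pdivlMr // => tr; apply: le_lt_trans tr.
  by apply: ler_wpM2l; [exact: ltW|rewrite /K lerDl].
have r01 : 0 <= (0 : R) <= 1 by rewrite lexx ler01.
have r11 : 0 <= (1 : R) <= 1 by rewrite lexx ler01.
pose G y := F (y + t *: w) - F y.
have dG a : 0 <= a <= 1 -> derivable G (x + a *: (t *: v)) (t *: v).
  move=> a01; apply: derivableB.
    have [_ d _] := H _ (inb a 1 a01 r11); rewrite scale1r in d.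
    by have [] := derive_translate (@diff_derivable _ _ _ _ _ (t *: v) d).
  apply: diff_derivable.
  by have [_ d _] := H _ (inb a 0 a01 r01); rewrite scale0r addr0 in d.
have [c1 /andP[c10 c11] E1] := mvt_line dG.
have c1b : 0 <= c1 <= 1 by rewrite !ltW.
pose y1 := x + c1 *: (t *: v).
have DvF a y : differentiable F y -> 'D_(a *: v) F y = a * 'D_v F y.
  by move=> d; rewrite !deriveE // linearZ.
have [d1 d0] : differentiable F (y1 + t *: w) /\ differentiable F y1.
  have [_ d _] := H _ (inb c1 1 c1b r11); have [_ d' _] := H _ (inb c1 0 c1b r01).
  by rewrite scale1r in d; rewrite scale0r addr0 in d'.
have E2 : 'D_(t *: v) G y1 = t * ('D_v F (y1 + t *: w) - 'D_v F y1).
  have -> : 'D_(t *: v) G y1 = 'D_(t *: v) F (y1 + t *: w) - 'D_(t *: v) F y1.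
    have [dd <-] := derive_translate (@diff_derivable _ _ _ _ _ (t *: v) d1).
    by rewrite (deriveB dd (@diff_derivable _ _ _ _ _ (t *: v) d0)).
  by rewrite !DvF // mulrBr.
have dDv b : 0 <= b <= 1 -> derivable ('D_v F) (y1 + b *: (t *: w)) (t *: w).
  by move=> b01; apply: diff_derivable; have [] := H _ (inb c1 b c1b b01).
have [c2 /andP[c20 c21] E3] := mvt_line dDv.
have c2b : 0 <= c2 <= 1 by rewrite !ltW.
have [h1 _ h3] := H _ (inb c1 c2 c1b c2b).
exists ('D_w ('D_v F) (y1 + c2 *: (t *: w))); split=> //.
have -> : F (x + t *: v + t *: w) - F (x + t *: v) - F (x + t *: w) + F x =
          G (x + t *: v) - G x by rewrite /G; ring.
by rewrite E1 -/y1 E2 E3 deriveE // linearZ /= -deriveE // mulrA -expr2.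
Unshelve. all: by end_near. Qed.

(** The second difference of [F] is symmetric in [v] and [w], so one and the same number lies within
    [e / 2] of both mixed derivatives. *)
Lemma schwarz (F : V -> R) (x v w : V) :
  C1at F x -> C1at ('D_v F) x -> C1at ('D_w F) x ->
  'D_w ('D_v F) x = 'D_v ('D_w F) x.
Proof.
move=> cF cv cw; apply/eqP; rewrite -subr_eq0 -normr_le0; apply/ler_addgt0Pr => e e0.
rewrite add0r; have e2 : 0 < e / 2 by rewrite divr_gt0.
have [r1 r10 H1] := mixed_quotient w cF cv e2.
have [r2 r20 H2] := mixed_quotient v cF cw e2.
pose t := Num.min r1 r2 / 2.
have m0 : 0 < Num.min r1 r2 by rewrite lt_min r10.
have t0 : 0 < t by rewrite divr_gt0.
have tm : t < Num.min r1 r2 by rewrite ltr_pdivrMr // ltr_pMr // ltr1n.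
have [|z1 [h1 E1]] := H1 t; first by rewrite t0 (lt_le_trans tm) // ge_min lexx.
have [|z2 [h2 E2]] := H2 t; first by rewrite t0 (lt_le_trans tm) // ge_min lexx orbT.
have zz : z1 = z2.
  apply: (@mulfI _ (t ^+ 2)); first by rewrite expf_neq0 // gt_eqF.
  rewrite -E1 -E2 (addrAC x); ring.
have sub3 (a b c : R) : a - b = (a - c) - (b - c) by ring.
rewrite zz in h1; rewrite (sub3 ('D_w ('D_v F) x) ('D_v ('D_w F) x) z2).
apply: le_trans (ler_normB _ _) _; rewrite [e]splitr; exact: lerD (ltW h1) (ltW h2).
Qed.

End Schwarz.

(** * Integrals of derivatives, strict differentiability, immersions *)

Section EuclideanCalculus.
Variable R : realType.

Lemma coord_norm n (x : 'rV[R]_n) i : `|x 0 i| <= `|x|.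
Proof.
by rewrite [leRHS]mx_normrE; exact: (le_bigmax _ (fun ij => `|x ij.1 ij.2|) (0, i)).
Qed.

Lemma norm_le_coord n (x : 'rV[R]_n) (c : R) : 0 <= c -> (forall i, `|x 0 i| <= c) -> `|x| <= c.
Proof.
move=> c0 h; rewrite [leLHS]mx_normrE; apply/bigmax_leP; split=> // -[i j] _.
by rewrite ord1 h.
Qed.

Lemma Cc_derive n (B : R) (F : 'rV[R]_n -> R) (v : 'rV[R]_n) :
  (forall x, C1at F x) -> (forall x, B < `|x| -> F x = 0) -> Cc B ('D_v F).
Proof.
move=> cF F0; split=> [x|x Bx]; first exact: (cF x).2.
rewrite -(derive_cst (0 : R) x v); apply: near_eq_D.
have : \forall y \near x, B < `|y|.
  have := @norm_continuous _ _ x; move=> /(_ [set t | B < t]); apply.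
  by apply: open_nbhs_nbhs; split => //; exact: open_gt.
by apply: filterS => y /F0.
Qed.

(** The derivative is a uniform limit of difference quotients with a common bounded support, and
    each quotient has integral 0 by translation invariance. *)
Lemma itint_derive0 n (B : R) (F : 'rV[R]_n -> R) (v : 'rV[R]_n) : 0 <= B ->
  (forall x, C1at F x) -> (forall x, B < `|x| -> F x = 0) -> itint ('D_v F) = 0.
Proof.
move=> B0 cF F0.
have ccF : Cc B F by split=> // x; exact: C1at_cont.
have ccD : Cc B ('D_v F) by exact: Cc_derive.
apply/eqP; rewrite -normr_le0; apply/ler_addgt0Pr => e e0; rewrite add0r.
pose B' := B + `|v| + 1.
have BB' : B <= B' by rewrite /B' -addrA lerDl addr_ge0.
have B'0 : 0 <= B' by exact: le_trans BB'.
pose K := (2 * B') ^+ n + 1.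
have K0 : 0 < K by rewrite ltr_wpDl // exprn_ge0 // mulr_ge0.
have [d d0 H] := Cc_unif ccD (divr_gt0 e0 K0).
(* At most 1, so that the translate keeps its support in the ball of radius [B'], and small enough
   for [s *: v] to stay below the modulus of continuity [d]. *)
pose s := Num.min 1 (d / (2 * (`|v| + 1))).
have v1 : 0 < `|v| + 1 by rewrite ltr_wpDl.
have s0 : 0 < s by rewrite lt_min ltr01 divr_gt0 // mulr_gt0.
have s1 : s <= 1 by rewrite ge_min lexx.
have sd : s * `|v| < d.
  apply: (@le_lt_trans _ _ (s * (`|v| + 1))).
    by rewrite ler_pM2l // lerDl.
  rewrite -ltr_pdivlMr //; apply: (@le_lt_trans _ _ (d / (2 * (`|v| + 1)))).
    by rewrite ge_min lexx orbT.
  by rewrite invfM mulrA ltr_pM2r ?invr_gt0 // ltr_pdivrMr // ltr_pMr // ltr1n.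
have sv : `|s *: v| <= `|v| by rewrite normrZ gtr0_norm // ler_piMl.
have ccS : Cc B' (fun x => F (x + s *: v)).
  apply: Cc_le (Cc_shift _ ccF).
  by rewrite /B' -addrA lerD2l (le_trans sv) // lerDl.
have E : itint (fun x => - s^-1 * (F (x + s *: v) - F x) + 'D_v F x) = itint ('D_v F).
  transitivity (- s^-1 * itint (fun x => -1 * F x + F (x + s *: v)) + itint ('D_v F)).
    rewrite -(@itint_lin _ _ B').
    + by congr itint; apply/funext => x; rewrite mulN1r [- F x + _]addrC.
    + have [[c1 z1] [c2 z2]] := (Cc_le BB' ccF, ccS).
      by split=> [|x Bx]; [exact: continuous_comb|rewrite z1 // z2 // mulr0 addr0].
    + exact: Cc_le ccD.
  rewrite (@itint_lin _ _ B') //; last exact: Cc_le ccF.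
  by rewrite (@itint_shift _ _ B) // mulN1r addNr mulr0 add0r.
rewrite -E.
apply: le_trans (@itint_bound _ _ B' (e / K) _ B'0 _ _) _.
- have [[c1 z1] [c2 z2]] := (Cc_le BB' ccF, ccS).
  have [c3 z3] := Cc_le BB' ccD.
  split=> [|x Bx]; last by rewrite (z1 x) // z2 // z3 // subrr mulr0 addr0.
  apply: continuous_comb => //.
  rewrite (_ : (fun x => _) = (fun x => -1 * F x + F (x + s *: v))).
    exact: continuous_comb.
  by apply/funext => x; rewrite mulN1r addrC.
- move=> x.
  have [|c /andP[c0 c1] Ec] := @mvt_line R _ F x (s *: v).
    by move=> t _; exact: C1at_derivable.
  have Dsv y : 'D_(s *: v) F y = s * 'D_v F y.
    by rewrite !deriveE ?linearZ //; exact: C1at_diff.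
  rewrite Ec Dsv mulNr mulKf ?gt_eqF // addrC; apply/ltW/H.
  rewrite opprD addrA subrr sub0r normrN scalerA normrZ.
  apply: le_lt_trans sd; rewrite ler_wpM2r // normrM !gtr0_norm //.
  by rewrite ler_piMl // ltW.
- rewrite mulrCA ler_piMr ?(ltW e0) // ler_pdivrMr // mul1r /K lerDl.
  exact: ler01.
Qed.

Lemma derive_rV n (g : 'rV[R]_n -> R) x (v : 'rV[R]_n) : differentiable g x ->
  'D_v g x = \sum_i v 0 i * 'D_(delta_mx 0 i) g x.
Proof.
move=> dg; rewrite deriveE // {1}(row_sum_delta v) linear_sum.
by apply: eq_bigr => i _; rewrite linearZ /= -deriveE.
Qed.

(** Both endpoints move, unlike in the definition of the derivative at [x]: the mean value theorem
    on the segment compares partial derivatives at an intermediate point with those at [x]. The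
    estimates on secants depend on this uniformity. *)
Lemma strict_diff n (g : 'rV[R]_n -> R) x : C1at g x -> forall e, 0 < e ->
  \forall r \near (0 : R)^'+, forall y y', ball x r y -> ball x r y' ->
    `|g y - g y' - 'D_(y - y') g x| <= e * `|y - y'|.
Proof.
move=> cg e e0.
pose e' := e / (n%:R + 1).
have n1 : 0 < n%:R + 1 :> R by rewrite ltr_wpDl.
have e'0 : 0 < e' by rewrite divr_gt0.
have /nbhs_ballP [r0 /= r00 H] : \forall y \near x, differentiable g y /\
    forall i : 'I_n, `|'D_(delta_mx 0 i) g x - 'D_(delta_mx 0 i) g y| < e'.
  near=> y; split; first by near: y; exact: cg.1.
  near: y; apply: filter_forall => i.
  by have /cvgrPdist_lt /(_ _ e'0) := cg.2 (delta_mx 0 i).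
near=> r => y y' xy xy'.
have rr0 : r <= r0 by near: r; exact: nbhs_right_le.
have seg t : 0 <= t <= 1 -> ball x r0 (y' + t *: (y - y')).
  move=> /andP[t0 t1]; apply: (le_ball rr0).
  move: xy xy'; rewrite -!ball_normE /= => xy xy'.
  rewrite (_ : x - _ = t *: (x - y) + (1 - t) *: (x - y')); last first.
    by apply/rowP => i; rewrite !mxE; ring.
  apply: le_lt_trans (ler_normD _ _) _; rewrite !normrZ !ger0_norm ?subr_ge0 //.
  have [->|tn0] := eqVneq t 0; first by rewrite mul0r subr0 mul1r add0r.
  rewrite (_ : r = t * r + (1 - t) * r); last by ring.
  apply: ltr_leD; first by rewrite ltr_pM2l // lt_def tn0.
  by rewrite ler_wpM2l ?subr_ge0 // ltW.
have [|c /andP[c0 c1]] := @mvt_line R _ g y' (y - y').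
  by move=> t /seg /H [d _]; exact: diff_derivable.
rewrite [y' + (y - y')]addrC subrK => ->.
have c01 : 0 <= c <= 1 by rewrite !ltW.
have [dc Hc] := H _ (seg c c01).
have [dx _] := H _ (ballxx x r00).
rewrite !derive_rV // -sumrB.
apply: le_trans (ler_norm_sum _ _ _) _.
apply: (@le_trans _ _ (\sum_(i < n) e' * `|y - y'|)).
  apply: ler_sum => i _; rewrite -mulrBr normrM mulrC ler_pM //; last exact: coord_norm.
  by rewrite distrC ltW.
rewrite sumr_const card_ord -mulr_natl mulrA ler_wpM2r // /e' mulrCA.
by rewrite ler_piMr ?(ltW e0) // ler_pdivrMr // mul1r lerDl ler01.
Unshelve. all: by end_near. Qed.

Lemma mulmx_norm_le m n (A : 'M[R]_(m, n)) :
  exists2 K, 0 < K & forall u : 'rV[R]_m, `|u *m A| <= K * `|u|.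
Proof.
pose K := \sum_i \sum_j `|A i j| + 1.
have K0 : 0 < K by rewrite /K ltr_wpDl // !sumr_ge0 // => i _; rewrite sumr_ge0.
exists K => // u; apply: norm_le_coord => [|j]; first by rewrite mulr_ge0 // ltW.
rewrite mxE; apply: le_trans (ler_norm_sum _ _ _) _.
apply: (@le_trans _ _ ((\sum_i \sum_j `|A i j|) * `|u|)).
  rewrite mulr_suml; apply: ler_sum => i _; rewrite normrM mulrC.
  apply: ler_pM => //; last exact: coord_norm.
  by rewrite (bigD1 j) //= lerDl sumr_ge0.
by rewrite ler_wpM2r // /K lerDl.
Qed.

Lemma jacobianE n m (F : 'rV[R]_n -> 'rV[R]_m) x i j : differentiable F x ->
  'J F x i j = 'D_(delta_mx 0 i) (fun y => F y 0 j) x.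
Proof.
move=> dF; have -> : 'J F x i j = ((delta_mx 0 i : 'rV[R]_n) *m 'J F x) 0 j.
  by rewrite -rowE [RHS]mxE.
rewrite -deriveEjacobian // derive_mx; last exact: diff_derivable.
by rewrite mxE.
Qed.

(** A right inverse of the Jacobian bounds [y - y'] by its image under the linear part. The error of
    strict differentiability at level [(2 * K)^-1] costs half of [y - y'], which is absorbed on the
    left. *)
Lemma immersion_bound n m (F : 'rV[R]_n -> 'rV[R]_m) x :
  (forall j, C1at (fun y => F y 0 j) x) -> differentiable F x -> row_free ('J F x) ->
  exists2 c, 0 < c & \forall r \near (0 : R)^'+, forall y y', ball x r y -> ball x r y' ->
    c * `|y - y'| <= `|F y - F y'|.
Proof.
move=> cF dF /row_freeP [B JB].
have [K K0 KB] := mulmx_norm_le B.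
have e0 : 0 < (2 * K)^-1 by rewrite invr_gt0 mulr_gt0.
exists (2 * K)^-1 => //; near=> r.
have H : forall j, forall y y', ball x r y -> ball x r y' ->
    `|F y 0 j - F y' 0 j - 'D_(y - y') (fun z => F z 0 j) x| <= (2 * K)^-1 * `|y - y'|.
  by near: r; apply: filter_forall => j; exact: strict_diff.
move=> y y' xy xy'.
have h1 : `|y - y'| <= K * `|(y - y') *m 'J F x|.
  by rewrite -{1}[y - y']mulmx1 -JB mulmxA.
have h2 : `|F y - F y' - (y - y') *m 'J F x| <= (2 * K)^-1 * `|y - y'|.
  apply: norm_le_coord => [|j]; first by rewrite mulr_ge0 // ltW.
  have := H j _ _ xy xy'; rewrite (_ : 'D_(y - y') _ x = ((y - y') *m 'J F x) 0 j) ?mxE //.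
  rewrite derive_rV; last exact: C1at_diff.
  by apply: eq_bigr => i _; rewrite jacobianE.
have h3 : `|(y - y') *m 'J F x| <= `|F y - F y'| + (2 * K)^-1 * `|y - y'|.
  rewrite -[X in `|X|](subKr (F y - F y')); apply: le_trans (ler_normB _ _) _.
  by rewrite lerD2l.
have h4 : `|y - y'| <= K * `|F y - F y'| + 2^-1 * `|y - y'|.
  apply: (le_trans h1); apply: le_trans (ler_wpM2l (ltW K0) h3) _.
  rewrite mulrDr lerD2l mulrA invfM mulrCA divff ?gt_eqF // mulr1.
  exact: lexx.
rewrite invfM -mulrA mulrCA ler_pdivrMl //.
by move: h4; set a := `|y - y'|; set b := K * _; lra.
Unshelve. all: by end_near. Qed.

Lemma smooth_differentiable n m (U : set 'rV[R]_n) (F : 'rV[R]_n -> 'rV[R]_m) x :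
  smooth_on U F -> U x -> differentiable F x.
Proof. by move=> /(_ 1%N) [h _]; exact: h. Qed.

Lemma smooth_derive n m (U : set 'rV[R]_n) (F : 'rV[R]_n -> 'rV[R]_m) v :
  smooth_on U F -> smooth_on U ('D_v F).
Proof. by move=> sF k; have [_] := sF k.+1; exact. Qed.

Lemma smooth_C1at n m (U : set 'rV[R]_n) (F : 'rV[R]_n -> 'rV[R]_m) x j :
  open U -> smooth_on U F -> U x -> C1at (fun y => F y 0 j) x.
Proof.
move=> oU sF Ux.
have nU : \forall y \near x, U y by exact: open_nbhs_nbhs.
apply: (@C1at_intro _ _ _ (fun v y => ('D_v F y) 0 j)) => [|v|v].
- apply: filterS nU => y Uy.
  apply: (@differentiable_comp _ _ _ _ F (fun A : 'rV[R]_m => A 0 j)).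
    exact: smooth_differentiable sF Uy.
  exact: differentiable_coord.
- apply: filterS nU => y Uy; rewrite derive_mx ?mxE //.
  exact/diff_derivable/(smooth_differentiable sF).
- apply: (@continuous_comp _ _ _ ('D_v F) (fun A : 'rV[R]_m => A 0 j)).
    exact: (smooth_derive v sF 0%N).
  exact: coord_continuous.
Qed.

Lemma smooth_derive_coord n m (U : set 'rV[R]_n) (F : 'rV[R]_n -> 'rV[R]_m) x v j :
  smooth_on U F -> U x -> ('D_v F x) 0 j = 'D_v (fun y => F y 0 j) x.
Proof.
move=> sF Ux; rewrite derive_mx ?mxE //.
exact/diff_derivable/(smooth_differentiable sF).
Qed.

Lemma smooth_C1at_derive n m (U : set 'rV[R]_n) (F : 'rV[R]_n -> 'rV[R]_m) x v j :
  open U -> smooth_on U F -> U x -> C1at ('D_v (fun y => F y 0 j)) x.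
Proof.
move=> oU sF Ux; apply: C1at_near_eq (smooth_C1at j oU (smooth_derive v sF) Ux).
have nU : \forall y \near x, U y by exact: open_nbhs_nbhs.
by apply: filterS nU => y Uy; exact: smooth_derive_coord sF Uy.
Qed.

End EuclideanCalculus.

(** * The unit normal as a generalized cross product *)

Section CofactorNormal.
Variables (R : realType) (n : nat).
Implicit Types (y w : 'rV[R]_n.+2) (F : 'M[R]_(n, n.+2)).

Definition frame_mx y w F : 'M[R]_n.+2 := col_mx y (col_mx w F).

Let i1 : 'I_n.+2 := lift ord0 ord0.

(* The generalized cross product of [y] and the rows of [F]. *)
Definition cross y F : 'rV[R]_n.+2 := \row_c cofactor (frame_mx y 0 F) i1 c.

Let frame_mx1 y w F c : frame_mx y w F i1 c = w 0 c.
Proof.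
have -> : i1 = rshift 1 (lshift n ord0) :> 'I_(1 + (1 + n)) by apply/val_inj.
transitivity (col_mx w F (lshift n ord0) c); first exact: (@col_mxEd _ 1 (1 + n)).
exact: (@col_mxEu _ 1 n).
Qed.

Let frame_mx0 y w F c : frame_mx y w F ord0 c = y 0 c.
Proof.
have -> : ord0 = lshift (1 + n) ord0 :> 'I_(1 + (1 + n)) by apply/val_inj.
exact: (@col_mxEu _ 1 (1 + n)).
Qed.

Let frame_mx2 y w F k c : frame_mx y w F (rshift 1 (rshift 1 k)) c = F k c.
Proof.
transitivity (col_mx w F (rshift 1 k) c); first exact: (@col_mxEd _ 1 (1 + n)).
exact: (@col_mxEd _ 1 n).
Qed.

Let frame_mx_i1 y w w' F i c : i != i1 -> frame_mx y w F i c = frame_mx y w' F i c.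
Proof.
move=> ii; rewrite /frame_mx.
case: (@split_ordP 1 (1 + n) i) ii => j -> ii; first by rewrite !(@col_mxEu _ 1 (1 + n)).
rewrite !(@col_mxEd _ 1 (1 + n)).
case: (@split_ordP 1 n j) ii => k -> ii; last by rewrite !(@col_mxEd _ 1 n).
by case/eqP: ii; apply/val_inj; rewrite ord1.
Qed.

Lemma det_frame_mx y w F : \det (frame_mx y w F) = dotv w (cross y F).
Proof.
rewrite (expand_det_row _ i1); apply: eq_bigr => c _.
rewrite frame_mx1 [in RHS]mxE /cofactor; congr (_ * (_ * \det _)).
apply/matrixP => i j; rewrite [LHS]mxE [RHS]mxE [LHS]mxE [RHS]mxE.
apply: frame_mx_i1.
by rewrite eq_sym neq_lift.
Qed.

Lemma cross_y y F : dotv y (cross y F) = 0.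
Proof.
rewrite -det_frame_mx; apply: (@determinant_alternate _ _ _ ord0 i1) => // c.
by rewrite frame_mx0 frame_mx1.
Qed.

Lemma cross_F y F : F *m (cross y F)^T = 0.
Proof.
apply/matrixP => k j; rewrite ord1 mxE [RHS]mxE.
have : dotv (row k F) (cross y F) = 0.
  rewrite -det_frame_mx.
  apply: (@determinant_alternate _ _ _ i1 (rshift 1 (rshift 1 k))) => [|c].
    by apply/eqP => /(congr1 val).
  by rewrite frame_mx1 frame_mx2 mxE.
by move=> h; rewrite -[RHS]h; apply: eq_bigr => c _; rewrite !mxE.
Qed.

Lemma det_frame_mx_sqr y w F : dotv y y = 1 -> dotv w y = 0 -> F *m y^T = 0 ->
  F *m w^T = 0 -> \det (frame_mx y w F) ^+ 2 = dotv w w * \det (F *m F^T).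
Proof.
move=> yy wy Fy Fw.
have yF : y *m F^T = 0 by rewrite -[LHS]trmxK trmx_mul trmxK Fy trmx0.
have wF : w *m F^T = 0 by rewrite -[LHS]trmxK trmx_mul trmxK Fw trmx0.
rewrite expr2 -{2}det_tr -det_mulmx /frame_mx.
rewrite (@tr_col_mx _ 1 (1 + n)) (@tr_col_mx _ 1 n) (@mul_col_row _ 1 _ _ 1) (@mul_mx_row _ _ _ 1 n).
rewrite (@mul_col_mx _ 1 n) (@mul_col_row _ 1 n _ 1 n) !mx11_dotv yy (dotvC y w) wy yF wF Fy Fw raddf0.
rewrite (@col_mx0 _ 1 n 1) (@det_ublock _ 1 (1 + n)) det1 mul1r (@det_ublock _ 1 n).
by rewrite det_scalar1.
Qed.

(** For the cross product N itself the Gram identity reads |N|^4 = |N|^2 det, so only N = 0 has to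
    be excluded. A rank count gives a nonzero [w] orthogonal to [y] and [F]; its frame determinant
    is nonzero, yet equals the inner product of [w] with N. *)
Lemma cross_norm y F : dotv y y = 1 -> F *m y^T = 0 -> row_free F ->
  dotv (cross y F) (cross y F) = \det (F *m F^T).
Proof.
move=> yy Fy Ff.
have g0 := posdef_det (posdef_gram Ff).
have Ny : dotv (cross y F) y = 0 by rewrite dotvC cross_y.
have := det_frame_mx_sqr yy Ny Fy (cross_F y F).
rewrite det_frame_mx expr2 => h; apply: mulfI h.
apply/negP; rewrite dotvv_eq0 => /eqP N0.
pose Q : 'M[R]_(1 + n, n.+2) := col_mx y F.
have : kermx Q^T != 0.
  rewrite -mxrank_eq0 mxrank_ker subn_eq0 -ltnNge mxrank_tr.
  by apply: leq_ltn_trans (rank_leq_row _) _.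
move=> /rowV0Pn [w wk w0].
move/sub_kermxP: wk; rewrite tr_col_mx mul_mx_row => wQ.
have [wy wF] : w *m y^T = 0 /\ w *m F^T = 0.
  by apply: (@eq_row_mx _ _ 1 n); rewrite wQ row_mx0.
have Fw : F *m w^T = 0 by rewrite -[LHS]trmxK trmx_mul trmxK wF trmx0.
have wy' : dotv w y = 0 by rewrite dotvE wy mxE.
have := det_frame_mx_sqr yy wy' Fy Fw.
rewrite det_frame_mx N0 dotvC dotv0l expr0n /= => /esym/eqP.
by rewrite mulf_eq0 dotvv_eq0 (negbTE w0) gt_eqF.
Qed.

(** A closed formula for the normal that [unit_normal] selects by [xget]: a polynomial in the frame
    divided by the positive density, hence differentiable along a chart. *)
Definition unormal y F := (Num.sqrt (\det (F *m F^T)))^-1 *: cross y F.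

Lemma unormal_frame y F : dotv y y = 1 -> F *m y^T = 0 -> row_free F ->
  adapted_frame y (unormal y F) F.
Proof.
move=> yy Fy Ff; have g0 := posdef_det (posdef_gram Ff).
have s0 : Num.sqrt (\det (F *m F^T)) != 0 by rewrite sqrtr_eq0 -ltNge.
split => //.
- rewrite /unormal dotvZl dotvZr cross_norm // -{3}[\det _]sqr_sqrtr ?ltW // expr2.
  by rewrite mulKf // mulVf.
- by rewrite /unormal dotvZl dotvC cross_y mulr0.
- by rewrite /unormal linearZ /= -scalemxAr cross_F scaler0.
Qed.

Lemma det_unormal y F : dotv y y = 1 -> F *m y^T = 0 -> row_free F ->
  0 < \det (frame_mx y (unormal y F) F).
Proof.
move=> yy Fy Ff; have g0 := posdef_det (posdef_gram Ff).
rewrite det_frame_mx /unormal dotvZl cross_norm // mulr_gt0 // invr_gt0 sqrtr_gt0.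
by [].
Qed.

Lemma unormal_uniq y F v : dotv y y = 1 -> F *m y^T = 0 -> row_free F ->
  dotv v v = 1 -> dotv v y = 0 -> F *m v^T = 0 -> 0 < \det (frame_mx y v F) ->
  v = unormal y F.
Proof.
move=> yy Fy Ff vv vy Fv dv.
have afr := unormal_frame yy Fy Ff; have du := det_unormal yy Fy Ff.
have vF : v *m F^T = 0 by rewrite -[LHS]trmxK trmx_mul trmxK Fv trmx0.
have vE := af_decomp afr v; rewrite vy vF !mul0mx scale0r add0r addr0 in vE.
set c := dotv v _ in vE.
have c2 : c ^+ 2 = 1 by rewrite -vv vE dotvZl dotvZr (af_vv afr) mulr1 expr2.
have : 0 < c.
  by move: dv; rewrite vE !det_frame_mx dotvZl -det_frame_mx pmulr_lgt0.
move/eqP: c2; rewrite -subr_eq0 -[X in _ - X](expr1n _ 2) subr_sqr mulf_eq0 subr_eq0.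
case/orP => [/eqP c1 _|]; first by rewrite vE c1 scale1r.
by rewrite addr_eq0 => /eqP ->; rewrite ltr0N1.
Qed.

End CofactorNormal.

(** * The hypersurface in one chart *)

Section Charts.
Variables (R : realType) (n : nat) (M : topologicalType).
Variables (A : oriented_atlas R n M) (f : M -> 'rV[R]_n.+2).
Hypothesis fe : embedded_hypersurface A f.
Implicit Types (a b : chart A) (x : 'rV[R]_n) (p : M).

Definition image a : set 'rV[R]_n := mcoord a @` dom a.

Lemma image_open (a : chart A) : open (image a).
Proof. exact: coord_open. Qed.

Lemma image_nbhs a x : image a x -> \forall y \near x, image a y.
Proof. by move=> ax; apply: open_nbhs_nbhs; split => //; exact: image_open. Qed.

Lemma image_coord a p : dom a p -> image a (mcoord a p).
Proof. by move=> ap; exists p. Qed.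

Lemma param_dom a x : image a x -> dom a (param a x).
Proof. by move=> [p ap <-]; rewrite coordK. Qed.

Lemma paramK a x : image a x -> mcoord a (param a x) = x.
Proof. by move=> [p ap <-]; rewrite coordK. Qed.

Lemma dom_nbhs a p : dom a p -> \forall q \near p, dom a q.
Proof. by move=> ap; apply: open_nbhs_nbhs; split => //; exact: dom_open. Qed.

Lemma chart_smooth a : smooth_on (image a) (f \o param a).
Proof. by case: fe => _ h _ _ _; exact: h. Qed.

Lemma chart_C1 a x j : image a x -> C1at (fun y => f (param a y) 0 j) x.
Proof. by move=> ax; exact: (smooth_C1at j (@image_open a) (@chart_smooth a) ax). Qed.

Lemma chart_diff a x : image a x -> differentiable (f \o param a) x.
Proof. by move=> ax; exact: smooth_differentiable (@chart_smooth a) ax. Qed.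

Lemma tangentE a x i j : image a x ->
  tangent f a x i j = 'D_(delta_mx 0 i) (fun y => f (param a y) 0 j) x.
Proof. by move=> ax; rewrite /tangent jacobianE //; exact: chart_diff. Qed.

Lemma tangent_C1 a x i j : image a x -> C1at (fun y => tangent f a y i j) x.
Proof.
move=> ax; apply: C1at_near_eq (smooth_C1at_derive (delta_mx 0 i) j (@image_open a) (@chart_smooth a) ax).
by apply: filterS (image_nbhs ax) => y ay; rewrite tangentE.
Qed.

Lemma f_sphere p : dotv (f p) (f p) = 1.
Proof. by case: fe => h _ _ _ _; exact: h. Qed.

Lemma tangent_free a x : image a x -> row_free (tangent f a x).
Proof. by case: fe => _ _ h _ _; exact: h. Qed.

Let pos a x : 'rV[R]_n.+2 := f (param a x).

Lemma pos_dermx a x k : image a x -> dermx (delta_mx 0 k) (pos a) x = row k (tangent f a x).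
Proof. by move=> ax; apply/matrixP => i j; rewrite ord1 !mxE -tangentE // mxE. Qed.

Lemma pos_derivmx a x v : image a x -> derivmx v (pos a) x.
Proof. by move=> ax i j; rewrite ord1; apply: C1at_derivable; exact: chart_C1. Qed.

Lemma tangent_pos a x : image a x -> tangent f a x *m (f (param a x))^T = 0.
Proof.
move=> ax; apply/row_matrixP => k; rewrite row0 row_mul -pos_dermx //.
have d := @pos_derivmx a x (delta_mx 0 k) ax.
have [_] := dermxM d (derivmx_trmx d).
rewrite dermx_trmx.
have -> : (fun y => pos a y *m (pos a y)^T) = (fun=> 1%:M).
  by apply/funext => y; rewrite mx11_dotv f_sphere.
rewrite dermx_cst => /esym.
have -> : pos a x *m (dermx (delta_mx 0 k) (pos a) x)^T =
          (dermx (delta_mx 0 k) (pos a) x *m (pos a x)^T)^T.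
  by rewrite trmx_mul trmxK.
rewrite mx11_dotv tr_scalar_mx -raddfD => /matrixP /(_ 0 0).
rewrite !mxE eqxx mulr1n => /eqP; rewrite -mulr2n mulrn_eq0 /= => /eqP h.
by rewrite h raddf0.
Qed.

Lemma unit_normalE a x : image a x ->
  unit_normal f a x = unormal (f (param a x)) (tangent f a x).
Proof.
move=> ax; have yy := f_sphere (param a x).
have [Fy Ff] := (tangent_pos ax, tangent_free ax).
have [_ vv vy _ Fv _] := unormal_frame yy Fy Ff.
rewrite /unit_normal.
set P := [set v | _].
have Px : P (unormal (f (param a x)) (tangent f a x)).
  by split => //; exact: det_unormal.
by have [vv' vy' Fv' dv'] := xgetPex 0 (ex_intro P _ Px); exact: unormal_uniq.
Qed.

Lemma chart_frame a x : image a x ->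
  adapted_frame (f (param a x)) (unit_normal f a x) (tangent f a x).
Proof.
move=> ax; rewrite unit_normalE //.
by apply: unormal_frame; [exact: f_sphere|exact: tangent_pos|exact: tangent_free].
Qed.

Lemma metric_posdef a x : image a x -> posdef (metric f a x).
Proof. by move=> /tangent_free; exact: posdef_gram. Qed.

Lemma metric_C1 a x i j : image a x -> C1at (fun y => metric f a y i j) x.
Proof.
move=> ax; rewrite (_ : (fun _ => _) = fun y => \sum_k (tangent f a y i k * tangent f a y j k)).
  by apply: C1at_sum => k _; apply: C1atM; exact: tangent_C1.
by apply/funext => y; rewrite /metric mxE; apply: eq_bigr => k _; rewrite [_^T _ _]mxE.
Qed.

Lemma metric_det_C1 a x : image a x -> C1at (fun y => \det (metric f a y)) x.
Proof. by move=> ax; apply: C1at_det => i j; exact: metric_C1. Qed.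

Definition vol_density a x := Num.sqrt (\det (metric f a x)).

Lemma vol_density_gt0 a x : image a x -> 0 < vol_density a x.
Proof. by move=> /metric_posdef /posdef_det; rewrite sqrtr_gt0. Qed.

Lemma vol_density_C1 a x : image a x -> C1at (vol_density a) x.
Proof.
by move=> ax; apply: C1at_sqrt; [exact: metric_det_C1|exact/posdef_det/metric_posdef].
Qed.

Lemma invmetric_C1 a x i j : image a x -> C1at (fun y => invmx (metric f a y) i j) x.
Proof.
move=> ax.
apply: (@C1at_near_eq _ _ (fun y => (\det (metric f a y))^-1 * cofactor (metric f a y) j i)).
  apply: filterS (image_nbhs ax) => y ay.
  rewrite /invmx posdef_unit; last exact: metric_posdef.
  by rewrite [RHS]mxE [\adj _ _ _]mxE.
apply: C1atM.
  by apply: C1atV; [exact: metric_det_C1|rewrite gt_eqF //; exact/posdef_det/metric_posdef].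
rewrite /cofactor; apply: C1atZ; apply: C1at_det => k l.
rewrite (_ : (fun _ => _) = (fun y => metric f a y (lift j k) (lift i l))); first exact: metric_C1.
by apply/funext => y; rewrite !mxE.
Qed.

Lemma unit_normal_C1 a x c : image a x -> C1at (fun y => unit_normal f a y 0 c) x.
Proof.
move=> ax.
apply: (@C1at_near_eq _ _ (fun y => (vol_density a y)^-1 * cross (f (param a y)) (tangent f a y) 0 c)).
  by apply: filterS (image_nbhs ax) => y ay; rewrite unit_normalE // [RHS]mxE.
apply: C1atM.
  by apply: C1atV; [exact: vol_density_C1|rewrite gt_eqF // vol_density_gt0].
rewrite (_ : (fun _ => _) = (fun y => cofactor (frame_mx (f (param a y)) 0 (tangent f a y)) (lift ord0 ord0) c)); last first.
  by apply/funext => y; rewrite mxE.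
rewrite /cofactor; apply: C1atZ; apply: C1at_det => k l.
set i := lift (lift ord0 ord0) k; set j := lift c l.
rewrite (_ : (fun _ => _) = (fun y => frame_mx (f (param a y)) 0 (tangent f a y) i j)); last first.
  by apply/funext => y; rewrite 2!mxE.
clearbody i j; rewrite /frame_mx.
case: (@split_ordP 1 (1 + n) i) => k1 ->.
  rewrite (_ : (fun _ => _) = (fun y => f (param a y) 0 j)); first exact: chart_C1.
  by apply/funext => y; rewrite (@col_mxEu _ 1 (1 + n)) ord1.
rewrite (_ : (fun _ => _) = (fun y => col_mx 0 (tangent f a y) k1 j)); last first.
  by apply/funext => y; rewrite (@col_mxEd _ 1 (1 + n)).
case: (@split_ordP 1 n k1) => k2 ->.
  rewrite (_ : (fun _ => _) = cst 0); first exact: C1at_cst.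
  by apply/funext => y; rewrite (@col_mxEu _ 1 n) mxE.
rewrite (_ : (fun _ => _) = (fun y => tangent f a y k2 j)); first exact: tangent_C1.
by apply/funext => y; rewrite (@col_mxEd _ 1 n).
Qed.

Definition normal_der a x : 'M[R]_(n, n.+2) :=
  \matrix_(k, c) 'D_(delta_mx 0 k) (fun y => unit_normal f a y 0 c) x.

Lemma row_normal_der a x k :
  row k (normal_der a x) = dermx (delta_mx 0 k) (unit_normal f a) x.
Proof. by apply/matrixP => i j; rewrite ord1 !mxE. Qed.

Let normal_derivmx a x v : image a x -> derivmx v (unit_normal f a) x.
Proof. by move=> ax i j; rewrite ord1; apply: C1at_derivable; exact: unit_normal_C1. Qed.

Let tangent_derivmx a x v : image a x -> derivmx v (tangent f a) x.
Proof. by move=> ax i j; apply: C1at_derivable; exact: tangent_C1. Qed.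

Lemma normal_der_normal a x : image a x -> normal_der a x *m (unit_normal f a x)^T = 0.
Proof.
move=> ax; apply/row_matrixP => k; rewrite row0 row_mul row_normal_der.
have d := @normal_derivmx a x (delta_mx 0 k) ax.
have [_] := dermxM d (derivmx_trmx d).
rewrite dermx_trmx.
have -> : dermx (delta_mx 0 k) (fun y => unit_normal f a y *m (unit_normal f a y)^T) x = 0.
  rewrite -[RHS](dermx_cst 1%:M x (delta_mx 0 k)); apply: dermx_near.
  by apply: filterS (image_nbhs ax) => y /chart_frame /af_vv vv; rewrite mx11_dotv vv.
move=> /esym.
have -> : unit_normal f a x *m (dermx (delta_mx 0 k) (unit_normal f a) x)^T =
          (dermx (delta_mx 0 k) (unit_normal f a) x *m (unit_normal f a x)^T)^T.
  by rewrite trmx_mul trmxK.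
rewrite mx11_dotv tr_scalar_mx -raddfD => /matrixP /(_ 0 0).
rewrite !mxE eqxx mulr1n => /eqP; rewrite -mulr2n mulrn_eq0 /= => /eqP h.
by rewrite h raddf0.
Qed.

Lemma normal_der_pos a x : image a x -> normal_der a x *m (f (param a x))^T = 0.
Proof.
move=> ax; apply/row_matrixP => k; rewrite row0 row_mul row_normal_der.
have d := @normal_derivmx a x (delta_mx 0 k) ax.
have [_] := dermxM d (derivmx_trmx (@pos_derivmx a x (delta_mx 0 k) ax)).
rewrite dermx_trmx pos_dermx //.
have -> : dermx (delta_mx 0 k) (fun y => unit_normal f a y *m (pos a y)^T) x = 0.
  rewrite -[RHS](dermx_cst 0 x (delta_mx 0 k)); apply: dermx_near.
  by apply: filterS (image_nbhs ax) => y /chart_frame /af_yv yv; rewrite mx11_dotv yv raddf0.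
have -> : unit_normal f a x *m (row k (tangent f a x))^T = 0.
  rewrite -[LHS]trmxK trmx_mul trmxK -row_mul (af_Fv (chart_frame ax)) row0 trmx0.
  by [].
by rewrite addr0 => <-.
Qed.

(** Weingarten's equation: differentiating the orthogonality of normal and tangent vectors trades
    the second derivatives of [f] for first derivatives of the normal. *)
Lemma sff_coordE a x : image a x -> sff_coord f a x = - (normal_der a x *m (tangent f a x)^T).
Proof.
move=> ax; apply/row_matrixP => k.
have d := @normal_derivmx a x (delta_mx 0 k) ax.
have [_] := dermxM d (derivmx_trmx (@tangent_derivmx a x (delta_mx 0 k) ax)).
rewrite dermx_trmx -row_normal_der.
have -> : dermx (delta_mx 0 k) (fun y => unit_normal f a y *m (tangent f a y)^T) x = 0.
  rewrite -[RHS](dermx_cst 0 x (delta_mx 0 k)); apply: dermx_near.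
  apply: filterS (image_nbhs ax) => y /chart_frame /af_Fv Fv.
  by rewrite -[LHS]trmxK trmx_mul trmxK Fv trmx0.
move=> /esym/eqP; rewrite addrC addr_eq0 -row_mul => /eqP h.
rewrite raddfN /= -h; apply/rowP => j; rewrite !mxE /dotv; apply: eq_bigr => c _.
rewrite mulrC [in RHS]mxE [in RHS]mxE; congr (_ * _).
rewrite (smooth_derive_coord _ _ (smooth_derive _ (@chart_smooth a)) ax).
apply: near_eq_D; apply: filterS (image_nbhs ax) => y ay.
by rewrite (smooth_derive_coord _ _ (@chart_smooth a) ay) tangentE.
Qed.

(** The derivative of the normal has no component along the position or the normal, so its expansion
    in the adapted frame keeps only the tangential term. *)
Lemma normal_derE a x : image a x ->
  normal_der a x = - (sff_coord f a x *m invmx (metric f a x) *m tangent f a x).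
Proof.
move=> ax; apply/row_matrixP => k; rewrite raddfN /= !row_mul sff_coordE //.
rewrite raddfN /= !mulNmx opprK row_mul.
rewrite {1}(af_decomp (chart_frame ax) (row k (normal_der a x))).
have -> : dotv (row k (normal_der a x)) (f (param a x)) = 0.
  by rewrite dotvE -row_mul normal_der_pos // row0 mxE.
have -> : dotv (row k (normal_der a x)) (unit_normal f a x) = 0.
  by rewrite dotvE -row_mul normal_der_normal // row0 mxE.
by rewrite !scale0r !add0r.
Qed.

Lemma tangent_schwarz a x j k c : image a x ->
  'D_(delta_mx 0 k) (fun y => tangent f a y j c) x =
  'D_(delta_mx 0 j) (fun y => tangent f a y k c) x.
Proof.
move=> ax.
have E i l : 'D_(delta_mx 0 i) (fun y => tangent f a y l c) x =
    'D_(delta_mx 0 i) ('D_(delta_mx 0 l) (fun y => f (param a y) 0 c)) x.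
  apply: near_eq_D; apply: filterS (image_nbhs ax) => y ay.
  exact: tangentE.
rewrite !E; apply: schwarz; first exact: chart_C1.
- exact: (smooth_C1at_derive _ _ (@image_open a) (@chart_smooth a) ax).
- exact: (smooth_C1at_derive _ _ (@image_open a) (@chart_smooth a) ax).
Qed.

End Charts.

Section ContinuityAt.
Variables (R : realType) (T : topologicalType).

Lemma continuous_at_sum (I : Type) (r : seq I) (g : I -> T -> R) (x : T) :
  (forall i, {for x, continuous (g i)}) -> {for x, continuous (fun y => \sum_(i <- r) g i y)}.
Proof.
move=> cg; elim: r => [|i r IH].
  rewrite (_ : (fun _ => _) = cst 0); first exact: cst_continuous.
  by apply/funext => y; rewrite big_nil.
rewrite (_ : (fun _ => _) = (fun y => g i y + \sum_(j <- r) g j y)).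
  by apply: cvgD; [exact: cg|exact: IH].
by apply/funext => y; rewrite big_cons.
Qed.

Lemma continuous_atM (g h : T -> R) (x : T) : {for x, continuous g} -> {for x, continuous h} ->
  {for x, continuous (fun y => g y * h y)}.
Proof. by move=> cg ch; apply: cvgM. Qed.

Lemma continuous_at_near_eq (g h : T -> R) (x : T) : (\forall y \near x, g y = h y) ->
  {for x, continuous g} -> {for x, continuous h}.
Proof.
move=> gh; rewrite /prop_for /continuous_at -(nbhs_singleton gh) => cg.
by apply: cvg_trans cg; exact: near_eq_cvg.
Qed.

End ContinuityAt.

(** * Independence of the chart: Gauss map, gradient, shape operator *)

Section Intrinsic.
Variables (R : realType) (n : nat) (M : topologicalType).
Variables (A : oriented_atlas R n M) (f : M -> 'rV[R]_n.+2).
Hypothesis fe : embedded_hypersurface A f.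
Implicit Types (a b : chart A) (x : 'rV[R]_n) (p q : M) (psi phi : M -> R).

Definition transition_jac a b p : 'M[R]_n := 'J (mcoord a \o param b) (mcoord b p).

Lemma transition_near a b p : dom a p -> dom b p ->
  \forall y \near mcoord b p, dom a (param b y).
Proof.
move=> ap bp.
have := @param_continuous _ _ _ A b (mcoord b p) (image_coord bp).
rewrite /prop_for /continuous_at coordK //; apply.
by apply: open_nbhs_nbhs; split => //; exact: dom_open.
Qed.

Lemma transition_diff a b p : dom a p -> dom b p ->
  differentiable (mcoord a \o param b) (mcoord b p).
Proof.
move=> ap bp; have [h _] := @transition_smooth _ _ _ A b a 1%N.
by apply: h; exists p.
Qed.

Lemma transition_det a b p : dom a p -> dom b p -> 0 < \det (transition_jac a b p).
Proof. by move=> ap bp; apply: transition_oriented; exists p. Qed.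

Lemma transition_derive a b p psi v : dom a p -> dom b p ->
  differentiable (psi \o param a) (mcoord a p) ->
  'D_v (psi \o param b) (mcoord b p) =
  \sum_l (v *m transition_jac a b p) 0 l * 'D_(delta_mx 0 l) (psi \o param a) (mcoord a p).
Proof.
move=> ap bp dpsi.
have E : mcoord a (param b (mcoord b p)) = mcoord a p by rewrite coordK.
have dc : differentiable (psi \o param a) ((mcoord a \o param b) (mcoord b p)) by rewrite /= E.
have dt := transition_diff ap bp.
transitivity ('D_v ((psi \o param a) \o (mcoord a \o param b)) (mcoord b p)).
  by apply: near_eq_D; apply: filterS (transition_near ap bp) => y ay /=; rewrite coordK.
rewrite (deriveE _ (differentiable_comp dt dc)).
rewrite (diff_comp dt dc) /= E -(derive_rV _ dpsi) [RHS](deriveE _ dpsi); congr ('d _ _ _).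
by rewrite -deriveE // deriveEjacobian.
Qed.

Definition dchart a psi x : 'rV[R]_n := \row_k 'D_(delta_mx 0 k) (psi \o param a) x.

Lemma dchart_transition a b p psi : dom a p -> dom b p ->
  differentiable (psi \o param a) (mcoord a p) ->
  dchart b psi (mcoord b p) = dchart a psi (mcoord a p) *m (transition_jac a b p)^T.
Proof.
move=> ap bp d; apply/rowP => k; rewrite !mxE (transition_derive _ ap bp) //.
by apply: eq_bigr => l _; rewrite -rowE mulrC !mxE.
Qed.

Lemma tangent_transition a b p : dom a p -> dom b p ->
  tangent f b (mcoord b p) = transition_jac a b p *m tangent f a (mcoord a p).
Proof.
move=> ap bp; apply/matrixP => k j.
rewrite (tangentE fe _ _ (image_coord bp)).
have d := C1at_diff (chart_C1 fe j (image_coord ap)).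
rewrite -[LHS]/('D_(delta_mx 0 k) ((fun q => f q 0 j) \o param b) (mcoord b p)).
rewrite (transition_derive _ ap bp) // mxE; apply: eq_bigr => l _.
by rewrite -rowE (tangentE fe _ _ (image_coord ap)) [row _ _ _ _]mxE.
Qed.

Lemma metric_transition a b p : dom a p -> dom b p ->
  metric f b (mcoord b p) =
  transition_jac a b p *m metric f a (mcoord a p) *m (transition_jac a b p)^T.
Proof.
by move=> ap bp; rewrite /metric (tangent_transition ap bp) trmx_mul !mulmxA.
Qed.

(** This is where the orientation of the atlas enters: the positive determinant of the transition
    preserves the sign that singles out one of the two normals. *)
Lemma unit_normal_transition a b p : dom a p -> dom b p ->
  unit_normal f b (mcoord b p) = unit_normal f a (mcoord a p).
Proof.
move=> ap bp; have [ia ib] := (image_coord ap, image_coord bp).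
have afa := chart_frame fe ia.
rewrite (unit_normalE fe ib) coordK //; apply/esym.
have Ea : param a (mcoord a p) = p by rewrite coordK.
rewrite Ea in afa.
have afb := chart_frame fe ib; rewrite coordK // in afb.
apply: unormal_uniq.
- exact: af_yy afa.
- exact: af_Fy afb.
- exact: af_free afb.
- exact: af_vv afa.
- exact: af_yv afa.
- by rewrite (tangent_transition ap bp) -mulmxA (af_Fv afa) mulmx0.
set J := transition_jac a b p; set v := unit_normal f a _.
rewrite (tangent_transition ap bp) -/J.
have -> : frame_mx (f p) v (J *m tangent f a (mcoord a p)) =
    (block_mx 1%:M 0 0 (block_mx 1%:M 0 0 J : 'M[R]_(1 + n)) : 'M[R]_(1 + (1 + n))) *m
    frame_mx (f p) v (tangent f a (mcoord a p)).
  rewrite /frame_mx (@mul_block_col _ 1 (1 + n) 1 (1 + n)) (@mul_block_col _ 1 n 1 n).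
  by rewrite !mul1mx !mul0mx !add0r !addr0.
rewrite det_mulmx (@det_ublock _ 1 (1 + n)) (@det_ublock _ 1 n) !det1 !mul1r.
apply: mulr_gt0; first exact: transition_det.
by rewrite /v (unit_normalE fe ia) Ea; apply: det_unormal;
  [exact: af_yy afa|exact: af_Fy afa|exact: af_free afa].
Qed.

Definition nu p : 'rV[R]_n.+2 := unit_normal f (chart_at A p) (mcoord (chart_at A p) p).

Lemma nu_chart a p : dom a p -> nu p = unit_normal f a (mcoord a p).
Proof. by move=> ap; apply: unit_normal_transition => //; exact: dom_chart_at. Qed.

Lemma nu_param a x : image a x -> nu (param a x) = unit_normal f a x.
Proof. by move=> ax; rewrite (nu_chart (param_dom ax)) paramK. Qed.

Lemma frame_at a p : dom a p -> adapted_frame (f p) (nu p) (tangent f a (mcoord a p)).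
Proof.
move=> ap; rewrite (nu_chart ap) -{1}(coordK ap).
exact: chart_frame (image_coord ap).
Qed.

Lemma nu_norm p : dotv (nu p) (nu p) = 1.
Proof. exact: af_vv (frame_at (dom_chart_at A p)). Qed.

Lemma nu_pos p : dotv (nu p) (f p) = 0.
Proof. exact: af_yv (frame_at (dom_chart_at A p)). Qed.

Definition C1M psi := forall a x, image a x -> C1at (psi \o param a) x.

Lemma C1M_f c : C1M (fun p => f p 0 c).
Proof. by move=> a x ax; exact: chart_C1. Qed.

Lemma C1M_nu c : C1M (fun p => nu p 0 c).
Proof.
move=> a x ax; apply: C1at_near_eq (unit_normal_C1 fe c ax).
by apply: filterS (image_nbhs ax) => y ay /=; rewrite nu_param.
Qed.

Lemma C1M_diff psi a p : C1M psi -> dom a p -> differentiable (psi \o param a) (mcoord a p).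
Proof. by move=> cp ap; apply: C1at_diff; apply: cp; exact: image_coord. Qed.

Lemma continuous_chart (T : topologicalType) (g : 'rV[R]_n -> T) (h : M -> T) a p : dom a p ->
  {for mcoord a p, continuous g} -> (forall q, dom a q -> h q = g (mcoord a q)) ->
  {for p, continuous h}.
Proof.
move=> ap cg hg.
have nh : \forall q \near p, (g \o mcoord a) q = h q.
  by apply: filterS (dom_nbhs ap) => q aq; rewrite hg.
rewrite /prop_for /continuous_at -(nbhs_singleton nh).
have cc : {for p, continuous (g \o mcoord a)}.
  by apply: continuous_comp => //; exact: Defs.coord_continuous.
by apply: cvg_trans cc; exact: near_eq_cvg.
Qed.

Lemma C1M_continuous psi : C1M psi -> continuous psi.
Proof.
move=> cp p; apply: (continuous_chart (dom_chart_at A p) (g := psi \o param (chart_at A p))).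
  by apply: C1at_cont; apply: cp; exact/image_coord/dom_chart_at.
by move=> q dq /=; rewrite coordK.
Qed.

(** The Riemannian gradient pushed forward to R^{n+2}. In this form it does not depend on the chart,
    and inner products of gradients are Euclidean. *)
Definition gradc a psi x : 'rV[R]_n.+2 :=
  dchart a psi x *m invmx (metric f a x) *m tangent f a x.

Definition gradM psi p := gradc (chart_at A p) psi (mcoord (chart_at A p) p).

Lemma congr_invmx (J G : 'M[R]_n) : J \in unitmx -> G \in unitmx ->
  J^T *m invmx (J *m G *m J^T) *m J = invmx G.
Proof.
move=> Ju Gu.
have Ku : J *m G *m J^T \in unitmx by rewrite !unitmx_mul unitmx_tr Ju Gu.
apply: (can_inj (mulKmx Gu)); rewrite (mulmxV Gu).
apply: (can_inj (mulKmx Ju)); rewrite mulmx1 !mulmxA mulmxV //.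
exact: mul1mx.
Qed.

Lemma gradM_chart psi a p : C1M psi -> dom a p ->
  gradM psi p = gradc a psi (mcoord a p).
Proof.
move=> cp ap; rewrite /gradM /gradc; set b := chart_at A p.
have bp : dom b p by exact: dom_chart_at.
rewrite (dchart_transition ap bp (C1M_diff cp ap)) (metric_transition ap bp).
rewrite (tangent_transition ap bp).
have Ju : transition_jac a b p \in unitmx.
  by rewrite unitmxE unitfE gt_eqF // transition_det.
have Gu := posdef_unit (metric_posdef fe (image_coord ap)).
by rewrite -[invmx (metric f a _)](congr_invmx Ju Gu) !mulmxA.
Qed.

Lemma gradM_cont psi c : C1M psi -> continuous (fun p => gradM psi p 0 c).
Proof.
move=> cp p; set a := chart_at A p.
have ap : dom a p by exact: dom_chart_at.
have ia := image_coord ap.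
apply: (continuous_chart ap (g := fun x => gradc a psi x 0 c)); last first.
  by move=> q aq; rewrite (gradM_chart cp aq).
rewrite (_ : (fun x => _) = (fun x => \sum_l (\sum_k 'D_(delta_mx 0 k) (psi \o param a) x *
    invmx (metric f a x) k l) * tangent f a x l c)); last first.
  apply/funext => x; rewrite /gradc mxE; apply: eq_bigr => l _; congr (_ * _).
  by rewrite mxE; apply: eq_bigr => k _; rewrite [dchart _ _ _ _ _]mxE.
apply: continuous_at_sum => l; apply: continuous_atM; last exact: C1at_cont (tangent_C1 fe l c ia).
apply: continuous_at_sum => k; apply: continuous_atM; first exact: (cp a _ ia).2.
exact: C1at_cont (invmetric_C1 fe k l ia).
Qed.

Lemma gradM_pos psi p : dotv (gradM psi p) (f p) = 0.
Proof.
rewrite /gradM /gradc dotvE -!mulmxA (af_Fy (frame_at (dom_chart_at A p))).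
by rewrite !mulmx0 mxE.
Qed.

Lemma gradM_nu psi p : dotv (gradM psi p) (nu p) = 0.
Proof.
rewrite /gradM /gradc dotvE -!mulmxA (af_Fv (frame_at (dom_chart_at A p))).
by rewrite !mulmx0 mxE.
Qed.

Lemma gradM_comb psi phi1 phi2 (c1 c2 : R) p :
  (forall a x v, image a x -> param a x = p ->
    'D_v (psi \o param a) x = c1 * 'D_v (phi1 \o param a) x + c2 * 'D_v (phi2 \o param a) x) ->
  gradM psi p = c1 *: gradM phi1 p + c2 *: gradM phi2 p.
Proof.
move=> H; rewrite /gradM /gradc !scalemxAl -!mulmxDl; congr (_ *m _ *m _).
apply/rowP => k; rewrite !mxE; apply: H; first exact/image_coord/dom_chart_at.
by rewrite coordK //; exact: dom_chart_at.
Qed.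

Lemma gradM_near psi phi p : (\forall q \near p, psi q = phi q) -> gradM psi p = gradM phi p.
Proof.
set a := chart_at A p; have ap : dom a p by exact: dom_chart_at.
move=> H; have E : dchart a psi (mcoord a p) = dchart a phi (mcoord a p); last by rewrite /gradM /gradc -/a E.
apply/rowP => k; rewrite [LHS]mxE [RHS]mxE; apply: near_eq_D.
have := @param_continuous _ _ _ A a _ (image_coord ap).
by rewrite /prop_for /continuous_at coordK // => /(_ _ H).
Qed.

Lemma gradM_cst (c : R) p : gradM (fun=> c) p = 0.
Proof.
rewrite /gradM /gradc (_ : dchart _ _ _ = 0) ?mul0mx //.
by apply/rowP => k; rewrite !mxE; exact: derive_cst.
Qed.

Lemma gradM_f c p : gradM (fun q => f q 0 c) p =
  delta_mx 0 c - f p 0 c *: f p - nu p 0 c *: nu p.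
Proof.
have ap := dom_chart_at A p; have ia := image_coord ap.
have -> : delta_mx 0 c - f p 0 c *: f p - nu p 0 c *: nu p =
   row c (1%:M - (f p)^T *m f p - (nu p)^T *m nu p).
  apply/rowP => j; rewrite !mxE !big_ord1 !mxE; congr (_ - _ - _).
  by rewrite eq_sym.
rewrite -(af_proj (frame_at ap)) /gradM /gradc !row_mul; congr (_ *m _ *m _).
by apply/rowP => k; rewrite [LHS]mxE [RHS]mxE [RHS]mxE (tangentE fe _ _ ia).
Qed.

(** grad f_c is the tangential projection of a basis vector, and a tangent vector pairs with it as
    with the basis vector itself. Inner products with grad f_c thereby become plain coordinates. *)
Lemma dotv_gradM_f psi c p : dotv (gradM psi p) (gradM (fun q => f q 0 c) p) = gradM psi p 0 c.
Proof.
by rewrite gradM_f !dotvBr !dotvZr gradM_pos gradM_nu !mulr0 !subr0 dotv_delta.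
Qed.

(** Up to sign this is the shape operator, extended by 0 to the position and normal directions of
    R^{n+2}. *)
Definition grad_nu p : 'M[R]_n.+2 := \matrix_c gradM (fun q => nu q 0 c) p.

Lemma grad_nuE a p : dom a p ->
  grad_nu p = (normal_der f a (mcoord a p))^T *m invmx (metric f a (mcoord a p))
              *m tangent f a (mcoord a p).
Proof.
move=> ap; apply/row_matrixP => c; rewrite rowK !row_mul (gradM_chart (C1M_nu c) ap).
congr (_ *m _ *m _); apply/rowP => k; rewrite !mxE; apply: near_eq_D.
by apply: filterS (image_nbhs (image_coord ap)) => y ay /=; rewrite nu_param.
Qed.

Lemma orthonormal_frameP a x : image a x ->
  orthonormal_frame f a x *m metric f a x *m (orthonormal_frame f a x)^T = 1%:M.
Proof.
move=> ax; rewrite /orthonormal_frame.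
set P := [set E | _]; suff /xgetPex : exists E, P E by exact.
by apply: posdef_frame; exact: metric_posdef.
Qed.

(* The rows of [X] are an orthonormal basis of the tangent space in R^{n+2}. *)
Lemma grad_nu_sff p : exists2 X : 'M[R]_(n, n.+2), X *m X^T = 1%:M &
  grad_nu p = - (X^T *m (sff A f p)^T *m X).
Proof.
have ap := dom_chart_at A p; rewrite (grad_nuE ap) /sff.
set a := chart_at A p; set x := mcoord a p; set E := orthonormal_frame f a x.
have ax : image a x by exact: image_coord.
have EGE : E *m metric f a x *m E^T = 1%:M := orthonormal_frameP ax.
have EE : E^T *m E = invmx (metric f a x) := frame_inv EGE.
exists (E *m tangent f a x); first by rewrite trmx_mul -EGE /metric !mulmxA.
rewrite (normal_derE fe ax) [(- _)^T]raddfN /= !mulNmx -EE.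
by rewrite !trmx_mul !trmxK !mulmxA.
Qed.

(** Conjugation by a matrix with orthonormal rows keeps the Frobenius norm, so the sum over ambient
    coordinates sees exactly the h_ij. *)
Lemma grad_nu_sqnorm p : \sum_c dotv (row c (grad_nu p)) (row c (grad_nu p)) = sff_sqnorm A f p.
Proof.
have [X XX ->] := grad_nu_sff p; rewrite /sff_sqnorm; move: (sff A f p) => h.
transitivity (\tr (X^T *m h^T *m X *m (X^T *m h^T *m X)^T)).
  rewrite /mxtrace; apply: eq_bigr => c _; rewrite raddfN /= dotvNl dotvC dotvNl opprK mxE.
  by apply: eq_bigr => d _; rewrite [_^T _ _]mxE ![row c _ _ _]mxE.
rewrite !trmx_mul !trmxK mxtrace_mulC.
transitivity (\tr (X^T *m h *m (X *m X^T) *m h^T *m X)); first by rewrite !mulmxA.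
rewrite XX mulmx1 mxtrace_mulC !mulmxA XX mul1mx /mxtrace; apply: eq_bigr => i _.
by rewrite mxE; apply: eq_bigr => j _; rewrite [_^T _ _]mxE expr2.
Qed.

Lemma nu_divergence p : minimal A f -> \tr (grad_nu p) = 0.
Proof.
move=> /(_ p) H; have [X XX ->] := grad_nu_sff p; move: H; rewrite /mean_curvature.
rewrite raddfN /= mxtrace_mulC mulmxA XX mul1mx mxtrace_tr -/(\tr _) => /eqP.
(* For [n = 0] the factor [n%:R^-1] is 0 and minimality says nothing, but the trace is then an empty
   sum. *)
rewrite mulf_eq0 invr_eq0 pnatr_eq0 => /orP[/eqP n0|/eqP ->]; last exact: oppr0.
by rewrite /mxtrace big1 ?oppr0 // => i _; have := ltn_ord i; rewrite {2}n0.
Qed.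

End Intrinsic.

(** * The Laplacian of the position vector *)

Section DivergenceIdentity.
Variables (R : realType) (n : nat) (M : topologicalType).
Variables (A : oriented_atlas R n M) (f : M -> 'rV[R]_n.+2).
Hypotheses (fe : embedded_hypersurface A f) (fm : minimal A f).
Implicit Types (a b : chart A) (x : 'rV[R]_n) (p q : M) (psi phi : M -> R).

(** In index notation row k is sqrt(g) g^{kl} d_l f, so the divergence of the rows is sqrt(g) times
    the Laplacian of the position vector. *)
Definition cotangent a x : 'M[R]_(n, n.+2) :=
  vol_density f a x *: (invmx (metric f a x) *m tangent f a x).

Lemma cotangent_C1 a x i j : image a x -> C1at (fun y => cotangent a y i j) x.
Proof.
move=> ax; rewrite (_ : (fun _ => _) = (fun y => vol_density f a y *
  \sum_k (invmx (metric f a y) i k * tangent f a y k j))).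
  apply: C1atM; first exact: vol_density_C1.
  by apply: C1at_sum => k _; apply: C1atM; [exact: invmetric_C1|exact: tangent_C1].
by apply/funext => y; rewrite [LHS]mxE [X in _ * X]mxE.
Qed.

Lemma cotangent_tangent a x : image a x ->
  cotangent a x *m (tangent f a x)^T = (vol_density f a x)%:M.
Proof.
move=> ax; rewrite -scalemxAl -mulmxA mulVmx ?scalemx1 //.
exact: posdef_unit (metric_posdef fe ax).
Qed.

Let tangent_der a x m : image a x -> derivmx (delta_mx 0 m) (tangent f a) x.
Proof. by move=> ax i j; apply: C1at_derivable; exact: tangent_C1. Qed.

Let cotangent_der a x m : image a x -> derivmx (delta_mx 0 m) (cotangent a) x.
Proof. by move=> ax i j; apply: C1at_derivable; exact: cotangent_C1. Qed.

(** Jacobi's formula for det G. The two terms in the derivative of [F *m F^T] have the same trace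
    against the symmetric [invmx G], which cancels the 1/2 of the square root. *)
Lemma vol_density_derive a x m : image a x ->
  'D_(delta_mx 0 m) (vol_density f a) x =
  \tr (cotangent a x *m (dermx (delta_mx 0 m) (tangent f a) x)^T).
Proof.
move=> ax.
have Gp := metric_posdef fe ax; have g0 := posdef_det Gp.
rewrite derive_sqrt //; last exact: C1at_diff (metric_det_C1 fe ax).
rewrite derive_det; last by move=> i j; apply: C1at_derivable; exact: metric_C1.
have td := @tangent_der a x m ax.
have [_ ->] := dermxM td (derivmx_trmx td).
rewrite dermx_trmx; set F := tangent f a x; set DF := dermx _ _ x.
set G := metric f a x; set s := vol_density f a x.
have adjE : \adj G = s ^+ 2 *: invmx G.
  rewrite /s sqr_sqrtr ?ltW // /invmx posdef_unit // scalerA mulfV ?scale1r //.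
  by rewrite gt_eqF.
have Gs : (invmx G)^T = invmx G by rewrite invmxT //; have [] := Gp.
rewrite adjE -scalemxAl mxtraceZ mulmxDr mxtraceD.
have -> : \tr (invmx G *m (DF *m F^T)) = \tr (invmx G *m (F *m DF^T)).
  by rewrite -mxtrace_tr !trmx_mul trmxK Gs mxtrace_mulC.
have s0 : s != 0 by rewrite gt_eqF // vol_density_gt0.
rewrite /cotangent -/s -/G -/F -scalemxAl mxtraceZ -mulmxA.
rewrite -[Num.sqrt _]/s.
by field.
Qed.

(** This is Delta f = - n f in coordinates, checked on each part of the adapted frame by
    differentiating the product of [cotangent] with that part. *)
Lemma divergence_cotangent a x : image a x ->
  \sum_k row k (dermx (delta_mx 0 k) (cotangent a) x) =
  - (n%:R * vol_density f a x) *: f (param a x).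
Proof.
move=> ax; have afr := chart_frame fe ax.
have near_image := image_nbhs ax.
have dotr (k : 'I_n) (B : 'M[R]_(n, n.+2)) (w : 'rV[R]_n.+2) : dotv (row k B) w = (B *m w^T) k 0.
  by rewrite dotvE -row_mul mxE.
have dotrr (k l : 'I_n) (B C : 'M[R]_(n, n.+2)) : dotv (row k B) (row l C) = (B *m C^T) k l.
  by rewrite dotr !mxE; apply: eq_bigr => c _; rewrite !mxE.
have sumdot (w : 'rV[R]_n.+2) (B : 'I_n -> 'rV[R]_n.+2) : dotv (\sum_k B k) w = \sum_k dotv (B k) w.
  rewrite /dotv exchange_big /=; apply: eq_bigr => c _.
  by rewrite summxE mulr_suml.
apply: (af_eq afr).
(* Position: [cotangent] is orthogonal to [f], and its product with the tangent frame has the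
   density on the diagonal, once for each of the [n] indices. *)
- rewrite sumdot dotvZl (af_yy afr) mulr1.
  transitivity (\sum_(k < n) - vol_density f a x); last first.
    by rewrite mulr_natl sumrN sumr_const card_ord.
  apply: eq_bigr => k _; rewrite dotr.
  have dpos : derivmx (delta_mx 0 k) (fun y => f (param a y)) x.
    by move=> i j; rewrite ord1; apply: C1at_derivable; exact: chart_C1.
  have [_] := dermxM (@cotangent_der a x k ax) (derivmx_trmx dpos).
  rewrite dermx_trmx.
  have -> : dermx (delta_mx 0 k) (fun y => cotangent a y *m (f (param a y))^T) x = 0.
    rewrite -[RHS](dermx_cst 0 x (delta_mx 0 k)); apply: dermx_near.
    apply: filterS near_image => y ay; rewrite -scalemxAl -mulmxA (tangent_pos fe ay).
    by rewrite mulmx0 scaler0.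
  rewrite (pos_dermx fe _ ax) => /esym/eqP; rewrite addr_eq0 => /eqP ->.
  by rewrite mxE -dotr dotrr cotangent_tangent // mxE eqxx mulr1n.
(* Normal: what remains is the density times the trace of [grad_nu], which is 0 by minimality. *)
- rewrite sumdot dotvZl dotvC (af_yv afr) mulr0.
  transitivity (\sum_(k < n) - (cotangent a x *m (normal_der f a x)^T) k k).
    apply: eq_bigr => k _; rewrite dotr.
    have dnu : derivmx (delta_mx 0 k) (unit_normal f a) x.
      by move=> i j; rewrite ord1; apply: C1at_derivable; exact: unit_normal_C1.
    have [_] := dermxM (@cotangent_der a x k ax) (derivmx_trmx dnu).
    rewrite dermx_trmx -row_normal_der.
    have -> : dermx (delta_mx 0 k) (fun y => cotangent a y *m (unit_normal f a y)^T) x = 0.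
      rewrite -[RHS](dermx_cst 0 x (delta_mx 0 k)); apply: dermx_near.
      apply: filterS near_image => y ay; rewrite -scalemxAl -mulmxA (af_Fv (chart_frame fe ay)).
      by rewrite mulmx0 scaler0.
    move=> /esym/eqP; rewrite addr_eq0 => /eqP ->.
    by rewrite mxE -dotr dotrr.
  rewrite sumrN -[\sum_(k < n) _]/(\tr (cotangent a x *m (normal_der f a x)^T)).
  rewrite -scalemxAl mxtraceZ mxtrace_mulC mulmxA.
  have dp := param_dom ax.
  have := grad_nuE fe dp; rewrite (paramK ax) => <-.
  by rewrite nu_divergence // mulr0 oppr0.
(* Tangent: the derivative of the density cancels the term in which the tangent frame is
   differentiated, once the symmetry of second derivatives has exchanged the indices. *)
- apply/rowP => m.
  rewrite -scalemxAl mulmx_suml summxE [RHS]mxE.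
  have -> : f (param a x) *m (tangent f a x)^T = 0.
    by rewrite -[LHS]trmxK trmx_mul trmxK (tangent_pos fe ax) trmx0.
  rewrite mxE mulr0.
  transitivity (\sum_(k < n) (((k == m)%:R * 'D_(delta_mx 0 k) (vol_density f a) x) -
      \sum_c cotangent a x k c * 'D_(delta_mx 0 k) (fun y => tangent f a y m c) x)).
    apply: eq_bigr => k _; rewrite -row_mul mxE.
    have [_] := dermxM (@cotangent_der a x k ax) (derivmx_trmx (@tangent_der a x k ax)).
    rewrite dermx_trmx.
    have -> : dermx (delta_mx 0 k) (fun y => cotangent a y *m (tangent f a y)^T) x =
              ('D_(delta_mx 0 k) (vol_density f a) x)%:M.
      rewrite -dermx_scalar; apply: dermx_near.
      by apply: filterS near_image => y ay; rewrite cotangent_tangent.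
    move=> /matrixP /(_ k m); rewrite [in LHS]mxE [in RHS]mxE [X in _ + X]mxE => /eqP.
    rewrite -subr_eq => /eqP <-; rewrite mulr_natl; congr (_ - _).
    by apply: eq_bigr => c _; rewrite [X in _ * X]mxE [X in _ * X]mxE.
  rewrite sumrB (bigD1 m) //= eqxx mul1r big1 ?addr0; last first.
    by move=> k /negbTE ->; rewrite mul0r.
  rewrite vol_density_derive // /mxtrace; apply/eqP; rewrite subr_eq0; apply/eqP.
  apply: eq_bigr => k _; rewrite mxE; apply: eq_bigr => c _.
  by rewrite [X in _ * X]mxE [X in _ * X]mxE (tangent_schwarz fe).
Qed.

End DivergenceIdentity.

(** * Integration on M and bump functions *)

Section IntegralOnM.
Variables (R : realType) (n : nat) (M : ptopologicalType).
Variables (A : oriented_atlas R n M) (f : M -> 'rV[R]_n.+2).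
Variable dM : {measure set (borel M) -> \bar R}.
Hypotheses (Mc : closed_manifold M) (fe : embedded_hypersurface A f).
Hypothesis dMv : volume_element A f dM.
Implicit Types (a b : chart A) (x : 'rV[R]_n) (p q : M) (psi phi u : M -> R).

Lemma continuous_borel u : continuous u -> measurable_fun [set: borel M] (u : borel M -> R).
Proof.
move=> cu; apply: (measurability (@RGenOInfty.G R)); first exact: RGenOInfty.measurableE.
move=> _ [_ [x ->] <-]; rewrite setTI; apply: sub_sigma_algebra.
apply: (@open_comp M R u); first by move=> p _; exact: cu.
have -> : `]x, +oo[%classic = [set y : R | x < y].
  by apply/seteqP; split=> y; rewrite /= in_itv /= andbT.
exact: open_gt.
Qed.

Lemma continuous_borel_EFin u : continuous u ->
  measurable_fun [set: borel M] (EFin \o u : borel M -> \bar R).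
Proof. by move=> /continuous_borel h; exact/measurable_EFinP. Qed.

Definition in_chart a (K : set M) := closed K /\ K `<=` dom a.

Definition extend a (g : 'rV[R]_n -> R) : 'rV[R]_n -> R := g \_ (image a).

Lemma closed_compact (K : set M) : closed K -> compact K.
Proof. by move=> cK; apply: (subclosed_compact cK Mc.2). Qed.

Lemma coord_compact a K : in_chart a K -> compact (mcoord a @` K).
Proof.
move=> [cK Ka]; apply: continuous_compact; last exact: closed_compact.
apply: continuous_in_subspaceT => p /set_mem Kp.
exact: Defs.coord_continuous (Ka _ Kp).
Qed.

Lemma extend_near a g x : image a x -> \forall y \near x, g y = extend a g y.
Proof.
by move=> ax; apply: filterS (image_nbhs ax) => y ay; rewrite /extend patchE mem_set.
Qed.

Lemma extend0 a K g x : in_chart a K -> (forall y, image a y -> ~ K (param a y) -> g y = 0) ->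
  ~ (mcoord a @` K) x -> extend a g x = 0.
Proof.
move=> Ka g0 Kx; rewrite /extend patchE; case: ifPn => // /set_mem ax.
by apply: g0 => // Kp; apply: Kx; exists (param a x) => //; exact: paramK.
Qed.

Lemma extend_near0 a K g x : in_chart a K ->
  (forall y, image a y -> ~ K (param a y) -> g y = 0) ->
  ~ (mcoord a @` K) x -> \forall y \near x, 0 = extend a g y.
Proof.
move=> Ka g0 Kx.
have oK : open (~` (mcoord a @` K)).
  apply: closed_openC; apply: compact_closed; first exact: norm_hausdorff.
  exact: coord_compact.
have : \forall y \near x, (~` (mcoord a @` K)) y by exact: open_nbhs_nbhs.
by apply: filterS => y Ky; rewrite (extend0 Ka g0 Ky).
Qed.

(** The coordinate image of [K] is compact, hence closed: near its points the extension is [g], near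
    all other points it is 0, also along the boundary of the chart. *)
Lemma extend_C1 a K (g : 'rV[R]_n -> R) x : in_chart a K ->
  (forall y, image a y -> ~ K (param a y) -> g y = 0) ->
  (forall y, image a y -> C1at g y) -> C1at (extend a g) x.
Proof.
move=> Ka g0 cg; have [Kx|Kx] := pselect ((mcoord a @` K) x).
  have ax : image a x by case: Kx => p /Ka.2 ap <-; exact: image_coord.
  by apply: C1at_near_eq (cg _ ax); exact: extend_near.
apply: C1at_near_eq (@C1at_cst _ _ 0 x).
exact: extend_near0 Ka g0 Kx.
Qed.

Lemma extend_continuous a K (g : 'rV[R]_n -> R) : in_chart a K ->
  (forall y, image a y -> ~ K (param a y) -> g y = 0) ->
  (forall y, image a y -> {for y, continuous g}) -> continuous (extend a g).
Proof.
move=> Ka g0 cg.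
suff H : forall x : 'rV[R]_n, {for x, continuous (extend a g)} by [].
move=> x; have [Kx|Kx] := pselect ((mcoord a @` K) x).
  have ax : image a x by case: Kx => p /Ka.2 ap <-; exact: image_coord.
  exact: continuous_at_near_eq (extend_near g ax) (cg _ ax).
apply: continuous_at_near_eq (extend_near0 Ka g0 Kx) _.
exact: cst_continuous.
Qed.

Lemma extend_bound a K : in_chart a K -> exists2 B : R, 0 <= B &
  forall g, (forall y, image a y -> ~ K (param a y) -> g y = 0) ->
    forall x, B < `|x| -> extend a g x = 0.
Proof.
move=> Ka; have [B [_ HB]] := compact_bounded (coord_compact Ka).
exists (`|B| + 1) => [|g g0 x Bx]; first by rewrite addr_ge0.
apply: (extend0 Ka g0) => Kx.
have B1 : B < `|B| + 1 by apply: le_lt_trans (ler_norm B) _; rewrite ltrDl.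
by have := HB _ B1 x Kx; rewrite /= leNgt Bx.
Qed.

Lemma param_continuous_comp a x u : continuous u -> image a x ->
  {for x, continuous (fun y => u (param a y))}.
Proof.
move=> cu ax; apply: (@continuous_comp _ _ _ (param a) u); last exact: cu.
exact: Defs.param_continuous.
Qed.

Definition chart_density a u x := u (param a x) * vol_density f a x.

Lemma chart_density_continuous a u x : continuous u -> image a x ->
  {for x, continuous (chart_density a u)}.
Proof.
move=> cu ax; apply: continuous_atM; first exact: param_continuous_comp.
exact: C1at_cont (vol_density_C1 fe ax).
Qed.

Lemma extend_density_Cc a K : in_chart a K -> exists2 B : R, 0 <= B &
  forall u, continuous u -> (forall p, ~ K p -> u p = 0) -> Cc B (extend a (chart_density a u)).
Proof.
move=> Ka; have [B B0 HB] := extend_bound Ka; exists B => // u cu u0.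
have g0 y : image a y -> ~ K (param a y) -> chart_density a u y = 0.
  by move=> _ Ky; rewrite /chart_density u0 // mul0r.
split; last exact: HB.
by apply: extend_continuous Ka g0 _ => y ay; exact: chart_density_continuous.
Qed.

Lemma chart_integral_ge0 a K u : in_chart a K -> continuous u -> (forall p, 0 <= u p) ->
  (forall p, ~ K p -> u p = 0) ->
  (\int[dM]_(p in [set: borel M]) (u p)%:E = (itint (extend a (chart_density a u)))%:E)%E.
Proof.
move=> Ka cu u_ge0 u0.
have [B B0 HB] := extend_density_Cc Ka.
transitivity (\int[dM]_(p in (dom a : set (borel M))) (u p)%:E)%E.
  rewrite [RHS]integral_mkcond; apply: eq_integral => p _.
  rewrite patchE; case: ifPn => // /negP ap; rewrite u0 // => Kp; apply: ap.
  by apply/mem_set; exact: Ka.2.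
rewrite (dMv a (u := EFin \o u)).
- rewrite -(itint_EFin B0 (HB _ cu u0)); last first.
    move=> x; rewrite /extend patchE; case: ifP => // _.
    by rewrite mulr_ge0 // sqrtr_ge0.
  congr lebesgue_integral_rV; apply/funext => x.
  by rewrite /extend /= !patchE; case: ifP.
- exact: continuous_borel_EFin.
- by move=> p; rewrite /= lee_fin.
Qed.

Lemma extend_ge0 a u x : (forall p, 0 <= u p) -> 0 <= extend a (chart_density a u) x.
Proof.
move=> u0; rewrite /extend patchE; case: ifP => // _.
by rewrite mulr_ge0 // sqrtr_ge0.
Qed.

Definition bump p (r : R) q := sqpos (r ^+ 2 - dotv (f q - f p) (f q - f p)).

Lemma f_continuous : continuous f.
Proof.
move=> p; apply: (continuous_chart (dom_chart_at A p) (g := f \o param (chart_at A p))).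
  by apply: differentiable_continuous; apply: chart_diff => //; exact/image_coord/dom_chart_at.
by move=> q aq /=; rewrite coordK.
Qed.

Lemma C1M_cst (c : R) : C1M A (fun=> c).
Proof. by move=> a x _; exact: C1at_cst. Qed.

Lemma C1MD psi phi : C1M A psi -> C1M A phi -> C1M A (fun p => psi p + phi p).
Proof. by move=> c1 c2 a x ax; apply: C1atD; [exact: c1|exact: c2]. Qed.

Lemma C1MM psi phi : C1M A psi -> C1M A phi -> C1M A (fun p => psi p * phi p).
Proof. by move=> c1 c2 a x ax; apply: C1atM; [exact: c1|exact: c2]. Qed.

Lemma C1M_sum (I : Type) (s : seq I) (F : I -> M -> R) : (forall i, C1M A (F i)) ->
  C1M A (fun p => \sum_(i <- s) F i p).
Proof. by move=> c1 a x ax; apply: (C1at_sum s (P := xpredT)) => i _; exact: c1. Qed.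

Lemma C1M_dist p : C1M A (fun q => dotv (f q - f p) (f q - f p)).
Proof.
rewrite /dotv => a x ax; apply: (C1M_sum _ (F := fun c q => (f q - f p) 0 c * (f q - f p) 0 c)) ax.
move=> c; rewrite (_ : (fun q => _) = fun q => (f q 0 c + - f p 0 c) * (f q 0 c + - f p 0 c)).
  by apply: C1MM; apply: C1MD; [exact: C1M_f|exact: C1M_cst|exact: C1M_f|exact: C1M_cst].
by apply/funext => q; rewrite !mxE.
Qed.

Lemma sqpos_continuous : continuous (fun t : R => 2 * Num.max t 0).
Proof.
move=> t; apply: cvgM; first exact: cvg_cst.
rewrite (_ : (fun s => _) = (fun s : R => (s + `|s|) / 2)); last first.
  apply/funext => s; case: (leP s 0) => s0; first by rewrite ler0_norm // subrr mul0r.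
  by rewrite gtr0_norm //; field.
rewrite (_ : Num.max t 0 = (t + `|t|) / 2); last first.
  case: (leP t 0) => s0; first by rewrite ler0_norm // subrr mul0r.
  by rewrite gtr0_norm //; field.
apply: cvgM; last exact: cvg_cst.
by apply: cvgD; [exact: cvg_id|exact: norm_continuous].
Qed.

Lemma C1M_sqpos psi : C1M A psi -> C1M A (fun p => sqpos (psi p)).
Proof.
move=> c1 a x ax.
apply: (@C1at_comp _ _ (psi \o param a) (@sqpos R) (fun t => 2 * Num.max t 0)).
- exact: c1.
- by near=> t; exact: sqpos_derive.
- exact: sqpos_continuous.
Unshelve. all: by end_near. Qed.

Lemma C1M_bump p r : C1M A (bump p r).
Proof.
apply: C1M_sqpos.
rewrite (_ : (fun q => _) = fun q => r ^+ 2 + -1 * dotv (f q - f p) (f q - f p)).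
  by apply: C1MD; [exact: C1M_cst|apply: C1MM; [exact: C1M_cst|exact: C1M_dist]].
by apply/funext => q; rewrite mulN1r.
Qed.

Definition is_bump (b : M -> R) a (K : set M) :=
  [/\ C1M A b, forall q, 0 <= b q, in_chart a K & forall q, ~ K q -> b q = 0].

(** The topology of M is induced by [f], so a small ambient ball around [f p] already cuts out a
    closed set inside the chart and inside [W]. *)
Lemma bump_exists a p (W : set M) : dom a p -> open W -> W p ->
  exists (b : M -> R) (K : set M), [/\ is_bump b a K, 0 < b p & K `<=` W].
Proof.
move=> ap oW Wp.
have oD : open (dom a `&` W) by apply: openI => //; exact: dom_open.
have [_ _ _ _ /(_ _ oD) [V oV DV]] := fe.
have Vp : V (f p) by rewrite -[V (f p)]/((f @^-1` V) p) -DV.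
have /nbhs_ballP [r0 /= r00 rV] : nbhs (f p) V by exact: open_nbhs_nbhs.
(* With half the radius, the closed Euclidean ball of radius [r] lies in the open ball of radius
   [r0] for the sup norm of row vectors. *)
pose r := r0 / 2.
have r_gt0 : 0 < r by rewrite divr_gt0.
pose K := [set q | dotv (f q - f p) (f q - f p) <= r ^+ 2].
have KD : K `<=` dom a `&` W.
  move=> q Kq; rewrite DV /=; apply: rV; rewrite -ball_normE /=.
  apply: (@le_lt_trans _ _ r); last by rewrite /r ltr_pdivrMr // ltr_pMr // ltr1n.
  apply: norm_le_coord => [|c]; first exact: ltW.
  rewrite -(@ler_pXn2r _ 2) ?nnegrE ?normr_ge0 ?(ltW r_gt0) //.
  apply: le_trans Kq; rewrite real_normK ?num_real // /dotv (bigD1 c) //=.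
  have -> : (f p - f q) 0 c ^+ 2 = (f q - f p) 0 c * (f q - f p) 0 c by rewrite !mxE; ring.
  by rewrite lerDl sumr_ge0 // => j _; rewrite -expr2 sqr_ge0.
have cK : closed K.
  apply: (@preimage_closed M R (fun q => dotv (f q - f p) (f q - f p)) [set t | t <= r ^+ 2]).
    by move=> q _; exact: C1M_continuous (C1M_dist p) q.
  exact: closed_le.
exists (bump p r), K; split.
- split; first exact: C1M_bump.
  + by move=> q; rewrite /bump /sqpos sqr_ge0.
  + by split => // q /KD [].
  + move=> q Kq; rewrite /bump /sqpos max_r ?expr0n // subr_le0 leNgt.
    by apply/negP => h; apply: Kq; exact: ltW.
- by rewrite /bump subrr dotv0l subr0 /sqpos max_l ?sqr_ge0 // exprn_gt0 // exprn_gt0.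
- by move=> q /KD [].
Qed.

Lemma bump_cover : exists (s : seq M) (b : M -> M -> R) (K : M -> set M),
  (forall p, is_bump (b p) (chart_at A p) (K p)) /\ forall q, 0 < \sum_(p <- s) b p q.
Proof.
have H p : exists bK : (M -> R) * set M, is_bump bK.1 (chart_at A p) bK.2 /\ 0 < bK.1 p.
  have [b [K [h1 h2 _]]] := bump_exists (dom_chart_at A p) openT (I : [set: M] p).
  by exists (b, K).
have [bK HbK] := choice H.
have := Mc.2; rewrite compact_cover.
move=> /(_ M setT (fun p => [set q | 0 < (bK p).1 q])).
case.
- move=> p _; apply: (@open_comp _ _ (bK p).1 [set t | 0 < t]); last exact: open_gt.
  by move=> q _; have [[c _ _ _] _] := HbK p; exact: C1M_continuous c q.
- by move=> q _; exists q => //=; have [] := HbK q.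
move=> D _ HD; exists (finmap.enum_fset D), (fun p => (bK p).1), (fun p => (bK p).2).
split=> [p|q]; first by have [] := HbK p.
have [p /= Dp bp] := HD q I.
rewrite (big_rem p) //=; apply: ltr_pwDl => //.
by apply: sumr_ge0 => i _; have [[_ h _ _] _] := HbK i; exact: h.
Qed.

(** The sum of the bumps has a positive minimum on the compact M, and each bump has a finite
    integral in its chart; comparing the two bounds the volume. *)
Lemma finite_volume : (dM [set: borel M] < +oo)%E.
Proof.
have [s [b [K [Hb Hs]]]] := bump_cover.
pose B q := \sum_(p <- s) b p q.
have cB : continuous B.
  by apply: C1M_continuous; apply: C1M_sum => p; have [] := Hb p.
have [||c _ Hc] := @compact_EVT_min M R B setT _ Mc.2.
- by exists point.
- exact: continuous_subspaceT.
have Hc' q : B c <= B q by apply: Hc; exact: mem_setT.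
have B0 : 0 < B c by exact: Hs.
have cb p : continuous (b p) by have [h _ _ _] := Hb p; exact: C1M_continuous h.
have : ((B c)%:E * dM [set: borel M] < +oo)%E.
  rewrite -integral_cst //.
  apply: (@le_lt_trans _ _ (\int[dM]_(q in [set: borel M]) \sum_(p <- s) (b p q)%:E)%E).
    apply: ge0_le_integral => //.
    - by move=> q _; rewrite lee_fin ltW.
    - by apply: emeasurable_sum => p; exact: continuous_borel_EFin.
    - by move=> q _; rewrite sumEFin lee_fin; exact: Hc'.
  rewrite ge0_integral_sum //; last 2 first.
  - by move=> p; exact: continuous_borel_EFin.
  - by move=> p q _; rewrite lee_fin; have [_ h _ _] := Hb p; exact: h.
  apply: lte_sum_pinfty => p _.
  have [_ b0 Ka bK0] := Hb p.
  by rewrite (chart_integral_ge0 Ka (cb p) b0 bK0) ltry.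
case: (dM _) (measure_ge0 dM [set: borel M]) => [r _ _|_|//]; first exact: ltry.
by rewrite gt0_muley ?lte_fin.
Qed.

End IntegralOnM.

(** * The weak Laplace equation *)

Section WeakLaplace.
Variables (R : realType) (n : nat) (M : ptopologicalType).
Variables (A : oriented_atlas R n M) (f : M -> 'rV[R]_n.+2).
Variable dM : {measure set (borel M) -> \bar R}.
Hypotheses (Mc : closed_manifold M) (fe : embedded_hypersurface A f).
Hypothesis dMv : volume_element A f dM.
Implicit Types (a b : chart A) (x : 'rV[R]_n) (p q : M) (psi phi u v : M -> R).

Definition integralM u : R := \int[dM]_(p in [set: borel M]) u p.

Lemma continuous_integrable u : continuous u -> dM.-integrable [set: borel M] (EFin \o u).
Proof.
move=> cu; apply: measurable_bounded_integrable => //.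
- exact: finite_volume Mc fe dMv.
- exact: continuous_borel.
have [B [Br HB]] : bounded_set (u @` setT).
  apply: compact_bounded; apply: continuous_compact Mc.2; exact: continuous_subspaceT.
by exists B; split => // N BN p _ /=; apply: (HB N BN); exists p.
Qed.

Lemma integralMD u v : continuous u -> continuous v ->
  integralM (fun p => u p + v p) = integralM u + integralM v.
Proof. by move=> cu cv; apply: RintegralD => //; exact: continuous_integrable. Qed.

Lemma integralMB u v : continuous u -> continuous v ->
  integralM (fun p => u p - v p) = integralM u - integralM v.
Proof. by move=> cu cv; apply: RintegralB => //; exact: continuous_integrable. Qed.

Lemma integralMZ (c : R) u : continuous u -> integralM (fun p => c * u p) = c * integralM u.
Proof. by move=> cu; apply: RintegralZl => //; exact: continuous_integrable. Qed.

Lemma integralM_le u v : continuous u -> continuous v -> (forall p, u p <= v p) ->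
  integralM u <= integralM v.
Proof. by move=> cu cv uv; apply: le_Rintegral => //; exact: continuous_integrable. Qed.

Lemma integralM_ge0 u : (forall p, 0 <= u p) -> 0 <= integralM u.
Proof. by move=> u0; apply: Rintegral_ge0 => p _; exact: u0. Qed.

Lemma integralM_cst (c : R) : integralM (fun=> c) = c * volume dM.
Proof. by rewrite /integralM Rintegral_cst. Qed.

Lemma integralM_sum (I : Type) (s : seq I) (F : I -> M -> R) :
  (forall i, continuous (F i)) ->
  integralM (fun p => \sum_(i <- s) F i p) = \sum_(i <- s) integralM (F i).
Proof.
move=> cF; elim: s => [|i s IH].
  rewrite big_nil (_ : (fun _ => _) = (fun=> 0)); first by rewrite integralM_cst mul0r.
  by apply/funext => p; rewrite big_nil.
rewrite big_cons -IH -integralMD //; last first.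
  by move=> p; apply: continuous_at_sum => j; exact: cF.
by congr integralM; apply/funext => p; rewrite big_cons.
Qed.

Lemma max0_continuous u : continuous u -> continuous (fun p => Num.max (u p) 0).
Proof.
move=> cu p; have := @sqpos_continuous R (u p) => h.
rewrite (_ : (fun _ => _) = (fun q => 2^-1 * (2 * Num.max (u q) 0))); last first.
  by apply/funext => q; rewrite mulKf.
apply: (@continuous_atM _ _ (cst 2^-1) (fun q => 2 * Num.max (u q) 0)).
  exact: cst_continuous.
by apply: (@continuous_comp _ _ _ u (fun t => 2 * Num.max t 0)); first exact: cu.
Qed.

(** [volume_element] only speaks of nonnegative functions, so [u] is split into positive and
    negative parts, both continuous and both zero off [K]. *)
Lemma chart_integral a K u : in_chart a K -> continuous u -> (forall p, ~ K p -> u p = 0) ->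
  integralM u = itint (extend a (chart_density f a u)).
Proof.
move=> Ka cu u0.
pose up p := Num.max (u p) 0; pose un p := Num.max (- u p) 0.
have cNu : continuous (fun p => - u p) by move=> p; apply: cvgN; exact: cu.
have cup : continuous up by exact: max0_continuous.
have cun : continuous un by exact: (max0_continuous cNu).
have uE p : u p = up p - un p.
  rewrite /up /un; case: (leP (u p) 0) => h.
    by rewrite max_l ?oppr_ge0 // sub0r opprK.
  by rewrite max_r ?subr0 // oppr_le0 ltW.
have up0 p : ~ K p -> up p = 0 by move=> /u0; rewrite /up => ->; rewrite maxxx.
have un0 p : ~ K p -> un p = 0 by move=> /u0; rewrite /un => ->; rewrite oppr0 maxxx.
have up_ge0 p : 0 <= up p by rewrite /up le_max lexx orbT.
have un_ge0 p : 0 <= un p by rewrite /un le_max lexx orbT.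
have [B B0 HB] := extend_density_Cc Mc fe Ka.
have E v : continuous v -> (forall p, 0 <= v p) -> (forall p, ~ K p -> v p = 0) ->
    integralM v = itint (extend a (chart_density f a v)).
  move=> cv v_ge0 v0; rewrite /integralM /Rintegral.
  by rewrite (chart_integral_ge0 Mc fe dMv Ka cv v_ge0 v0).
transitivity (integralM (fun p => up p - un p)).
  by congr integralM; apply/funext.
rewrite integralMB // !E //.
transitivity (itint (fun x => -1 * extend a (chart_density f a un) x + extend a (chart_density f a up) x)).
  by rewrite (itint_lin _ (HB _ cun un0) (HB _ cup up0)) mulN1r addrC.
congr itint; apply/funext => x; rewrite /extend !patchE; case: ifP => _.
  by rewrite /chart_density uE; ring.
by rewrite mulr0 addr0.
Qed.

(** The volume charges every open set because its density is positive in charts: a bump at a point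
    where [u] is positive gives a product with positive chart integral, which is at most max b times
    the integral of [u]. *)
Lemma integralM_eq0 u : continuous u -> (forall p, 0 <= u p) -> integralM u = 0 ->
  forall p, u p = 0.
Proof.
move=> cu u0 Lu p; apply/eqP; apply: contraT => up.
have {}up : 0 < u p by rewrite lt_def up u0.
have ap := dom_chart_at A p.
have [b [K [[cb b0 Ka bK] bp _]]] := bump_exists fe ap openT (I : [set: M] p).
have cb' := C1M_continuous cb.
have [||c _ Hc] := @compact_EVT_max M R b setT _ Mc.2.
- by exists p.
- exact: continuous_subspaceT.
have cub : continuous (fun q => u q * b q) by move=> q; apply: continuous_atM; [exact: cu|exact: cb'].
have h1 : integralM (fun q => u q * b q) <= integralM (fun q => b c * u q).
  apply: integralM_le => // [|q].
    by move=> q; apply: continuous_atM; [exact: cst_continuous|exact: cu].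
  by rewrite mulrC ler_wpM2r //; apply: Hc; exact: mem_setT.
rewrite integralMZ // Lu mulr0 in h1.
suff h2 : 0 < integralM (fun q => u q * b q) by have := lt_le_trans h2 h1; rewrite ltxx.
have ub0 q : ~ K q -> u q * b q = 0 by move=> /bK ->; rewrite mulr0.
rewrite (chart_integral Ka cub ub0).
have [B B0 HB] := extend_density_Cc Mc fe Ka.
apply: (itint_gt0 (x0 := mcoord (chart_at A p) p) B0 (HB _ cub ub0)).
  by move=> x; apply: extend_ge0 => q; rewrite mulr_ge0.
have ia := image_coord ap.
rewrite /extend patchE mem_set // /chart_density coordK //.
by rewrite !mulr_gt0 // vol_density_gt0.
Qed.

Lemma volume_gt0 : 0 < volume dM.
Proof.
rewrite lt_neqAle fine_ge0 ?andbT; last exact: measure_ge0.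
apply/eqP => v0.
have := @integralM_eq0 (fun=> 1) _ _ _ point.
rewrite integralM_cst -v0 mulr0 => /(_ _ _ erefl) H.
have /eqP : (1 : R) = 0 by apply: H => // p; exact: cst_continuous.
by rewrite oner_eq0.
Qed.

Hypothesis fm : minimal A f.

(** The divergence of psi grad f_i: pairing grad psi with grad f_i reads off coordinate [i] by
    [dotv_gradM_f], and Delta f_i = - n f_i. *)
Definition laplace_test psi i p := gradM A f psi p 0 i - n%:R * psi p * f p 0 i.

Lemma laplace_test_continuous psi i : C1M A psi -> continuous (laplace_test psi i).
Proof.
move=> cp p; apply: cvgB; first exact: gradM_cont.
apply: cvgM; last exact: C1M_continuous (C1M_f fe i) p.
by apply: cvgM; [exact: cvg_cst|exact: C1M_continuous cp p].
Qed.

Lemma laplace_test_chart a psi i x : C1M A psi -> image a x ->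
  chart_density f a (laplace_test psi i) x =
  \sum_k 'D_(delta_mx 0 k) (fun y => psi (param a y) * cotangent f a y k i) x.
Proof.
move=> cp ax; have cpx := cp _ _ ax.
transitivity (\sum_k (psi (param a x) * 'D_(delta_mx 0 k) (fun y => cotangent f a y k i) x +
    cotangent f a x k i * 'D_(delta_mx 0 k) (psi \o param a) x)); last first.
  apply: eq_bigr => k _; rewrite deriveM //; first exact: C1at_derivable.
  by apply: C1at_derivable; exact: cotangent_C1.
rewrite big_split /= -mulr_sumr addrC.
rewrite /chart_density /laplace_test mulrBl; congr (_ + _).
  have ap := param_dom ax.
  rewrite (gradM_chart fe cp ap) (paramK ax) /gradc -mulmxA mxE mulr_suml.
  apply: eq_bigr => k _; rewrite [dchart _ _ _ _ _]mxE [cotangent _ _ _ _ _]mxE.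
  by rewrite /vol_density; ring.
have := divergence_cotangent fe fm ax => /rowP /(_ i).
rewrite summxE (eq_bigr (fun k => 'D_(delta_mx 0 k) (fun y => cotangent f a y k i) x)); last first.
  by move=> k _; rewrite !mxE.
move=> ->; rewrite mxE; ring.
Qed.

(** In the chart the integrand is a sum of coordinate derivatives of C^1 functions with bounded
    support, and each of them integrates to 0. *)
Lemma laplace_test_local a K psi i : C1M A psi -> in_chart a K -> (forall p, ~ K p -> psi p = 0) ->
  integralM (laplace_test psi i) = 0.
Proof.
move=> cp Ka p0.
have L0 p : ~ K p -> laplace_test psi i p = 0.
  move=> Kp; rewrite /laplace_test p0 // mulr0 mul0r subr0.
  rewrite (@gradM_near _ _ _ _ f psi (fun=> 0)); first by rewrite gradM_cst mxE.
  have : \forall q \near p, (~` K) q.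
    by apply: open_nbhs_nbhs; split => //; exact: closed_openC Ka.1.
  by apply: filterS => q; exact: p0.
rewrite (chart_integral Ka (@laplace_test_continuous psi i cp) L0).
pose g k y := psi (param a y) * cotangent f a y k i.
have g0 k y : image a y -> ~ K (param a y) -> g k y = 0.
  by move=> _ Ky; rewrite /g p0 // mul0r.
have cg k x : C1at (extend a (g k)) x.
  apply: (extend_C1 Mc _ Ka (g0 k)) => y ay.
  by apply: C1atM; [exact: cp|exact: cotangent_C1].
have [B B0 HB] := extend_bound Mc Ka.
have sB k := HB _ (g0 k).
have -> : extend a (chart_density f a (laplace_test psi i)) =
          (fun x => \sum_k 'D_(delta_mx 0 k) (extend a (g k)) x).
  apply/funext => x; have [Kx|Kx] := pselect ((mcoord a @` K) x).
    have ax : image a x by case: Kx => p /Ka.2 ap <-; exact: image_coord.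
    rewrite {1}/extend patchE mem_set // laplace_test_chart //.
    by apply: eq_bigr => k _; apply: near_eq_D; exact: extend_near.
  rewrite (extend0 Ka _ Kx); last first.
    by move=> y _ Ky; rewrite /chart_density L0 // mul0r.
  rewrite big1 // => k _; rewrite -[RHS](derive_cst (0 : R) x (delta_mx 0 k)).
  have h := extend_near0 Mc Ka (g0 k) Kx.
  by apply: esym; apply: near_eq_D; exact: h.
have cc k := Cc_derive (delta_mx 0 k) (cg k) (sB k).
have H (s : seq 'I_n) : Cc B (fun x => \sum_(k <- s) 'D_(delta_mx 0 k) (extend a (g k)) x) /\
    itint (fun x => \sum_(k <- s) 'D_(delta_mx 0 k) (extend a (g k)) x) = 0.
  elim: s => [|k s [IH1 IH2]].
    have -> : (fun x => \sum_(k <- [::]) 'D_(delta_mx 0 k) (extend a (g k)) x) = (fun=> 0).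
      by apply/funext => x; rewrite big_nil.
    have c0 : Cc B (fun _ : 'rV[R]_n => 0 : R) by split=> // x; exact: cst_continuous.
    split=> //; apply/eqP; rewrite -normr_le0 -[X in _ <= X](mulr0 ((2 * B) ^+ n)).
    by apply: itint_bound => // x; rewrite normr0.
  have -> : (fun x => \sum_(j <- k :: s) 'D_(delta_mx 0 j) (extend a (g j)) x) =
      (fun x => 1 * 'D_(delta_mx 0 k) (extend a (g k)) x +
         \sum_(j <- s) 'D_(delta_mx 0 j) (extend a (g j)) x).
    by apply/funext => x; rewrite big_cons mul1r.
  split; last by rewrite (itint_lin _ (cc k) IH1) IH2 (itint_derive0 _ B0 (cg k) (sB k)) mulr0 addr0.
  have [[c1 z1] [c2 z2]] := (cc k, IH1).
  by split=> [|x Bx]; [exact: continuous_comb|rewrite z1 // z2 // mulr0 addr0].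
exact: (H _).2.
Qed.

Lemma C1M_inv psi : C1M A psi -> (forall p, psi p != 0) -> C1M A (fun p => (psi p)^-1).
Proof. by move=> cp p0 a x ax; apply: (@C1atV _ _ (psi \o param a)); [exact: cp|exact: p0]. Qed.

Lemma gradMD psi phi p : C1M A psi -> C1M A phi ->
  gradM A f (fun q => psi q + phi q) p = gradM A f psi p + gradM A f phi p.
Proof.
move=> c1 c2; rewrite (@gradM_comb _ _ _ A f _ psi phi 1 1) ?scale1r // => a x v ax _.
by rewrite !mul1r; apply: deriveD; apply: C1at_derivable; [exact: c1|exact: c2].
Qed.

(* The weak form of [Delta f_i = - n f_i] on a minimal hypersurface. *)
Lemma weak_laplace psi i : C1M A psi -> integralM (laplace_test psi i) = 0.
Proof.
move=> cp; have [s [b [K [Hb Hs]]]] := bump_cover Mc fe.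
have cb p : C1M A (b p) by have [] := Hb p.
pose B q := \sum_(p <- s) b p q.
have cB : C1M A B by exact: C1M_sum.
(* The bumps are not normalized; dividing [psi] by their sum [B] writes it as a finite sum of
   functions supported in charts. The induction on the list takes [phi] arbitrary. *)
pose phi q := psi q * (B q)^-1.
have cphi : C1M A phi by apply: (C1MM cp (C1M_inv cB _)) => q; rewrite gt_eqF // /B.
have -> : psi = (fun q => \sum_(p <- s) b p q * phi q).
  apply/funext => q; rewrite -mulr_suml /phi mulrCA mulfV ?mulr1 //.
  by rewrite gt_eqF.
elim: s {Hs B cB} phi cphi => [|p s IH] phi cphi.
  rewrite (_ : laplace_test _ _ = (fun=> 0)); first by rewrite integralM_cst mul0r.
  apply/funext => q; rewrite /laplace_test big_nil mulr0 mul0r subr0.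
  rewrite (@gradM_near _ _ _ _ f _ (fun=> 0)); first by rewrite gradM_cst mxE.
  by near=> q'; rewrite big_nil.
have c1 : C1M A (fun q => b p q * phi q) := C1MM (cb p) cphi.
have c2 : C1M A (fun q => \sum_(j <- s) b j q * phi q).
  by apply: C1M_sum => j; exact: C1MM (cb j) cphi.
rewrite (_ : laplace_test _ _ = (fun q => laplace_test (fun q => b p q * phi q) i q +
   laplace_test (fun q => \sum_(j <- s) b j q * phi q) i q)); last first.
  apply/funext => q; rewrite /laplace_test.
  have -> : (fun q => \sum_(j <- p :: s) b j q * phi q) =
            (fun q => b p q * phi q + \sum_(j <- s) b j q * phi q).
    by apply/funext => q'; rewrite big_cons.
  by rewrite (gradMD q c1 c2) mxE big_cons; ring.
rewrite integralMD; [|exact: laplace_test_continuous|exact: laplace_test_continuous].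
rewrite IH // addr0; have [_ _ Ka bK] := Hb p.
by apply: (@laplace_test_local _ _ _ i c1 Ka) => q /bK ->; rewrite mul0r.
Unshelve. all: by end_near. Qed.

End WeakLaplace.

(** * Critical points and secants *)

Section CriticalPoints.
Variables (R : realType) (n : nat) (M : topologicalType).
Variables (A : oriented_atlas R n M) (f : M -> 'rV[R]_n.+2).
Hypothesis fe : embedded_hypersurface A f.
Implicit Types (a b : chart A) (x : 'rV[R]_n) (p q : M) (psi phi : M -> R).
Local Notation nu := (nu A f).
Local Notation gradM := (gradM A f).

Lemma gradM_max psi p : C1M A psi -> (\forall q \near p, psi q <= psi p) -> gradM psi p = 0.
Proof.
move=> cp pmax; set a := chart_at A p.
have ap : dom a p by exact: dom_chart_at.
rewrite /gradM /gradc (_ : dchart _ _ _ = 0) ?mul0mx //.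
set x := mcoord a p; have ax : image a x by exact: image_coord.
apply/rowP => k; rewrite !mxE; pose g := psi \o param a; pose v : 'rV[R]_n := delta_mx 0 k.
have ng : \forall y \near x, g y <= g x /\ differentiable g y.
  near=> y; split; last by near: y; exact: (cp _ _ ax).1.
  near: y; have := @Defs.param_continuous _ _ _ A a x ax.
  by rewrite /prop_for /continuous_at /g /= coordK // => /(_ _ pmax).
have /nbhs_ballP [r /= r0 H] := ng.
have r2 : 0 < r / 2 by rewrite divr_gt0.
have v1 : `|v| <= 1.
  by apply: norm_le_coord => // i; rewrite mxE eqxx; case: eqP; rewrite ?normr1 ?normr0.
have inb t : t \in `]- (r / 2), r / 2[ -> ball x r (x + t *: v).
  rewrite in_itv /= -ltr_norml => tr.
  rewrite -ball_normE /= opprD addrA subrr sub0r normrN normrZ.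
  apply: (@le_lt_trans _ _ `|t|); first by rewrite ler_piMr.
  by apply: lt_trans tr _; rewrite ltr_pdivrMr // ltr_pMr // ltr1n.
have x0 : x + 0 *: v = x by rewrite scale0r addr0.
have := @derive1_at_max R (fun t => g (x + t *: v)) (- (r / 2)) (r / 2) 0.
case.
- by rewrite -subr_ge0 opprK addr_ge0 // ltW.
- move=> t /inb /H [_ d]; have [] := @derive_line _ _ g x v t (diff_derivable d).
  exact.
- by rewrite in_itv /= oppr_lt0 r2.
- by move=> t /inb /H [h _]; rewrite x0.
move=> _ <-.
have [_ d] := H _ (ballxx x r0).
have [_ E] : is_derive (0 : R) 1 (fun t : R => g (x + t *: v)) ('D_v g (x + 0 *: v)).
  by apply: derive_line; rewrite x0; exact: diff_derivable.
by rewrite E x0.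
Unshelve. all: by end_near. Qed.

Lemma C1M_dot (y : 'rV[R]_n.+2) : C1M A (fun q => dotv y (f q)).
Proof.
move=> a x ax.
by apply: (C1at_sum _ (P := xpredT)) => c _; apply: C1atZ; exact: chart_C1.
Qed.

Lemma gradM_dot (y : 'rV[R]_n.+2) p :
  gradM (fun q => dotv y (f q)) p = y - dotv y (f p) *: f p - dotv y (nu p) *: nu p.
Proof.
have ap := dom_chart_at A p; have ia := image_coord ap.
transitivity (y *m (1%:M - (f p)^T *m f p - (nu p)^T *m nu p)); last first.
  by rewrite !mulmxBr mulmx1 !mulmxA !mx11_dotv !mul_scalar_mx.
rewrite -(af_proj (frame_at fe ap)) /gradM /gradc !mulmxA; congr (_ *m _ *m _).
apply/rowP => k; rewrite [LHS]mxE [RHS]mxE.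
have dk c : derivable (fun x => y 0 c * f (param (chart_at A p) x) 0 c)
    (mcoord (chart_at A p) p) (delta_mx 0 k).
  by apply: C1at_derivable; apply: C1atZ; exact: chart_C1.
rewrite (_ : _ \o _ = (fun x => \sum_c y 0 c * f (param (chart_at A p) x) 0 c)) //.
rewrite (derive_suml _ dk).2; apply: eq_bigr => c _.
rewrite deriveMl; last by apply: C1at_derivable; exact: chart_C1.
by rewrite [_^T _ _]mxE (tangentE fe _ _ ia).
Qed.

Lemma gradMM psi phi p : C1M A psi -> C1M A phi ->
  gradM (fun q => psi q * phi q) p = phi p *: gradM psi p + psi p *: gradM phi p.
Proof.
move=> c1 c2; apply: gradM_comb => a x v ax ap.
rewrite -[fun q => psi q * phi q]/(psi \* phi).
have -> : (psi \* phi) \o param a = (psi \o param a) * (phi \o param a) by [].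
rewrite deriveM; [|by apply: C1at_derivable; exact: c1|by apply: C1at_derivable; exact: c2].
by rewrite /= ap addrC.
Qed.

(* Uniform first-order contact with the tangent plane along secants. *)
Lemma secant p (e : R) : 0 < e -> exists W, nbhs p W /\
  forall q q', W q -> W q' -> `|dotv (nu p) (f q) - dotv (nu p) (f q')| <= e * `|f q - f q'|.
Proof.
move=> e0; set a := chart_at A p.
have ap : dom a p by exact: dom_chart_at.
set x := mcoord a p; have ax : image a x by exact: image_coord.
have [c c0 Hc] := immersion_bound (fun j => chart_C1 fe j ax) (chart_diff fe ax) (tangent_free fe ax).
pose g y := dotv (nu p) (f (param a y)).
have cg : C1at g x by exact: (C1M_dot (nu p) ax).
(* The height over the tangent plane at [p] is critical at [p], since its derivatives pair the
   tangent frame with [nu p]. Strict differentiability then controls all secants near [p], and the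
   constant [c] of the immersion turns coordinate distances into distances of images. *)
have Dg v : 'D_v g x = 0.
  rewrite derive_rV; last exact: C1at_diff.
  apply: big1 => k _.
  have -> : 'D_(delta_mx 0 k) g x = (tangent f a x *m (nu p)^T) k 0.
    have dk j : derivable (fun y => nu p 0 j * f (param a y) 0 j) x (delta_mx 0 k).
      by apply: C1at_derivable; apply: C1atZ; exact: chart_C1.
    rewrite /g /dotv (derive_suml _ dk).2 mxE; apply: eq_bigr => j _.
    rewrite deriveMl; last by apply: C1at_derivable; exact: chart_C1.
    by rewrite [_^T _ _]mxE (tangentE fe _ _ ax); exact: mulrC.
  by rewrite (af_Fv (frame_at fe ap)) mxE mulr0.
have Hg := strict_diff cg (mulr_gt0 e0 c0).
have [r [r0 rc rg]] : exists r : R, [/\ 0 < r,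
    forall y y', ball x r y -> ball x r y' -> c * `|y - y'| <= `|(f \o param a) y - (f \o param a) y'|
    & forall y y', ball x r y -> ball x r y' -> `|g y - g y' - 'D_(y - y') g x| <= e * c * `|y - y'|].
  have : \forall r \near (0 : R)^'+, [/\ 0 < r,
    forall y y', ball x r y -> ball x r y' -> c * `|y - y'| <= `|(f \o param a) y - (f \o param a) y'|
    & forall y y', ball x r y -> ball x r y' -> `|g y - g y' - 'D_(y - y') g x| <= e * c * `|y - y'|].
    by near=> r; split; near: r; [exact: nbhs_right_gt|exact: Hc|exact: Hg].
  by move=> /filter_ex.
exists (dom a `&` mcoord a @^-1` ball x r); split.
  apply: filterI; first exact: dom_nbhs.
  have h := Defs.coord_continuous ap; apply: h.
  by apply/nbhs_ballP; exists r.
move=> q q' [aq xq] [aq' xq'].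
have := rg _ _ xq xq'; rewrite Dg subr0 /g !coordK // => h.
apply: (le_trans h); rewrite -mulrA ler_pM2l //.
by have := rc _ _ xq xq'; rewrite /= !coordK.
Unshelve. all: by end_near. Qed.

End CriticalPoints.

(** * Consequences of the reflection symmetry *)

Section Symmetry.
Variables (R : realType) (n : nat) (M : ptopologicalType).
Variables (A : oriented_atlas R n M) (f : M -> 'rV[R]_n.+2).
Variable dM : {measure set (borel M) -> \bar R}.
Hypotheses (Mc : closed_manifold M) (fe : embedded_hypersurface A f).
Hypotheses (dMv : volume_element A f dM) (fm : minimal A f).
Hypotheses (fs : reflection_symmetric (range f)) (fng : ~ totally_geodesic A f).
Implicit Types (a b : chart A) (x : 'rV[R]_n) (p q : M) (psi phi : M -> R).
Local Notation nu := (nu A f).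
Local Notation gradM := (gradM A f).

(** For [n = 0] every [sff p] is an empty matrix, hence 0. *)
Lemma dim_gt0 : (0 < n)%N.
Proof.
rewrite lt0n; apply/eqP => n0; apply: fng => p; apply/matrixP => i.
by have := ltn_ord i; rewrite {2}n0.
Qed.

Lemma reflection_lift j : exists s : M -> M, forall q, f (s q) = coord_reflection j (f q).
Proof.
suff H q : exists q', f q' = coord_reflection j (f q) by have [s Hs] := choice H; exists s.
have : range f (coord_reflection j (f q)) by rewrite -(fs j); exists (f q) => //; exists q.
by case=> q' _ <-; exists q'.
Qed.

Lemma f_inj : injective f.
Proof. by have [_ _ _ h _] := fe. Qed.

(** By injectivity [s] is the reflection read through [f]; as open sets of M are preimages under
    [f], continuity passes from the reflection to [s]. *)
Lemma reflection_fix j (s : M -> M) p : (forall q, f (s q) = coord_reflection j (f q)) ->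
  f p 0 j = 0 -> {for p, continuous s} /\ s p = p.
Proof.
move=> sf pj.
have sp : s p = p.
  apply: f_inj; rewrite sf; apply/rowP => k; rewrite mxE; case: eqP => // ->.
  by rewrite pj oppr0.
split => //; rewrite /prop_for /continuous_at sp => U nU.
have [U' [oU' U'p] UU'] : exists2 B, open_nbhs p B & B `<=` U by move: nU; rewrite nbhsE.
change (nbhs p (s @^-1` U)).
have [_ _ _ _ /(_ _ oU') [V oV UV]] := fe.
have cr : {for f p, continuous (coord_reflection j : 'rV[R]_n.+2 -> _)}.
  move=> B /nbhs_ballP [e /= e0 eB]; apply/nbhs_ballP; exists e => //= y.
  rewrite -ball_normE /= => h; apply: eB; rewrite -ball_normE /=; apply: le_lt_trans h.
  apply: norm_le_coord => // k; rewrite !mxE; case: eqP => _.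
    by rewrite -opprD normrN; have := coord_norm (f p - y) k; rewrite !mxE.
  by have := coord_norm (f p - y) k; rewrite !mxE.
have Vp : V (coord_reflection j (f p)) by rewrite -sf sp -[V (f p)]/((f @^-1` V) p) -UV.
have h : nbhs p [set q | V (coord_reflection j (f q))].
  have cc : {for p, continuous (coord_reflection j \o f)}.
    by apply: continuous_comp; [exact: (f_continuous fe)|exact: cr].
  by apply: cc; exact: open_nbhs_nbhs.
apply: filterS h => q Vq; apply: UU'; rewrite UV /=.
by rewrite /= sf.
Qed.

(** For [q] near [p] the reflected point [s q] is near [p] too, and the chord between their images
    is 2 f_j(q) e_j. If nu_j(p) is nonzero, a nonzero chord in this direction is not almost tangent
    at [p], against [secant]. *)
Lemma tangential_open j p : f p 0 j = 0 -> nu p 0 j != 0 -> \forall q \near p, f q 0 j = 0.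
Proof.
move=> pj nj; have [s sf] := reflection_lift j.
have [cs sp] := reflection_fix sf pj.
have e0 : 0 < `|nu p 0 j| / 2 by rewrite divr_gt0 // normr_gt0.
have [W [nW HW]] := secant fe p e0.
have nsW : nbhs p (s @^-1` W) by apply: cs; rewrite sp.
near=> q.
have Wq : W q by near: q.
have Wsq : W (s q) by near: q.
have := HW _ _ Wq Wsq; rewrite -dotvBr sf.
have -> : f q - coord_reflection j (f q) = (2 * f q 0 j) *: delta_mx 0 j.
  apply/rowP => k; rewrite !mxE eqxx /=; case: eqP => [->|_]; last by rewrite subrr mulr0.
  by rewrite opprK mulr1; ring.
rewrite dotvZr dotv_delta normrM => h.
have h2 : `|(2 * f q 0 j) *: (delta_mx 0 j : 'rV[R]_n.+2)| <= `|2 * f q 0 j|.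
  apply: norm_le_coord => // k; rewrite !mxE eqxx /=.
  by case: eqP => _; rewrite ?mulr1 // mulr0 normr0.
have h3 := le_trans h (ler_wpM2l (ltW e0) h2).
apply/eqP; apply: contraT => fq.
have f0 : 0 < `|2 * f q 0 j| by rewrite normr_gt0 mulf_neq0.
move: h3; rewrite mulrC ler_pM2r // ler_pdivlMr // ger_pMr ?normr_gt0 // ?ler_pMl.
by rewrite lern1.
Unshelve. all: by end_near. Qed.

End Symmetry.

Lemma dotv_bounds (R : realType) (N : nat) (y z : 'rV[R]_N) : dotv y y = 1 -> dotv z z = 1 ->
  -1 <= dotv y z <= 1.
Proof.
move=> yy zz; have := dotvv_ge0 (y - z); have := dotvv_ge0 (y + z).
rewrite !dotvBl !dotvBr !dotvDl !dotvDr (dotvC z y) yy zz => h1 h2.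
by apply/andP; split; lra.
Qed.

(** * Excluding a great sphere component *)

Section FreeBoundary.
Variables (R : realType) (n : nat) (M : ptopologicalType).
Variables (A : oriented_atlas R n M) (f : M -> 'rV[R]_n.+2).
Variable dM : {measure set (borel M) -> \bar R}.
Hypotheses (Mc : closed_manifold M) (fe : embedded_hypersurface A f).
Hypotheses (dMv : volume_element A f dM) (fm : minimal A f).
Hypotheses (fs : reflection_symmetric (range f)) (fng : ~ totally_geodesic A f).
Implicit Types (a b : chart A) (x : 'rV[R]_n) (p q : M) (psi phi : M -> R).
Local Notation nu := (nu A f).
Local Notation gradM := (gradM A f).

Lemma f_coord_continuous j : continuous (fun q => f q 0 j).
Proof. exact: C1M_continuous (C1M_f fe j). Qed.

Lemma nu_coord_continuous j : continuous (fun q => nu q 0 j).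
Proof. exact: C1M_continuous (C1M_nu fe j). Qed.

Lemma closed_eq_continuous (g : M -> R) (c : R) : continuous g -> closed [set q | g q = c].
Proof.
move=> cg; apply: (@preimage_closed M R g [set c]); first by move=> q _; exact: cg.
exact: closed_eq.
Qed.

Variable j : 'I_n.+2.

(** The set to be shown empty: around each of its points M is a piece of the great sphere x_j =
    0. *)
Let Z := [set p | f p 0 j = 0 /\ nu p 0 j != 0].

Let Z_normal p : Z p -> delta_mx 0 j = nu p 0 j *: nu p.
Proof.
move=> [pj nj]; have := gradM_f fe j p.
rewrite (@gradM_near _ _ _ A f _ (fun=> 0)); last exact: (tangential_open fe fs pj nj).
by rewrite gradM_cst pj scale0r subr0 => /esym/eqP; rewrite subr_eq0 => /eqP.
Qed.

Let Z_sq p : Z p -> nu p 0 j ^+ 2 = 1.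
Proof. by move=> /Z_normal /rowP /(_ j); rewrite !mxE !eqxx => h; rewrite expr2 -h. Qed.

Let Z_near p : Z p -> \forall q \near p, Z q.
Proof.
move=> Zp; have h := tangential_open fe fs Zp.1 Zp.2.
have h2 : \forall q \near p, nu q 0 j != 0.
  apply: (@nu_coord_continuous j p [set t | t != 0]).
  by apply: open_nbhs_nbhs; split; [exact: open_neq|exact: Zp.2].
by near=> q; split; near: q.
Unshelve. all: by end_near. Qed.

(** On [Z] the normal is e_j up to sign, so the open condition nu_j != 0 can be replaced by the
    closed condition nu_j^2 = 1. *)
Let Z_closed : closed Z.
Proof.
have -> : Z = [set q | f q 0 j = 0] `&` [set q | nu q 0 j * nu q 0 j = 1].
  apply/seteqP; split=> p.
    by move=> Zp; split; [exact: Zp.1|rewrite /= -expr2; exact: Z_sq].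
  move=> [pj nj]; split => //; apply/eqP => n0; move: nj; rewrite /= n0 mulr0 => /esym/eqP.
  by rewrite oner_eq0.
apply: closedI; first exact: closed_eq_continuous (f_coord_continuous (j := j)).
apply: closed_eq_continuous => q; apply: continuous_atM; exact: nu_coord_continuous.
Qed.

Let cauchy (y z : 'rV[R]_n.+2) : dotv y y = 1 -> dotv z z = 1 -> dotv y z = 1 -> y = z.
Proof.
move=> yy zz yz; apply/eqP; rewrite -subr_eq0 -dotvv_eq0.
by rewrite !dotvBl !dotvBr (dotvC z y) yy zz yz !subrr.
Qed.

(** A maximum on [Z] of the linear function given by [y] is critical on M because [Z] is open. As
    the normal is parallel to e_j, criticality forces [y] to be plus or minus [f p]. *)
Let Z_sphere p0 (y : 'rV[R]_n.+2) : Z p0 -> dotv y y = 1 -> y 0 j = 0 -> exists2 p, Z p & f p = y.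
Proof.
move=> Zp0 yy yj.
have cy := C1M_dot fe y.
have [||p /set_mem Zp Hp] := @compact_EVT_max M R (fun q => dotv y (f q)) Z _
    (closed_compact Mc Z_closed).
- by exists p0.
- exact: continuous_subspaceT (C1M_continuous cy).
have pmax : \forall q \near p, dotv y (f q) <= dotv y (f p).
  by apply: filterS (Z_near Zp) => q Zq; apply: Hp; exact/mem_set.
have yn q : Z q -> dotv y (nu q) = 0.
  move=> Zq; apply: (@mulfI _ (nu q 0 j)); first exact: Zq.2.
  by rewrite mulr0 -dotvZr -Z_normal // dotv_delta.
have := gradM_max f cy pmax; rewrite (gradM_dot fe) yn // scale0r subr0.
move=> /eqP; rewrite subr_eq0 => /eqP yE.
set c := dotv y (f p) in yE Hp.
have c2 : c ^+ 2 = 1 by rewrite -yy yE dotvZl dotvZr (f_sphere fe) mulr1 expr2.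
move/eqP: c2; rewrite -subr_eq0 -[X in _ - X](expr1n _ 2) subr_sqr mulf_eq0 subr_eq0.
case/orP => [/eqP c1|]; first by exists p => //; rewrite yE c1 scale1r.
(* If the maximum is -1, the function is constantly -1 on [Z], so [f] is constant near [p]. The
   tangential projection is then 0, and its trace gives [n = 0]. *)
rewrite addr_eq0 => /eqP c1.
have fZ q : Z q -> f q = f p.
  move=> Zq; apply: cauchy; rewrite ?(f_sphere fe) //.
  have h := Hp q (mem_set Zq).
  have /andP[h1 _] := dotv_bounds yy (f_sphere fe q).
  have : dotv y (f q) = -1 by apply/eqP; rewrite eq_le h1 andbT -c1.
  by rewrite yE c1 dotvZl mulN1r => /oppr_inj; rewrite dotvC.
have P0 c' : delta_mx 0 c' - f p 0 c' *: f p - nu p 0 c' *: nu p = 0.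
  rewrite -(gradM_f fe) (@gradM_near _ _ _ A f _ (fun=> f p 0 c')) ?gradM_cst //.
  by apply: filterS (Z_near Zp) => q Zq; rewrite fZ.
have : \sum_c' (1 - f p 0 c' * f p 0 c' - nu p 0 c' * nu p 0 c') = 0 :> R.
  by apply: big1 => c' _; have /rowP /(_ c') := P0 c'; rewrite !mxE !eqxx.
rewrite !sumrB -/(dotv (f p) (f p)) -/(dotv (nu p) (nu p)) (f_sphere fe) (nu_norm fe).
rewrite sumr_const card_ord -addrA -opprD => /eqP; rewrite subr_eq0 (_ : 1 + 1 = 2%:R) //.
by rewrite eqr_nat => /eqP [n0]; move: (dim_gt0 fng); rewrite lt0n => /eqP.
Qed.

(* Frankel's theorem for a great sphere, via the weak Laplace equation tested
   with the locally constant function sign(f_j) off the great sphere. *)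
Let Z_full p0 : Z p0 -> forall q, Z q.
Proof.
move=> Zp0 q; apply: contrapT => nZq.
(* [Z] alone already covers the great sphere, so by injectivity no other point of M lies on the
   hyperplane. *)
have fj p : ~ Z p -> f p 0 j != 0.
  move=> nZp; apply/eqP => pj; apply: nZp.
  have [p' Zp' E] := Z_sphere Zp0 (f_sphere fe p) pj.
  by rewrite -(f_inj fe E).
pose psi p := if p \in Z then 0 else Num.sg (f p 0 j).
have psi_loc p : \forall p' \near p, psi p = psi p'.
  have [Zp|nZp] := pselect (Z p).
    by apply: filterS (Z_near Zp) => p' Zp'; rewrite /psi !mem_set.
  have oZ : open (~` Z) by exact: closed_openC Z_closed.
  have nn : nbhs p (~` Z) := @open_nbhs_nbhs _ p (~` Z) (conj oZ nZp).
  have cf := @f_coord_continuous j p.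
  have := fj _ nZp; rewrite neq_lt => /orP[s0|s0].
    have ns : \forall p' \near p, f p' 0 j < 0.
      by apply: (cf [set t | t < 0]); apply: open_nbhs_nbhs; split => //; exact: open_lt.
    apply: filterS2 nn ns => p' nZp' sp'.
    by rewrite /psi (memNset nZp) (memNset nZp') !ltr0_sg.
  have ns : \forall p' \near p, 0 < f p' 0 j.
    by apply: (cf [set t | 0 < t]); apply: open_nbhs_nbhs; split => //; exact: open_gt.
  apply: filterS2 nn ns => p' nZp' sp'.
  by rewrite /psi (memNset nZp) (memNset nZp') !gtr0_sg.
have cpsi : C1M A psi.
  move=> a x ax; apply: C1at_near_eq (C1at_cst (psi (param a x)) x).
  have h := @Defs.param_continuous _ _ _ A a x ax.
  exact: (h _ (psi_loc (param a x))).
have := weak_laplace Mc fe dMv fm j cpsi.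
(* [psi] is locally constant, so only the term of order zero remains in the weak equation: the
   integral of |f_j| off [Z]. *)
have -> : laplace_test A f psi j = (fun p => - n%:R * (psi p * f p 0 j)).
  apply/funext => p; rewrite /laplace_test (@gradM_near _ _ _ A f psi (fun=> psi p)).
    by rewrite gradM_cst mxE; ring.
  by apply: filterS (psi_loc p) => p' ->.
have cpf : continuous (fun p => psi p * f p 0 j).
  move=> p; apply: continuous_atM; first exact: C1M_continuous cpsi p.
  exact: f_coord_continuous.
rewrite (integralMZ Mc fe dMv _ cpf) => /eqP.
rewrite mulf_eq0 oppr_eq0 pnatr_eq0 eqn0Ngt (dim_gt0 fng) /= => /eqP I0.
have psi0 p : 0 <= psi p * f p 0 j.
  rewrite /psi; case: ifP => _; first by rewrite mul0r; exact: lexx.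
  by rewrite -normrEsg; exact: normr_ge0.
have := integralM_eq0 Mc fe dMv cpf psi0 I0 q.
rewrite /psi (memNset nZq) -normrEsg => /eqP; rewrite normr_eq0.
by rewrite (negbTE (fj _ nZq)).
Qed.

Let Z_geodesic : (forall q, Z q) -> totally_geodesic A f.
Proof.
move=> ZT p.
have g0 c : gradM (fun q => nu q 0 c) p = 0.
  have [->|cj] := eqVneq c j.
    have := gradMM f p (C1M_nu fe j) (C1M_nu fe j).
    rewrite (_ : (fun q : M => nu q 0 j * nu q 0 j) = (fun=> 1)); last by apply/funext => q; rewrite -expr2 Z_sq.
    rewrite gradM_cst -scalerDl -mulr2n => /esym/eqP; rewrite scaler_eq0 mulrn_eq0 /=.
    by rewrite (negbTE (ZT p).2) => /eqP.
  rewrite (_ : (fun q => nu q 0 c) = (fun=> 0)) ?gradM_cst //.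
  apply/funext => q; apply: (@mulfI _ (nu q 0 j)); first exact: (ZT q).2.
  have /rowP /(_ c) := Z_normal (ZT q); rewrite !mxE eqxx /= (negbTE cj) => <-.
  by rewrite mulr0.
have := grad_nu_sqnorm fe p; rewrite big1; last first.
  by move=> c _; rewrite rowK g0 dotv0l.
move=> /esym S0; apply/matrixP => i k; rewrite [RHS]mxE; apply/eqP.
rewrite -sqrf_eq0; apply/eqP.
have S1 := psumr_eq0P (fun i _ => sumr_ge0 _ (fun k _ => sqr_ge0 (sff A f p i k))) S0.
exact: (psumr_eq0P (fun k _ => sqr_ge0 (sff A f p i k)) (S1 i isT)).
Qed.

Lemma nu_vanish p : f p 0 j = 0 -> nu p 0 j = 0.
Proof.
move=> pj; apply/eqP; apply: contraT => nj; exfalso; apply: fng.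
by apply: Z_geodesic; apply: (@Z_full p).
Qed.

End FreeBoundary.

(** * Truncation near zero *)

Section Truncation.
Variable R : realType.
Implicit Types (d t : R).

(* [shrink d] moves [t] towards 0 by [d]; its square is of class C^1. *)
Definition shrink d t : R := Num.max (t - d) 0 - Num.max (- t - d) 0.

Lemma shrink_sqr d t : 0 < d -> shrink d t ^+ 2 = sqpos (t - d) + sqpos (- t - d).
Proof.
move=> d0; rewrite /shrink /sqpos.
case: (leP (t - d) 0) => h1; case: (leP (- t - d) 0) => h2; try ring.
by exfalso; lra.
Qed.

Lemma shrink_dist d t : 0 < d -> `|shrink d t - t| <= d.
Proof.
move=> d0; rewrite /shrink.
by case: (leP (t - d) 0) => h1; case: (leP (- t - d) 0) => h2; rewrite ler_norml; apply/andP; split; lra.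
Qed.

Lemma shrink0 d t : `|t| <= d -> shrink d t = 0.
Proof.
rewrite ler_norml => /andP[h1 h2]; rewrite /shrink !max_r ?subrr //; lra.
Qed.

Lemma shrink_lower d t : 0 < d -> `|t| <= 1 -> t ^+ 2 - 2 * d <= shrink d t ^+ 2.
Proof.
move=> d0; rewrite ler_norml => /andP[h1 h2]; rewrite /shrink.
by case: (leP (t - d) 0) => h3; case: (leP (- t - d) 0) => h4; nra.
Qed.

(** Half of |a + b|^2 is at most |a|^2 + |b|^2. Meant for [w] the vector in the completed square,
    [y] the coordinate f_i, [g] its gradient and [e] the error of the truncation. *)
Lemma weighted_norm_bound (N : nat) (w g : 'rV[R]_N) (y e c : R) : y ^+ 2 <= 1 ->
  e ^+ 2 * dotv g g <= c -> 2^-1 * dotv (y *: w + e *: g) (y *: w + e *: g) - c <= dotv w w.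
Proof.
move=> y1 h3; have h1 := dotvv_ge0 (y *: w - e *: g).
have h2 : y ^+ 2 * dotv w w <= dotv w w by rewrite ler_piMl // dotvv_ge0.
move: h1 h2 h3; rewrite !dotvBl !dotvBr !dotvDl !dotvDr !dotvZl !dotvZr (dotvC g w) !expr2.
move: (dotv w w) (dotv w g) (dotv g g) => a1 a2 a3; rewrite !mulrA => h1 h2 h3.
by rewrite [e * y]mulrC in h1 *; lra.
Qed.

Lemma sum_affine (N : nat) (x l v : 'I_N -> R) (a b c e : R) :
  \sum_i (a * x i - b + l i + c * (v i - e)) =
  a * \sum_i x i - N%:R * b + \sum_i l i + c * (\sum_i v i - N%:R * e).
Proof.
have sc (z : R) : \sum_(i < N) z = N%:R * z by rewrite sumr_const card_ord mulr_natl.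
by rewrite !big_split /= -!mulr_sumr big_split /= !sumrN !sc.
Qed.

End Truncation.

(** * The inequality with truncation at height d *)

Section Inequality.
Local Opaque minimal totally_geodesic volume_element reflection_symmetric.
Variables (R : realType) (n : nat) (M : ptopologicalType).
Variables (A : oriented_atlas R n M) (f : M -> 'rV[R]_n.+2).
Variable dM : {measure set (borel M) -> \bar R}.
Hypotheses (Mc : closed_manifold M) (fe : embedded_hypersurface A f).
Hypotheses (dMv : volume_element A f dM) (fm : minimal A f).
Hypotheses (fs : reflection_symmetric (range f)) (fng : ~ totally_geodesic A f).
Implicit Types (a b : chart A) (x : 'rV[R]_n) (p q : M) (psi phi : M -> R).
Local Notation nu := (nu A f).
Local Notation gradM := (gradM A f).
Let nu0 i p := @nu_vanish R n M A f dM Mc fe dMv fm fs fng i p.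

Let gnu i p := gradM (fun q => nu q 0 i) p.
Let gf i p := gradM (fun q => f q 0 i) p.

Variables (d : R) (d0 : 0 < d).

Let sq i p := shrink d (nu p 0 i) ^+ 2.

Let sq_C1 i : C1M A (sq i).
Proof.
have -> : sq i = (fun p => sqpos (nu p 0 i + - d) + sqpos (-1 * nu p 0 i + - d)).
  by apply/funext => p; rewrite /sq shrink_sqr // mulN1r.
apply: C1MD; apply: C1M_sqpos; apply: C1MD; try exact: C1M_cst; first exact: C1M_nu.
by apply: C1MM; [exact: C1M_cst|exact: C1M_nu].
Qed.

Let sq_derive i a x v : image a x ->
  'D_v (sq i \o param a) x =
  2 * shrink d (nu (param a x) 0 i) * 'D_v ((fun q => nu q 0 i) \o param a) x.
Proof.
move=> ax; pose g := (fun q => nu q 0 i) \o param a.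
rewrite -/g; have gx : nu (param a x) 0 i = g x by [].
have cg : C1at g x by exact: C1M_nu.
have -> : sq i \o param a = (fun y => (@sqpos R \o (fun y => g y - d)) y + (@sqpos R \o (fun y => - g y - d)) y).
  by apply/funext => y; rewrite /= /sq shrink_sqr.
have c1 : C1at (fun y => g y - d) x by exact: C1atB cg (C1at_cst _ _).
have c2 : C1at (fun y => - g y - d) x by exact: C1atB (C1atN cg) (C1at_cst _ _).
have [e1 E1] := is_derive_comp1 v (C1at_diff c1) (sqpos_derive (g x - d)).
have [e2 E2] := is_derive_comp1 v (C1at_diff c2) (sqpos_derive (- g x - d)).
rewrite deriveD; [|exact: diff_derivable|exact: diff_derivable].
rewrite E1 E2.
have -> : 'D_v (fun y => g y - d) x = 'D_v g x.
  by rewrite deriveB; [rewrite derive_cst subr0|exact: C1at_derivable|exact: derivable_cst].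
have -> : 'D_v (fun y => - g y - d) x = - 'D_v g x.
  rewrite deriveB; [|by apply: derivableN; exact: C1at_derivable|exact: derivable_cst].
  by rewrite derive_cst subr0 deriveN //; exact: C1at_derivable.
rewrite /shrink gx; move: ('D_v g x) (Num.max (g x - d) 0) (Num.max (- g x - d) 0) => D1 m1 m2.
by rewrite mulrN -mulrBl mulrBr.
Qed.

Let psi i p := sq i p * (f p 0 i)^-1.

(** By [nu_vanish] and continuity |nu_i| stays below [d] near a zero of f_i, and the truncation is
    identically 0 there. *)
Let psi_near0 i p : f p 0 i = 0 -> \forall q \near p, psi i q = 0.
Proof.
move=> pi0.
have : \forall q \near p, `|nu q 0 i| < d.
  have np : nu p 0 i = 0 := nu0 pi0.
  apply: (@nu_coord_continuous R n M A f fe i p [set t | `|t| < d]).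
  rewrite np; apply: open_nbhs_nbhs; split => /=; last by rewrite normr0.
  apply: (@open_comp _ _ (fun t : R => `|t|) [set t | t < d]); last exact: open_lt.
  by move=> t _; exact: norm_continuous.
by apply: filterS => q /ltW qd; rewrite /psi /sq shrink0 // expr0n mul0r.
Qed.

Let psi_C1 i : C1M A (psi i).
Proof.
move=> a x ax; have [fx|fx] := eqVneq (f (param a x) 0 i) 0.
  apply: C1at_near_eq (@C1at_cst _ _ 0 x).
  have h : nbhs x (fun y => psi i (param a y) = 0) :=
    @Defs.param_continuous _ _ _ A a x ax _ (psi_near0 fx).
  by apply: filterS h => y /= ->.
apply: C1atM; first exact: sq_C1.
by apply: (@C1atV _ _ ((fun q => f q 0 i) \o param a)); [exact: (C1M_f fe)|exact: fx].
Qed.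

(** Barta's completed square with the truncation u of nu_i in the coefficient u / f_i: the gradient
    of u^2 is 2 u grad nu_i, so the cross terms of the square are those in the divergence of (u^2 /
    f_i) grad f_i. *)
Let pointwise_identity i p :
  dotv (gnu i p) (gnu i p) =
  dotv (gnu i p - (shrink d (nu p 0 i) / f p 0 i) *: gf i p)
       (gnu i p - (shrink d (nu p 0 i) / f p 0 i) *: gf i p)
  + laplace_test A f (psi i) i p + n%:R * sq i p.
Proof.
rewrite /laplace_test; have [fx|fx] := eqVneq (f p 0 i) 0.
  (* At a zero of f_i both [psi i] and its gradient vanish, and so does the coefficient of grad f_i,
     because [invr0] sends the inverse of 0 to 0. *)
  rewrite (@gradM_near _ _ _ A f (psi i) (fun=> 0)); last exact: psi_near0.
  by rewrite gradM_cst mxE fx invr0 !mulr0 scale0r subr0 /sq nu0 // shrink0 ?normr0 ?ltW //; ring.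
set u := shrink d (nu p 0 i).
have -> : gradM (psi i) p = (2 * u / f p 0 i) *: gnu i p + (- (u ^+ 2 / f p 0 i ^+ 2)) *: gf i p.
  apply: gradM_comb => a x v ax xp.
  have cs : C1at (sq i \o param a) x by exact: sq_C1.
  have cfx : C1at ((fun q => f q 0 i) \o param a) x by exact: chart_C1.
  have fx' : ((fun q => f q 0 i) \o param a) x != 0 by rewrite /= xp.
  rewrite -[psi i \o param a]/(fun y => (sq i \o param a) y * (((fun q => f q 0 i) \o param a) y)^-1).
  rewrite deriveM; [|exact: C1at_derivable|by apply: derivableV => //; exact: C1at_derivable].
  rewrite (deriveV fx'); last exact: C1at_derivable.
  rewrite (sq_derive i v ax) /= xp /sq -/u.
  rewrite -[_ *: 'D_v _ x]/(- f p 0 i ^- 2 * 'D_v ((fun q => f q 0 i) \o param a) x).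
  set D1 := 'D_v _ x; set D2 := 'D_v _ x.
  rewrite -[X in X + _ = _]/(u ^+ 2 * (- f p 0 i ^- 2 * D1)).
  rewrite -[X in _ + X = _]/((f p 0 i)^-1 * (2 * u * D2)).
  by field.
have g1 : gnu i p 0 i = dotv (gnu i p) (gf i p) := esym (dotv_gradM_f fe _ _ _).
have g2 : gf i p 0 i = dotv (gf i p) (gf i p) := esym (dotv_gradM_f fe _ _ _).
rewrite /psi /sq -/u; move: (gnu i p) (gf i p) g1 g2 => v w g1 g2.
rewrite mxE [(_ *: v) 0 i]mxE [(_ *: w) 0 i]mxE g1 g2.
rewrite !dotvBl !dotvBr !dotvZl !dotvZr (dotvC w v).
move: u (f p 0 i) fx (dotv v v) (dotv v w) (dotv w w) => u y fx a1 a2 a3.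
by field.
Qed.

(** The completed square multiplied by f_i^2 and freed from the truncation. It has no denominator
    and does not involve [d], so it survives the limit, and its vanishing is the equality
    condition. *)
Let defect i p := dotv (f p 0 i *: gnu i p - nu p 0 i *: gf i p)
                       (f p 0 i *: gnu i p - nu p 0 i *: gf i p).

Lemma coord_le1 (y : 'rV[R]_n.+2) i : dotv y y = 1 -> y 0 i ^+ 2 <= 1.
Proof.
move=> <-; rewrite /dotv (bigD1 i) //= expr2 lerDl.
by apply: sumr_ge0 => c _; rewrite -expr2 sqr_ge0.
Qed.

Let gf_le1 i p : dotv (gf i p) (gf i p) <= 1.
Proof.
rewrite {2}/gf dotv_gradM_f // /gf gradM_f // !mxE !eqxx.
have := sqr_ge0 (f p 0 i); have := sqr_ge0 (nu p 0 i); rewrite !expr2.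
by rewrite /= => h1 h2; lra.
Qed.

(** The error [d ^+ 2] comes from restoring nu_i in the completed square, as |grad f_i| is at most
    1; the error [2 * d] comes from restoring nu_i^2 in the last term. *)
Let pointwise_bound i p :
  2^-1 * defect i p - d ^+ 2 + laplace_test A f (psi i) i p + n%:R * (nu p 0 i ^+ 2 - 2 * d)
  <= dotv (gnu i p) (gnu i p).
Proof.
rewrite pointwise_identity; apply: lerD; last first.
  rewrite ler_wpM2l // /sq; apply: shrink_lower => //.
  by rewrite -(@expr_le1 _ 2) // real_normK ?num_real // coord_le1 // nu_norm.
rewrite lerD2r.
set u := shrink d (nu p 0 i).
have [fx|fx] := eqVneq (f p 0 i) 0.
  apply: le_trans (dotvv_ge0 _); rewrite /defect fx nu0 // !scale0r subr0 dotv0l mulr0 sub0r.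
  by rewrite oppr_le0 sqr_ge0.
have f1 := coord_le1 i (f_sphere fe p).
set w := gnu i p - _.
have E : f p 0 i *: gnu i p - nu p 0 i *: gf i p = f p 0 i *: w + (u - nu p 0 i) *: gf i p.
  rewrite /w; move: (gnu i p) (gf i p) => g1 g2; apply/rowP => c; rewrite !mxE.
  by field.
rewrite /defect E.
apply: weighted_norm_bound => //.
have h := shrink_dist (nu p 0 i) d0; rewrite -/u in h.
have h4 : (u - nu p 0 i) ^+ 2 <= d ^+ 2.
  by rewrite -[X in X <= _]real_normK ?num_real // lerXn2r ?nnegrE // ltW.
apply: le_trans h4; exact: ler_piMr (sqr_ge0 _) (gf_le1 i p).
Qed.

Let dotv_gradM_continuous psi1 psi2 : C1M A psi1 -> C1M A psi2 ->
  continuous (fun p => dotv (gradM psi1 p) (gradM psi2 p)).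
Proof.
move=> c1 c2 p; apply: continuous_at_sum => c; apply: continuous_atM; exact: gradM_cont.
Qed.

Let defect_continuous i : continuous (defect i).
Proof.
move=> p; apply: continuous_at_sum => c.
have h : {for p, continuous (fun q => (f q 0 i *: gnu i q - nu q 0 i *: gf i q) 0 c)}.
  rewrite (_ : (fun q => _) = (fun q => f q 0 i * gnu i q 0 c - nu q 0 i * gf i q 0 c)).
    apply: cvgB; apply: cvgM.
    - exact: C1M_continuous (C1M_f fe i) p.
    - by apply: gradM_cont => //; exact: C1M_nu.
    - exact: C1M_continuous (C1M_nu fe i) p.
    - by apply: gradM_cont => //; exact: C1M_f.
  by apply/funext => q; move: (gnu i q) (gf i q) => g1 g2; rewrite !mxE.
exact: continuous_atM.
Qed.

Definition total_defect p := \sum_i defect i p.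

Lemma sff_sqnorm_continuous : continuous (sff_sqnorm A f).
Proof.
have -> : sff_sqnorm A f = (fun p => \sum_i dotv (gnu i p) (gnu i p)).
  by apply/funext => p; rewrite -(grad_nu_sqnorm fe); apply: eq_bigr => i _; rewrite rowK.
by move=> p; apply: continuous_at_sum => i; apply: dotv_gradM_continuous; exact: C1M_nu.
Qed.

Lemma total_defect_continuous : continuous total_defect.
Proof. by move=> p; apply: continuous_at_sum => i; exact: defect_continuous. Qed.

Lemma total_defect_ge0 p : 0 <= total_defect p.
Proof. by apply: sumr_ge0 => i _; exact: dotvv_ge0. Qed.

Lemma total_defect0 p i : total_defect p = 0 -> f p 0 i *: gnu i p = nu p 0 i *: gf i p.
Proof.
move=> E; have := psumr_eq0P (fun i _ => dotvv_ge0 _) E => /(_ i isT) /eqP.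
by rewrite dotvv_eq0 subr_eq0 => /eqP.
Qed.

Lemma integral_bound :
  2^-1 * integralM dM total_defect + n%:R * volume dM
  <= integralM dM (sff_sqnorm A f) + (d ^+ 2 + 2 * d * n%:R) * n.+2%:R * volume dM.
Proof.
pose c := (d ^+ 2 + 2 * d * n%:R) * n.+2%:R.
pose L p := \sum_i laplace_test A f (psi i) i p.
have cL : continuous L.
  by move=> p; apply: continuous_at_sum => i; exact: laplace_test_continuous.
have cE : continuous (fun p => 2^-1 * total_defect p).
  move=> p; apply: (@continuous_atM _ _ (cst 2^-1) total_defect); first exact: cst_continuous.
  exact: total_defect_continuous.
have cC (k : R) : continuous (fun _ : M => k) by move=> p; exact: cst_continuous.
have L0 : integralM dM L = 0.
  rewrite (integralM_sum Mc fe dMv).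
    by apply: big1 => i _; apply: (weak_laplace Mc fe dMv fm); exact: psi_C1.
  by move=> i; exact: laplace_test_continuous.
have cEL : continuous (fun p => 2^-1 * total_defect p + L p).
  by move=> p; apply: cvgD; [exact: cE|exact: cL].
have H : integralM dM (fun p => (2^-1 * total_defect p + L p) + (n%:R - c)) <=
         integralM dM (sff_sqnorm A f).
  apply: (integralM_le Mc fe dMv).
  - by move=> p; apply: cvgD; [exact: cEL|exact: cC].
  - exact: sff_sqnorm_continuous.
  move=> p; rewrite -(grad_nu_sqnorm fe p).
  apply: (@le_trans _ _ (\sum_i (2^-1 * defect i p - d ^+ 2 + laplace_test A f (psi i) i p
      + n%:R * (nu p 0 i ^+ 2 - 2 * d)))); last first.
    by apply: ler_sum => i _; rewrite rowK; exact: pointwise_bound.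
  rewrite (sum_affine (defect^~ p) (fun i => laplace_test A f (psi i) i p)
    (fun i => nu p 0 i ^+ 2)) -/(L p) -/(total_defect p).
  (* Only the sum over all [n.+2] coordinates produces the constant: |nu|^2 = 1 turns the terms n
     nu_i^2 into [n]. *)
  rewrite (_ : \sum_i nu p 0 i ^+ 2 = 1); last first.
    by rewrite -(nu_norm fe p); apply: eq_bigr => i _; rewrite expr2.
  rewrite /c; move: (total_defect p) (L p) (n%:R : R) (n.+2%:R : R) => e l k m.
  by rewrite le_eqVlt; apply/orP; left; apply/eqP; ring.
rewrite (integralMD Mc fe dMv cEL (cC _)) (integralMD Mc fe dMv cE cL) L0 addr0 in H.
rewrite (integralMZ Mc fe dMv _ total_defect_continuous) integralM_cst in H.
rewrite -/c; move: H; set V := volume dM; lra.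
Qed.

End Inequality.

(** * The limit d -> 0 *)

Section AverageBound.
Variables (R : realType) (n : nat) (M : ptopologicalType).
Variables (A : oriented_atlas R n M) (f : M -> 'rV[R]_n.+2).
Variable dM : {measure set (borel M) -> \bar R}.
Hypotheses (Mc : closed_manifold M) (fe : embedded_hypersurface A f).
Hypotheses (dMv : volume_element A f dM) (fm : minimal A f).
Hypotheses (fs : reflection_symmetric (range f)) (fng : ~ totally_geodesic A f).

Lemma integral_bound0 :
  2^-1 * integralM dM (total_defect A f) + n%:R * volume dM <= integralM dM (sff_sqnorm A f).
Proof.
apply/ler_addgt0Pr => e e0.
have V0 := volume_gt0 Mc fe dMv.
pose c : R := (1 + 2 * n%:R) * n.+2%:R * volume dM.
have c0 : 0 < c by rewrite !mulr_gt0 // ltr_pwDl // mulr_ge0.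
(* [d] at most 1 gives d^2 <= d, so that the whole error is at most [d * c]. *)
pose d : R := Num.min 1 (e / c).
have d0 : 0 < d by rewrite lt_min ltr01 divr_gt0.
apply: le_trans (integral_bound Mc fe dMv fm fs fng d0) _; rewrite lerD2l.
apply: (@le_trans _ _ (d * c)); last first.
  by rewrite -ler_pdivlMr // ge_min lexx orbT.
rewrite /c !mulrA !ler_wpM2r ?(ltW V0) // mulrDr mulr1 [2 * d]mulrC mulrA lerD2r.
by rewrite expr2 ler_piMl ?(ltW d0) // ge_min lexx.
Qed.

Lemma average_ge : n%:R <= average dM (sff_sqnorm A f).
Proof.
have V0 := volume_gt0 Mc fe dMv.
rewrite /average mulrC ler_pdivlMr //; apply: le_trans integral_bound0.
by rewrite lerDr mulr_ge0 // integralM_ge0 // => p; exact: total_defect_ge0.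
Qed.

(** With equality, the retained half of the total defect has integral at most 0; being continuous
    and nonnegative, the defect vanishes everywhere. *)
Lemma average_eq : average dM (sff_sqnorm A f) = n%:R ->
  forall p i, f p 0 i *: gradM A f (fun q => nu A f q 0 i) p =
              nu A f p 0 i *: gradM A f (fun q => f q 0 i) p.
Proof.
have V0 := volume_gt0 Mc fe dMv.
move=> E p i; apply: total_defect0.
have cE := total_defect_continuous fe.
apply: (integralM_eq0 Mc fe dMv cE (@total_defect_ge0 _ _ _ A f)).
apply/eqP; rewrite eq_le integralM_ge0 ?andbT; last by move=> q; exact: total_defect_ge0.
have := integral_bound0; have -> : integralM dM (sff_sqnorm A f) = n%:R * volume dM.
  by rewrite -E /average mulrC mulrA divff ?mul1r // gt_eqF.
by rewrite gerDr pmulr_rle0 // invr_gt0.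
Qed.

End AverageBound.

(** * Diagonal curvature matrices and their tori *)

Section PrincipalCurvatures.
Variables (R : realType) (n : nat).
Implicit Types (I J : {set 'I_n.+2}) (u v : 'I_n.+2) (y : 'rV[R]_n.+2).

(** Both [I] and its complement then have at least two elements, so both factors of the torus are
    spheres of positive dimension. *)
Definition admissible I := (1 < #|I| <= n)%N.

(* The principal curvatures of the torus whose first factor spans the
   coordinates in [I]: lambda^2 = (n - m) / m with m = #|I| - 1. *)
Definition lam I : R := Num.sqrt ((n.+1 - #|I|)%:R / (#|I|.-1)%:R).

Definition curv I (i : 'I_n.+2) : R := if i \in I then lam I else - (lam I)^-1.

(** The squared radius m / n of the factor in the coordinates [I], a sphere of dimension m = #|I| -
    1. *)
Definition block I : R := (#|I|.-1)%:R / n%:R.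

Definition torus I : set 'rV[R]_n.+2 :=
  [set y | \sum_(i in I) y 0 i ^+ 2 = block I /\ \sum_(i in ~: I) y 0 i ^+ 2 = block (~: I)].

Lemma card_compl I : #|~: I| = (n.+2 - #|I|)%N.
Proof. by rewrite cardsCs finset.setCK card_ord. Qed.

Lemma admissibleC I : admissible I -> admissible (~: I).
Proof.
rewrite /admissible card_compl => /andP[h1 h2].
by lia.
Qed.

Lemma admissible_n I : admissible I -> (0 < n)%N.
Proof. by move=> /andP[h1 h2]; exact: leq_trans (ltnW h1) h2. Qed.

Lemma block_gt0 I : admissible I -> 0 < block I.
Proof.
move=> aI; have n0 := admissible_n aI; case/andP: aI => h1 _.
by rewrite divr_gt0 // ltr0n // -subn1 subn_gt0.
Qed.

Lemma lam_gt0 I : admissible I -> 0 < lam I.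
Proof.
move=> /andP[h1 h2]; rewrite sqrtr_gt0 divr_gt0 // ltr0n ?subn_gt0 //.
by rewrite -subn1 subn_gt0.
Qed.

Lemma lam_sqr I : admissible I -> (#|I|.-1)%:R * lam I ^+ 2 = (n.+1 - #|I|)%:R.
Proof.
move=> /andP[h1 h2]; rewrite sqr_sqrtr ?divr_ge0 // mulrC divfK //.
by rewrite pnatr_eq0 -lt0n -subn1 subn_gt0.
Qed.

Lemma curv_inj I I' : admissible I -> admissible I' -> curv I =1 curv I' -> I = I'.
Proof.
move=> aI aI' E; apply/finset.setP => i; have := E i; rewrite /curv.
have [l l'] := (lam_gt0 aI, lam_gt0 aI').
have [m m'] : 0 < (lam I)^-1 /\ 0 < (lam I')^-1 by rewrite !invr_gt0.
by case: (i \in I); case: (i \in I') => // h; lra.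
Qed.

Lemma block_sum I : admissible I -> block I + block (~: I) = 1.
Proof.
move=> aI; have n0 := admissible_n aI; case/andP: aI => h1 h2.
rewrite /block -mulrDl -natrD card_compl.
have -> : (#|I|.-1 + (n.+2 - #|I|).-1 = n)%N by lia.
by rewrite divff // pnatr_eq0 -lt0n.
Qed.

Lemma sum_blocks I (F : 'I_n.+2 -> R) :
  \sum_i F i = \sum_(i in I) F i + \sum_(i in ~: I) F i.
Proof.
rewrite (bigID (fun i => i \in I)) /=; congr (_ + _).
by apply: eq_bigl => i; rewrite inE.
Qed.

Lemma curv_sumE I (F : 'I_n.+2 -> R) : \sum_i curv I i * F i =
  lam I * \sum_(i in I) F i - (lam I)^-1 * \sum_(i in ~: I) F i.
Proof.
rewrite (sum_blocks I) !mulr_sumr -sumrN; congr (_ + _); apply: eq_bigr => i.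
  by rewrite /curv => ->.
by rewrite inE /curv => /negbTE ->; rewrite mulNr.
Qed.

Lemma dotv_blocks I y :
  dotv y y = \sum_(i in I) y 0 i ^+ 2 + \sum_(i in ~: I) y 0 i ^+ 2.
Proof. by rewrite -sum_blocks; apply: eq_bigr => i _; rewrite expr2. Qed.

Lemma lam_balance I : admissible I ->
  (#|I|.-1)%:R * lam I = (n.+1 - #|I|)%:R * (lam I)^-1.
Proof.
move=> aI; rewrite -(lam_sqr aI) expr2 -!mulrA mulfV ?mulr1 //.
by rewrite gt_eqF // lam_gt0.
Qed.

Lemma lam_block I : admissible I -> lam I * block I = (lam I)^-1 * block (~: I).
Proof.
move=> aI; rewrite /block card_compl !mulrA [lam I * _]mulrC lam_balance //.
by rewrite [_^-1 * _]mulrC; congr (_%:R / _ / _); case/andP: aI; lia.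
Qed.

(** Both conditions on the right are linear in the two block sums, with determinant lam + 1 / lam up
    to sign; by [block_sum] and [lam_block] the squared radii are the solution. *)
Lemma curv_torus I y : admissible I ->
  torus I y <-> dotv y y = 1 /\ \sum_i curv I i * y 0 i ^+ 2 = 0.
Proof.
move=> aI; rewrite (dotv_blocks I) curv_sumE /torus /=.
have [[l0 bb] lb] := (lam_gt0 aI, block_sum aI, lam_block aI).
split=> [[-> ->]|[]]; first by rewrite bb lb subrr.
move: (\sum_(i in I) _) (\sum_(i in ~: I) _) => s t st E.
have l1 : lam I + (lam I)^-1 != 0 by rewrite gt_eqF // addr_gt0 // invr_gt0.
have sb : s = block I.
  apply: (mulfI l1); rewrite !mulrDl lb -mulrDr [block (~: I) + _]addrC bb -st.
  by move/eqP: E; rewrite subr_eq0 => /eqP ->; rewrite -mulrDr addrC.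
by split=> //; apply: (@addrI _ s); rewrite st sb bb.
Qed.

(* The two roots of t^2 = 1 + b t are lambda and -1/lambda; the trace condition
   determines lambda. *)
Lemma curv_classify (c : 'I_n.+2 -> R) y b :
  (0 < n)%N -> (forall i, y 0 i != 0) ->
  (forall i, c i ^+ 2 = 1 + b * c i) -> \sum_i c i = b -> \sum_i c i * y 0 i ^+ 2 = 0 ->
  exists2 I, admissible I & c =1 curv I.
Proof.
move=> n0 y0 cq cb cy; pose I : {set _} := [set i | 0 < c i]%SET.
have c0 i : c i != 0.
  by apply/eqP => ci; have := cq i; rewrite ci expr0n mulr0 addr0 => /esym/eqP; rewrite oner_eq0.
have y2 i : 0 < y 0 i ^+ 2 by rewrite exprn_even_gt0 //= y0.
have opp0 (e : 'I_n.+2 -> R) : \sum_i e i * y 0 i ^+ 2 = 0 -> \sum_i - e i * y 0 i ^+ 2 = 0.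
  by move=> e0; under eq_bigr do rewrite mulNr; rewrite sumrN e0 oppr0.
(* The weights y_i^2 are positive, so a weighted sum equal to 0 needs values of both signs; this is
   applied to c and to -c. *)
have pos (e : 'I_n.+2 -> R) : (forall i, e i != 0) -> \sum_i e i * y 0 i ^+ 2 = 0 ->
    exists i, 0 < e i.
  move=> e0 es; apply/not_existsP => h.
  have h' i : 0 <= - e i * y 0 i ^+ 2.
    by rewrite mulr_ge0 ?sqr_ge0 // oppr_ge0 leNgt; exact/negP/h.
  have /(psumr_eq0P (fun i _ => h' i))/(_ ord0 isT)/eqP := opp0 _ es.
  by rewrite mulNr oppr_eq0 mulf_eq0 (negbTE (e0 _)) gt_eqF.
have [i0 ci0] := pos c c0 cy.
have [|j0] := pos (fun i => - c i) _ (opp0 _ cy); first by move=> i; rewrite oppr_eq0.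
rewrite oppr_gt0 => cj0.
have dich i j : c i = c j \/ c i * c j = -1.
  have : (c i - c j) * (1 + c i * c j) = 0.
    transitivity (c i * (1 + b * c j - c j ^+ 2) - c j * (1 + b * c i - c i ^+ 2)); first by ring.
    by rewrite -!cq !subrr !mulr0 subrr.
  by move/eqP; rewrite mulf_eq0 subr_eq0 addrC addr_eq0 => /orP[/eqP|/eqP]; [left|right].
have same i j : 0 < c i * c j -> c i = c j.
  by case: (dich i j) => // ->; rewrite oppr_gt0 ltr10.
have opp i j : c i * c j < 0 -> c i * c j = -1.
  by case: (dich i j) => // ->; rewrite -expr2 ltNge sqr_ge0.
set l := c i0 in ci0.
have cE i : c i = if i \in I then l else - l^-1.
  rewrite inE; case: ifPn => ci; first by apply: same; rewrite mulr_gt0.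
  have ci' : c i < 0 by rewrite lt_neqAle c0 leNgt.
  apply: (@mulIf _ l); first by rewrite gt_eqF.
  by rewrite mulNr mulVf ?gt_eqF // opp // nmulr_rlt0.
have bE : b = l - l^-1.
  by have := cq i0; rewrite -/l => h; apply: (@mulIf _ l); rewrite ?gt_eqF // mulrBl mulVf ?gt_eqF // -expr2 h; ring.
have I1 : i0 \in I by rewrite inE.
have J1 : j0 \in ~: I by rewrite !inE -leNgt ltW.
have k0 : (0 < #|I|)%N by apply/card_gt0P; exists i0.
have k1 : (#|I| < n.+2)%N.
  have : (0 < #|~: I|)%N by apply/card_gt0P; exists j0.
  by rewrite card_compl subn_gt0.
have tr : #|I|%:R * l - (n.+2 - #|I|)%:R * l^-1 = l - l^-1.
  rewrite -bE -cb (bigID (fun i => i \in I)) /=; congr (_ + _).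
    by rewrite (eq_bigr (fun=> l)) ?sumr_const ?mulr_natl // => i iI; rewrite cE iI.
  rewrite (eq_bigr (fun=> - l^-1)); last by move=> i /negbTE iI; rewrite cE iI.
  rewrite (eq_bigl (mem (~: I))) ?sumr_const => [|i]; last by rewrite !inE.
  rewrite -mulrN mulr_natl; congr (_ *+ _).
  by rewrite card_compl.
have tr2 : (#|I|.-1)%:R * l ^+ 2 = (n.+1 - #|I|)%:R.
  have e1 : (#|I|%:R : R) = (#|I|.-1)%:R + 1 by rewrite -(natrD _ _ 1%N) addn1 prednK.
  have e2 : ((n.+2 - #|I|)%:R : R) = (n.+1 - #|I|)%:R + 1.
    by rewrite -(natrD _ _ 1%N) addn1 subSn.
  move: tr; rewrite e1 e2 => tr.
  have : l * ((#|I|.-1%:R + 1) * l - ((n.+1 - #|I|)%:R + 1) * l^-1) = l * (l - l^-1) by rewrite tr.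
  rewrite !mulrBr divff ?gt_eqF // [l * (_ * l^-1)]mulrCA divff ?gt_eqF // expr2 => h.
  by have := h; set x := (_.-1)%:R; set z := (_ - _)%:R => h'; lra.
(* Size 1 would make the left side of [tr2] vanish and size n + 1 the right side; both contradict n
   > 0. *)
have aI : admissible I.
  apply/andP; split.
    rewrite ltn_neqAle k0 andbT; apply/eqP => k1'.
    by move: tr2; rewrite -k1' mul0r subn1 /= => /esym/eqP; rewrite pnatr_eq0 eqn0Ngt n0.
  rewrite leqNgt; apply/negP => nk.
  have kn : #|I| = n.+1 by apply/eqP; rewrite eqn_leq -ltnS k1 nk.
  move: tr2; rewrite kn subnn /= => /eqP; rewrite mulf_eq0 pnatr_eq0 eqn0Ngt n0 /=.
  by rewrite expf_eq0 /= gt_eqF.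
exists I => // i; rewrite /curv cE.
suff -> : lam I = l by [].
rewrite /lam -tr2 mulrAC divff ?mul1r ?sqrtr_sqr ?gtr0_norm //.
by rewrite pnatr_eq0 -lt0n -subn1 subn_gt0; case/andP: aI.
Qed.

(** If [u] and [v] lie in different blocks, each block J contains one zero and |J| - 1 entries of
    square 1 / n, which add up to its squared radius. So one point serves for every set that
    separates [u] from [v]. *)
Definition flat_point u v : 'rV[R]_n.+2 :=
  \row_i (if (i == u) || (i == v) then 0 else Num.sqrt n%:R^-1).

Lemma flat_block J u v : u \in J -> v \notin J ->
  \sum_(i in J) flat_point u v 0 i ^+ 2 = block J.
Proof.
move=> uJ vJ; rewrite (big_setD1 u) //= mxE eqxx /= expr0n /= add0r.
rewrite (eq_bigr (fun=> n%:R^-1)) => [|i]; last first.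
  rewrite !inE => /andP[iu iJ]; rewrite mxE (negbTE iu) /=.
  have /negbTE -> : i != v by apply: contraNneq vJ => <-.
  by rewrite sqr_sqrtr // invr_ge0 ler0n.
by rewrite sumr_const /block mulr_natl (cardsD1 u J) uJ.
Qed.

Lemma flat_pointC u v : flat_point u v = flat_point v u.
Proof. by apply/rowP => i; rewrite !mxE orbC. Qed.

Lemma flat_torus I u v : (u \in I) != (v \in I) -> torus I (flat_point u v).
Proof.
wlog uI : u v / u \in I => [H uv|].
  case: (boolP (u \in I)) => uI; first exact: H.
  have vI : v \in I by move: uv; rewrite (negbTE uI); case: (v \in I).
  by rewrite flat_pointC; apply: H => //; rewrite eq_sym.
rewrite uI => vI; have {}vI : v \notin I by move: vI; case: (v \in I).
by split; [|rewrite flat_pointC]; apply: flat_block; rewrite // inE ?uI.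
Qed.

(** It suffices to find two indices separated by both sets. If [u] and [v], separated by [I], are on
    the same side of [I'], an index [w] from the other side of [I'] replaces whichever of them is on
    its own side of [I]. *)
Lemma torus_meet I I' : admissible I -> admissible I' -> exists2 y, torus I y & torus I' y.
Proof.
move=> aI aI'.
have ne J : admissible J -> exists i, i \in J by move=> /andP[/ltnW/card_gt0P].
have ne' J (b : bool) : admissible J -> exists i, (i \in J) = b.
  move=> aJ; case: b; first exact: ne.
  by have [i] := ne _ (admissibleC aJ); rewrite inE => /negbTE; exists i.
suff [u [v [h h']]] : exists u v, (u \in I) != (v \in I) /\ (u \in I') != (v \in I').
  by exists (flat_point u v); exact: flat_torus.
have [[u uI] [v vI]] := (ne' _ true aI, ne' _ false aI).
have [h|h] := eqVneq (u \in I') (v \in I'); last by exists u, v; rewrite uI vI.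
have [w wI'] := ne' _ (~~ (u \in I')) aI'.
case: (boolP (w \in I)) => wI.
  by exists w, v; rewrite wI vI wI' -h; case: (u \in I').
by exists u, w; rewrite (negbTE wI) uI wI'; case: (u \in I').
Qed.

End PrincipalCurvatures.

(** * The equality case *)

Section EqualityCase.
Local Opaque minimal.
Variables (R : realType) (n : nat) (M : ptopologicalType).
Variables (A : oriented_atlas R n M) (f : M -> 'rV[R]_n.+2).
Hypotheses (Mc : closed_manifold M) (fe : embedded_hypersurface A f) (fm : minimal A f).
Hypothesis n_gt0 : (0 < n)%N.
Hypothesis nu0 : forall p i, f p 0 i = 0 -> nu A f p 0 i = 0.
Hypothesis parallel : forall p i, f p 0 i *: gradM A f (fun q => nu A f q 0 i) p =
  nu A f p 0 i *: gradM A f (fun q => f q 0 i) p.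
Implicit Types (p q : M) (I J K : {set 'I_n.+2}) (y z : 'rV[R]_n.+2).
Local Notation nu := (nu A f).
Local Notation gradM := (gradM A f).

(** The product is the sum of nu_c grad nu_c, half of the gradient of |nu|^2 = 1. *)
Lemma nu_grad_nu p : nu p *m grad_nu A f p = 0.
Proof.
have ap := dom_chart_at A p.
rewrite (grad_nuE fe ap) !mulmxA -[X in X *m _ *m _]trmxK trmx_mul trmxK.
by rewrite (nu_chart fe ap) (normal_der_normal fe (image_coord ap)) trmx0 !mul0mx.
Qed.

(** Where f_i = 0 also nu_i = 0, so e_i is tangent and is itself the gradient of f_i. This replaces
    division by f_i at its zeros. *)
Lemma tangent_coord_neq0 p i : ~ (f p 0 i = 0 /\ gradM (fun q => f q 0 i) p = 0).
Proof.
move=> [fi]; rewrite (gradM_f fe) fi (nu0 fi) !scale0r !subr0 => /matrixP/(_ 0 i).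
by rewrite !mxE !eqxx => /eqP; rewrite oner_eq0.
Qed.

(* [nu = C f] and [grad nu = C grad f] for the diagonal matrix C of principal
   curvatures attached to [I]. *)
Definition principal I : set M := [set p | forall i, nu p 0 i = curv R I i * f p 0 i /\
  gradM (fun q => nu q 0 i) p = curv R I i *: gradM (fun q => f q 0 i) p].

(** With C = diag (nu_i / f_i), grad nu is C times the tangential projection. Then [nu_grad_nu]
    reads C^2 f = f + b C f, where b is the quadratic form of C at nu, and the vanishing trace reads
    tr C = b. As all f_i are nonzero, the first relation holds entrywise. *)
Lemma principal_pointwise p : (forall i, f p 0 i != 0) ->
  exists2 I, admissible I & principal I p.
Proof.
move=> f0; pose c i := nu p 0 i / f p 0 i.
have cf i : nu p 0 i = c i * f p 0 i by rewrite /c divfK.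
have cg i : gradM (fun q => nu q 0 i) p = c i *: gradM (fun q => f q 0 i) p.
  by apply: (scalerI (f0 i)); rewrite parallel cf scalerA mulrC.
pose b := \sum_i c i * (nu p 0 i) ^+ 2.
have nn : \sum_i (c i * f p 0 i) ^+ 2 = 1.
  by rewrite -(nu_norm fe p); apply: eq_bigr => i _; rewrite -cf expr2.
have nf : \sum_i c i * f p 0 i ^+ 2 = 0.
  by rewrite -[RHS](nu_pos fe p); apply: eq_bigr => i _; rewrite cf expr2 mulrA.
have quad i : c i ^+ 2 = 1 + b * c i.
  apply: (mulIf (f0 i)); apply/eqP; rewrite -subr_eq0; apply/eqP.
  have /matrixP/(_ 0 i) := nu_grad_nu p; rewrite mxE [RHS]mxE => E; rewrite -[RHS]E {E}.
  rewrite (eq_bigr (fun j => nu p 0 j * c j * (i == j)%:R -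
    (c j * f p 0 j) ^+ 2 * f p 0 i - c j * nu p 0 j ^+ 2 * nu p 0 i)); last first.
    move=> j _; rewrite mxE cg (gradM_f fe).
    move: (f p) (nu p) (cf j) => y v vE; rewrite !mxE eqxx /= vE; ring.
  rewrite !sumrB -!mulr_suml nn mul1r -/b (bigD1 i) //= eqxx mulr1 big1 ?addr0.
    by rewrite cf; ring.
  by move=> j /negbTE ji; rewrite eq_sym ji mulr0.
have tr : \sum_i c i = b.
  have := nu_divergence fe p fm; rewrite /mxtrace.
  rewrite (eq_bigr (fun i => c i - c i * f p 0 i ^+ 2 - c i * nu p 0 i ^+ 2)); last first.
    move=> i _; rewrite mxE cg (gradM_f fe).
    move: (f p) (nu p) => y v; rewrite !mxE !eqxx /=; ring.
  by rewrite !sumrB nf subr0 -/b => /eqP; rewrite subr_eq0 => /eqP.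
have [I aI cI] := curv_classify n_gt0 f0 quad tr nf.
by exists I => // i; rewrite -cI.
Qed.

Lemma principal_closed I : closed (principal I).
Proof.
have -> : principal I = \bigcap_i ([set p | nu p 0 i - curv R I i * f p 0 i = 0] `&`
    \bigcap_c [set p | gradM (fun q => nu q 0 i) p 0 c -
                       curv R I i * gradM (fun q => f q 0 i) p 0 c = 0]).
  apply/seteqP; split => p h.
    move=> i _; have [h1 h2] := h i; split => [|c _] /=; first by rewrite h1 subrr.
    by rewrite h2 [_ 0 c]mxE subrr.
  move=> i; have [h1 h2] := h i Logic.I; split; first exact/subr0_eq.
  by apply/rowP => c; rewrite [RHS]mxE; apply/subr0_eq; exact: h2.
apply: closed_bigI => i _; apply: closedI; last (apply: closed_bigI => c _);
  apply: closed_eq_continuous => p; apply: cvgB.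
- exact: (nu_coord_continuous fe (j := i)).
- by apply: cvgM; [exact: cvg_cst|exact: (f_coord_continuous fe (j := i))].
- exact: gradM_cont (C1M_nu fe i) p.
- by apply: cvgM; [exact: cvg_cst|exact: gradM_cont (C1M_f fe i) p].
Qed.

Lemma coord_open_neq0 (U : set M) i : open U -> U !=set0 -> exists2 p, U p & f p 0 i != 0.
Proof.
move=> oU [p Up]; apply: contrapT => h.
have h0 q : U q -> f q 0 i = 0.
  by move=> Uq; apply/eqP; apply: contraT => fq; exfalso; apply: h; exists q.
apply: (@tangent_coord_neq0 p i); split; first exact: h0.
rewrite (@gradM_near _ _ _ A f _ (fun=> 0)) ?gradM_cst //.
by apply: filterS (open_nbhs_nbhs (conj oU Up)) => q; exact: h0.
Qed.

Lemma nonzero_dense (U : set M) : open U -> U !=set0 -> exists2 p, U p & forall i, f p 0 i != 0.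
Proof.
move=> oU U0.
suff [W [oW [p Wp] WU Ws]] : exists W, [/\ open W, W !=set0, W `<=` U &
    forall p i, W p -> i \in enum 'I_n.+2 -> f p 0 i != 0].
  by exists p => [|i]; [exact: WU|apply: Ws; rewrite ?mem_enum].
elim: (enum 'I_n.+2) => [|i s [W [oW W0 WU Ws]]]; first by exists U; split.
have [p Wp fp] := coord_open_neq0 i oW W0.
exists (W `&` ~` [set q | f q 0 i = 0]); split.
- apply: openI => //; apply: closed_openC; apply: closed_eq_continuous.
  exact: (f_coord_continuous fe (j := i)).
- by exists p; split => //; exact/eqP.
- by move=> q [/WU].
- by move=> q j [Wq /eqP qi]; rewrite inE => /predU1P[->//|]; exact: Ws.
Qed.

(** The points treated by [principal_pointwise] are dense, and the pieces are finitely many closed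
    sets, so their union is closed and dense. *)
Lemma principal_cover p : exists2 I, admissible I & principal I p.
Proof.
apply: contrapT => h.
pose W : set M := \bigcup_(I in [set I | admissible I]) principal I.
have cW : closed W.
  by apply: closed_bigcup => [|I _]; [exact: finite_finset|exact: principal_closed].
have [|q Wq fq] := nonzero_dense (closed_openC cW).
  by exists p => -[I aI Ip]; apply: h; exists I.
by have [I aI Iq] := principal_pointwise fq; apply: Wq; exists I.
Qed.

(** If the curvatures differed at [i], the two relations of [principal] would make f_i and grad f_i
    vanish together, against [tangent_coord_neq0]. *)
Lemma principal_disjoint I J p : admissible I -> admissible J ->
  principal I p -> principal J p -> I = J.
Proof.
move=> aI aJ Ip Jp; apply: (@curv_inj R n) => // i; apply/eqP; apply: contraT => cij.
have d0 : curv R I i - curv R J i != 0 by rewrite subr_eq0.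
have [[h1 h2] [h3 h4]] := (Ip i, Jp i); exfalso; apply: (@tangent_coord_neq0 p i); split.
  by apply: (mulfI d0); rewrite mulr0 mulrBl -h1 -h3 subrr.
by apply: (scalerI d0); rewrite scaler0 scalerBl -h2 -h4 subrr.
Qed.

Lemma principal_near I p : admissible I -> principal I p -> \forall q \near p, principal I q.
Proof.
move=> aI Ip.
have : \forall q \near p, forall J, admissible J -> J != I -> ~ principal J q.
  apply: filter_forall => J; have [aJ|] := boolP (admissible J); last by move=> _; exact: nearW.
  have [->|JI] := eqVneq J I; first exact: nearW.
  have NJ : (~` principal J) p by move=> Jp; move/eqP: JI; apply; exact: principal_disjoint Jp Ip.
  by apply: filterS (open_nbhs_nbhs (conj (closed_openC (@principal_closed J)) NJ)).
apply: filterS => q hq; have [J aJ Jq] := principal_cover q.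
by have [<-//|JI] := eqVneq J I; case: (hq J aJ JI).
Qed.

Lemma principal_torus I p : admissible I -> principal I p -> torus I (f p).
Proof.
move=> aI Ip; apply/(curv_torus _ aI); split; first exact: (f_sphere fe p).
by rewrite -[RHS](nu_pos fe p); apply: eq_bigr => i _; rewrite (Ip i).1 expr2 mulrA.
Qed.


Lemma torus_block I J y : torus I y -> J = I \/ J = ~: I ->
  \sum_(i in J) y 0 i ^+ 2 = block R J.
Proof. by move=> [h1 h2] [->|->]. Qed.

Lemma curv_block I J : J = I \/ J = ~: I -> exists k, forall i, i \in J -> curv R I i = k.
Proof.
case=> ->; first by exists (lam R I) => i iI; rewrite /curv iI.
by exists (- (lam R I)^-1) => i; rewrite inE /curv => /negbTE ->.
Qed.

Lemma admissible_block I J : admissible I -> J = I \/ J = ~: I -> 0 < block R J.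
Proof. by move=> aI [->|->]; apply: block_gt0 => //; exact: admissibleC. Qed.

(* The weight 2 on the complement of [K] forces the signs at a maximum. *)
Lemma block_step I K p y : admissible I -> K = I \/ K = ~: I -> principal I p -> torus I y ->
  (forall i, i \in ~: K -> y 0 i = f p 0 i) ->
  - block R K < \sum_(i in K) y 0 i * f p 0 i -> exists2 q, principal I q & f q = y.
Proof.
move=> aI IK Ip Ty yK big_p.
have IK' : ~: K = I \/ ~: K = ~: I by case: IK => ->; [right|left; rewrite finset.setCK].
have [B0 B0'] := (admissible_block aI IK, admissible_block aI IK').
pose z : 'rV[R]_n.+2 :=
  \row_i (y 0 i * (if i \in K then (block R K)^-1 else 2 / block R (~: K))).
have valE x : dotv z x = (block R K)^-1 * \sum_(i in K) y 0 i * x 0 i +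
    2 / block R (~: K) * \sum_(i in ~: K) y 0 i * x 0 i.
  rewrite /dotv (sum_blocks K) !mulr_sumr; congr (_ + _); apply: eq_bigr => i.
    by move=> iK; rewrite mxE iK mulrAC mulrC.
  by rewrite inE => /negbTE iK; rewrite mxE iK mulrAC mulrC.
have cz := C1M_dot fe z.
have [||q /set_mem Iq Hq] := @compact_EVT_max M R (fun q => dotv z (f q)) (principal I) _
    (closed_compact Mc (@principal_closed I)).
- by exists p.
- exact: continuous_subspaceT (C1M_continuous cz).
exists q => //.
have Tq := principal_torus aI Iq.
have qmax : \forall q' \near q, dotv z (f q') <= dotv z (f q).
  by apply: filterS (principal_near aI Iq) => q' Iq'; apply: Hq; exact/mem_set.
(* Criticality makes [z] a combination of [f q] and [nu q]. On each block [nu q] is a multiple of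
   [f q], hence so are [z] and [y], and the block sums leave only a sign. *)
have := gradM_max f cz qmax; rewrite (gradM_dot fe).
move: (dotv z (f q)) (dotv z (nu q)) => a b /matrixP crit.
have zE i : z 0 i = (a + b * curv R I i) * f q 0 i.
  have := crit 0 i; have := (Iq i).1; move: (f q) (nu q) (z) => x v z'.
  by rewrite !mxE => ->; lra.
have sign J (w : R) : J = I \/ J = ~: I -> 0 < w -> (forall i, i \in J -> z 0 i = y 0 i * w) ->
    exists2 e : R, e = 1 \/ e = -1 & forall i, i \in J -> y 0 i = e * f q 0 i.
  move=> IJ w0 zJ; have [k kJ] := curv_block IJ; exists ((a + b * k) / w); last first.
    move=> i iJ; apply: (mulIf (lt0r_neq0 w0)).
    by rewrite -zJ // zE kJ // mulrAC divfK ?lt0r_neq0.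
  set e := _ / w.
  have e2 : e ^+ 2 * block R J = block R J.
    rewrite -{1}(torus_block Tq IJ) -(torus_block Ty IJ) mulr_sumr; apply: eq_bigr => i iJ.
    rewrite -exprMn; congr (_ ^+ 2); apply: (mulIf (lt0r_neq0 w0)).
    by rewrite -zJ // zE kJ // /e mulrAC divfK ?lt0r_neq0.
  suff : e ^+ 2 == 1 by rewrite sqrf_eq1 => /orP[/eqP|/eqP]; [left|right].
  by apply/eqP; apply: (mulIf (lt0r_neq0 (admissible_block aI IJ))); rewrite mul1r.
have [||e e1 yE] := sign K (block R K)^-1 IK.
- by rewrite invr_gt0.
- by move=> i iK; rewrite mxE iK.
have [||e' e1' yE'] := sign (~: K) (2 / block R (~: K)) IK'.
- by rewrite divr_gt0.
- by move=> i; rewrite inE => /negbTE iK; rewrite mxE iK.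
have Kq : \sum_(i in K) y 0 i * f q 0 i = e * block R K.
  rewrite -(torus_block Tq IK) mulr_sumr; apply: eq_bigr => i iK.
  by rewrite yE // -mulrA.
have Kq' : \sum_(i in ~: K) y 0 i * f q 0 i = e' * block R (~: K).
  rewrite -(torus_block Tq IK') mulr_sumr; apply: eq_bigr => i iK.
  by rewrite yE' // -mulrA.
have Kp' : \sum_(i in ~: K) y 0 i * f p 0 i = block R (~: K).
  rewrite -(torus_block Ty IK'); apply: eq_bigr => i iK.
  by rewrite -yK // expr2.
have := Hq p (mem_set Ip); rewrite !valE Kq Kq' Kp'.
rewrite [_^-1 * (e * _)]mulrCA mulVf ?lt0r_neq0 // mulr1 divfK ?lt0r_neq0 //.
rewrite mulrCA divfK ?lt0r_neq0 // => le_pq.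
have lt_p : -1 < (block R K)^-1 * \sum_(i in K) y 0 i * f p 0 i.
  by rewrite -ltr_pdivrMl ?invr_gt0 // invrK mulrN1.
(* The value at [q] is e + 2 e' and is at least the value at [p], which exceeds -1 + 2 = 1; among
   the four sign choices only e = e' = 1 allows this. *)
have [e_eq e_eq'] : e = 1 /\ e' = 1.
  move: lt_p le_pq; set s := _ * \sum_(_ in _) _.
  by case: e1 e1' => -> [] -> // h1 h2; exfalso; move: h1 h2; lra.
apply/rowP => i; case: (boolP (i \in K)) => iK; first by rewrite yE // e_eq mul1r.
by rewrite yE' ?e_eq' ?mul1r // inE.
Qed.

(* Antipodal points are joined through a vertex of the block. *)
Lemma block_move I K p y : admissible I -> K = I \/ K = ~: I -> principal I p -> torus I y ->
  (forall i, i \in ~: K -> y 0 i = f p 0 i) -> exists2 q, principal I q & f q = y.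
Proof.
move=> aI IK Ip Ty yK.
have IK' : ~: K = I \/ ~: K = ~: I by case: IK => ->; [right|left; rewrite finset.setCK].
have B0 := admissible_block aI IK.
have Tp := principal_torus aI Ip.
have [|anti] := ltP (- block R K) (\sum_(i in K) y 0 i * f p 0 i).
  exact: block_step.
(* On [K] both points have squared norm [block R K], so a product this negative is the equality case
   of Cauchy-Schwarz. *)
have yp i : i \in K -> y 0 i = - f p 0 i.
  move=> iK; apply/eqP; rewrite -addr_eq0 -sqrf_eq0.
  have : \sum_(i in K) (y 0 i + f p 0 i) ^+ 2 <= 0.
    rewrite (eq_bigr (fun i => y 0 i ^+ 2 + 2 * (y 0 i * f p 0 i) + f p 0 i ^+ 2)); last first.
      by move=> j _; ring.
    rewrite !big_split /= -mulr_sumr (torus_block Ty IK) (torus_block Tp IK).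
    by move: anti; lra.
  rewrite eq_le sqr_ge0 andbT; apply: le_trans; rewrite (bigD1 i) //= lerDl.
  by apply: sumr_ge0 => j _; exact: sqr_ge0.
(* [K] has at least two indices, so not every f_i^2 can reach the block sum. *)
have [i iK fi] : exists2 i, i \in K & f p 0 i ^+ 2 < block R K.
  apply: contrapT => h.
  have : (1 < #|K|)%N by case: IK => ->; [|have /andP[]:= admissibleC aI]; case/andP: aI.
  move=> /card_gt1P[i [j [iK jK ij]]].
  have big_i l : l \in K -> block R K <= f p 0 l ^+ 2.
    by move=> lK; rewrite leNgt; apply/negP => hl; apply: h; exists l.
  have := torus_block Tp IK; rewrite (bigD1 i) //= (bigD1 j) /=; last by rewrite jK eq_sym.
  have := big_i _ iK; have := big_i _ jK.
  have : 0 <= \sum_(l < n.+2 | (l \in K) && (l != i) && (l != j)) f p 0 l ^+ 2.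
    by apply: sumr_ge0 => l _; exact: sqr_ge0.
  by move: (\sum_(_ < _ | _) _) => s; lra.
pose r := Num.sqrt (block R K).
have r2 : r ^+ 2 = block R K by rewrite sqr_sqrtr // ltW.
have r0 : 0 < r by rewrite sqrtr_gt0.
have fr : `|f p 0 i| < r.
  by rewrite -(@ltr_pXn2r _ 2) ?nnegrE ?(ltW r0) ?normr_ge0 // real_normK ?num_real // r2.
(* The vertex r e_i of the sphere in the block [K]. As |f_i| < r, it is antipodal neither to [f p]
   nor to [y], so [block_step] applies twice. *)
pose z : 'rV[R]_n.+2 := \row_j (if j \in K then (if j == i then r else 0) else y 0 j).
have zi (x : 'rV[R]_n.+2) : \sum_(j in K) z 0 j * x 0 j = r * x 0 i.
  rewrite (bigD1 i) //= mxE iK eqxx big1 ?addr0 // => j /andP[jK /negbTE ji].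
  by rewrite mxE jK ji mul0r.
have zK j : j \in ~: K -> z 0 j = y 0 j by rewrite inE => /negbTE jK; rewrite mxE jK.
have Tz : torus I z.
  have hK : \sum_(j in K) z 0 j ^+ 2 = block R K.
    by have := zi z; rewrite [X in r * X]mxE iK eqxx -expr2 r2 => <-; apply: eq_bigr.
  have hK' : \sum_(j in ~: K) z 0 j ^+ 2 = block R (~: K).
    by rewrite -(torus_block Ty IK'); apply: eq_bigr => j jK; rewrite zK.
  by case: IK hK hK' => -> h1 h2; split => //; rewrite finset.setCK in h2.
move: fr; rewrite ltr_norml => /andP[fr1 fr2].
have [||q Iq qz] := @block_step I K p z aI IK Ip Tz.
- by move=> j jK; rewrite zK // yK.
- by rewrite zi -r2 expr2 -mulrN ltr_pM2l.
apply: (@block_step I K q y aI IK Iq Ty) => [j jK|]; first by rewrite qz zK.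
rewrite (eq_bigr (fun j => z 0 j * y 0 j)) => [|j _]; last by rewrite qz mulrC.
by rewrite zi yp // -r2 expr2 -mulrN ltr_pM2l // ltrN2.
Qed.

Lemma principal_full I p y : admissible I -> principal I p -> torus I y ->
  exists2 q, principal I q & f q = y.
Proof.
move=> aI Ip [y1 y2]; have [p1 p2] := principal_torus aI Ip.
pose z : 'rV[R]_n.+2 := \row_i (if i \in I then y 0 i else f p 0 i).
have z1 i : i \in I -> z 0 i = y 0 i by move=> iI; rewrite mxE iI.
have z2 i : i \in ~: I -> z 0 i = f p 0 i by rewrite inE => /negbTE iI; rewrite mxE iI.
have [|//|q Iq qz] := @block_move I I p z aI (or_introl erefl) Ip.
  split; first by rewrite -y1; apply: eq_bigr => i iI; rewrite z1.
  by rewrite -p2; apply: eq_bigr => i iI; rewrite z2.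
apply: (@block_move I (~: I) q y aI (or_intror erefl) Iq) => // i.
by rewrite finset.setCK => iI; rewrite qz z1.
Qed.

(** Over a common point of the tori of two nonempty pieces, injectivity of [f] gives one point of M
    in both pieces, and [principal_disjoint] identifies the index sets. *)
Lemma range_torus : exists2 I, admissible I & range f = torus I.
Proof.
have [I aI Ip0] := principal_cover (point : M).
exists I => //; apply/seteqP; split => y; last first.
  by move=> /(principal_full aI Ip0) [q _ <-]; exists q.
move=> [p _ <-]; have [J aJ Jp] := principal_cover p.
have [z Iz Jz] := @torus_meet R n _ _ aI aJ.
have [q Iq qz] := principal_full aI Ip0 Iz.
have [q' Jq' qz'] := principal_full aJ Jp Jz.
have qq : q = q' by apply: (f_inj fe); rewrite qz.
rewrite -qq in Jq'; rewrite (principal_disjoint aI aJ Iq Jq').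
exact: principal_torus.
Qed.

End EqualityCase.

(** * Permuting coordinates to a standard Clifford torus *)

Section CliffordCongruence.
Variables (R : realType) (n : nat).
Implicit Types (I : {set 'I_n.+2}) (x y : 'rV[R]_n.+2).

Definition first_coords m : {set 'I_n.+2} := [set i : 'I_n.+2 | (i <= m)%N]%SET.

Lemma card_first_coords m : (m <= n)%N -> #|first_coords m| = m.+1.
Proof.
move=> mn; rewrite -sum1_card (eq_bigl (fun i : 'I_n.+2 => (i < m.+1)%N)) => [|i].
  by rewrite (big_ord_narrow _) ?sum1_card ?card_ord // !ltnS ltnW.
by rewrite inE.
Qed.

Lemma first_coords_admissible m : (1 <= m <= n - 1)%N -> admissible (first_coords m).
Proof. by move=> mn; rewrite /admissible card_first_coords; lia. Qed.

Lemma clifford_torusE m : (1 <= m <= n - 1)%N -> clifford_torus R n m = torus (first_coords m).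
Proof.
move=> mn; have cI : #|first_coords m| = m.+1 by rewrite card_first_coords //; lia.
rewrite /clifford_torus /torus /block card_compl cI !sqr_sqrtr ?divr_ge0 //=.
have -> : (n.+2 - m.+1).-1 = (n - m)%N by lia.
by apply/seteqP; split => x [h1 h2]; split; rewrite -?h1 -?h2; apply: eq_bigl => i;
  rewrite !inE ?ltnNge.
Qed.

Lemma initial_perm I : exists s : {perm 'I_n.+2}, forall j : 'I_n.+2, (s j \in I) = (j < #|I|)%N.
Proof.
pose e := enum I ++ enum (~: I).
have se : size e = n.+2 by rewrite size_cat -!cardE cardsC card_ord.
have ue : uniq e.
  rewrite cat_uniq !enum_uniq /= andbT; apply/hasPn => i.
  by rewrite !mem_enum inE.
have inj : injective (fun j : 'I_n.+2 => nth ord0 e j).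
  by move=> j k /eqP; rewrite nth_uniq ?se // => /eqP/val_inj.
exists (perm inj) => j; rewrite permE nth_cat -cardE; case: ltnP => jI.
  by rewrite -mem_enum mem_nth // -cardE.
have : nth ord0 (enum (~: I)) (j - #|I|) \in enum (~: I).
  by apply: mem_nth; rewrite -cardE card_compl ltn_sub2r // (leq_ltn_trans jI).
by rewrite mem_enum inE => /negbTE.
Qed.

Definition perm_row (s : {perm 'I_n.+2}) x : 'rV[R]_n.+2 := \row_j x 0 (s j).

Lemma perm_row_sum (s : {perm 'I_n.+2}) (P Q : pred 'I_n.+2) x : (forall j, P (s j) = Q j) ->
  \sum_(j | Q j) perm_row s x 0 j ^+ 2 = \sum_(j | P j) x 0 j ^+ 2.
Proof.
move=> PQ; rewrite [RHS](reindex_perm s); apply: eq_big => [j|j _]; first by rewrite /= PQ.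
by rewrite mxE.
Qed.

Lemma perm_row_dot (s : {perm 'I_n.+2}) x y : dotv (perm_row s x) (perm_row s y) = dotv x y.
Proof.
by rewrite /dotv [RHS](reindex_perm s); apply: eq_bigr => j _; rewrite !mxE.
Qed.

Lemma perm_rowK (s : {perm 'I_n.+2}) x : perm_row s (perm_row s^-1%g x) = x.
Proof. by apply/rowP => j; rewrite !mxE permK. Qed.

Lemma perm_row_isometry (s : {perm 'I_n.+2}) : sphere_isometry (perm_row s).
Proof.
split=> [|x y _ _]; last by rewrite /sphere_dist perm_row_dot.
apply/seteqP; split => x.
  by move=> [y yy <-]; rewrite /usphere /= perm_row_dot.
by move=> xx; exists (perm_row s^-1%g x); rewrite ?perm_rowK // /usphere /= perm_row_dot.
Qed.

Lemma torus_congruent I : admissible I ->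
  exists m, (1 <= m <= n - 1)%N /\ congruent (torus I) (clifford_torus R n m).
Proof.
move=> aI; have [s sI] := initial_perm I; exists (#|I|.-1).
have mn : (1 <= #|I|.-1 <= n - 1)%N by move: aI; rewrite /admissible; lia.
split=> //; exists (perm_row s); split; first exact: perm_row_isometry.
have sJ j : (s j \in I) = (j \in first_coords #|I|.-1).
  by rewrite sI inE; case/andP: aI; case: #|I|.
have cJ : #|first_coords #|I|.-1| = #|I| by rewrite card_first_coords; lia.
have sT x : torus I x <-> torus (first_coords #|I|.-1) (perm_row s x).
  rewrite /torus /block !card_compl /= cJ (perm_row_sum (P := mem I)) //.
  by rewrite (perm_row_sum (P := mem (~: I))) // => j; rewrite /= !finset.in_setC sJ.
rewrite clifford_torusE //; apply/seteqP; split => x; first by move=> [y /sT yT <-].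
by move=> xT; exists (perm_row s^-1%g x); [apply/sT|]; rewrite perm_rowK.
Qed.

End CliffordCongruence.

(** * Sphere isometries and the quadric of a Clifford torus *)

Section CliffordMatrix.
Variables (R : realType) (n : nat).
Implicit Types (I : {set 'I_n.+2}) (x y : 'rV[R]_n.+2).

Lemma curv_quad I i : admissible I ->
  curv R I i ^+ 2 = 1 + (lam R I - (lam R I)^-1) * curv R I i.
Proof.
move=> /(lam_gt0 R)/lt0r_neq0; rewrite /curv; move: (lam R I) => l l0.
by case: (i \in I); field.
Qed.

Lemma curv_sum I : admissible I -> \sum_i curv R I i = lam R I - (lam R I)^-1.
Proof.
move=> aI; have := lam_balance R aI; case/andP: (aI) => h1 h2.
rewrite (eq_bigr (fun i => curv R I i * 1)) => [|i _]; last by rewrite mulr1.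
rewrite curv_sumE !sumr_const card_compl.
have -> : (n.+2 - #|I| = (n.+1 - #|I|).+1)%N by lia.
have -> : (1 : R) *+ #|I| = 1 + #|I|.-1%:R by rewrite -mulrS prednK // ltnW.
rewrite mulrS !mulrDr !mulr1 [_ * #|I|.-1%:R]mulrC [_^-1 * _]mulrC => ->.
by rewrite opprD addrACA subrr addr0.
Qed.

Lemma sphere_isometry_dot (T : 'rV[R]_n.+2 -> 'rV[R]_n.+2) x y : sphere_isometry T ->
  dotv x x = 1 -> dotv y y = 1 -> dotv (T x) (T y) = dotv x y.
Proof.
move=> [TS Td] xx yy.
have S z : dotv z z = 1 -> dotv (T z) (T z) = 1.
  by move=> zz; suff : usphere R n.+2 (T z) by []; rewrite -TS; exists z.
have bnd z w : dotv z z = 1 -> dotv w w = 1 -> dotv z w \in `[-1, 1].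
  by move=> zz ww; rewrite in_itv /= dotv_bounds.
rewrite -[LHS](@acosK R) ?bnd ?S // -[RHS](@acosK R) ?bnd //.
by congr cos; exact: Td.
Qed.

(** The images of the basis vectors are orthonormal, and the coordinates of [T x] with respect to
    them are inner products that [T] preserves. *)
Lemma sphere_isometry_linear (T : 'rV[R]_n.+2 -> 'rV[R]_n.+2) : sphere_isometry T ->
  exists2 Q : 'M[R]_n.+2, Q *m Q^T = 1%:M & forall x, dotv x x = 1 -> T x = x *m Q.
Proof.
move=> Ti; pose Q : 'M[R]_n.+2 := \matrix_i T (delta_mx 0 i).
have ee (i : 'I_n.+2) : dotv (delta_mx 0 i) (delta_mx 0 i) = 1 :> R.
  by rewrite dotv_delta mxE !eqxx.
have QQ : Q *m Q^T = 1%:M.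
  apply/matrixP => i j; rewrite !mxE.
  transitivity (dotv (T (delta_mx 0 i)) (T (delta_mx 0 j))).
    by apply: eq_bigr => k _; rewrite !mxE.
  by rewrite sphere_isometry_dot // dotv_delta mxE eqxx eq_sym.
exists Q => // x xx.
have TQ : T x *m Q^T = x.
  apply/rowP => i; rewrite mxE -[RHS]dotv_delta -(sphere_isometry_dot Ti xx (ee i)).
  by apply: eq_bigr => k _; rewrite !mxE.
by rewrite -{2}TQ -mulmxA (mulmx1C QQ) mulmx1.
Qed.

(** [B] is the diagonal curvature matrix of the torus carried back by the orthogonal matrix of the
    congruence; its algebraic properties are invariant under orthogonal conjugation. *)
Lemma clifford_matrix m (X : set 'rV[R]_n.+2) : (1 <= m <= n - 1)%N ->
  (forall x, X x -> dotv x x = 1) -> congruent X (clifford_torus R n m) ->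
  exists (B : 'M[R]_n.+2) (b : R), [/\ B^T = B, B *m B = 1%:M + b *: B, \tr B = b &
    forall x, X x -> dotv x (x *m B) = 0].
Proof.
move=> mn X1 [T [Ti TX]]; have [aI tE] := (first_coords_admissible mn, clifford_torusE R mn).
move: (first_coords n m) aI tE => I aI tE.
have [Q QQ TQ] := sphere_isometry_linear Ti.
pose C : 'M[R]_n.+2 := diag_mx (\row_i curv R I i).
have CT : C^T = C by rewrite tr_diag_mx.
exists (Q *m C *m Q^T), (lam R I - (lam R I)^-1); split.
- by rewrite !trmx_mul trmxK CT mulmxA.
- rewrite -!mulmxA (mulmxA Q^T) (mulmx1C QQ) mul1mx (mulmxA C).
  have -> : C *m C = 1%:M + (lam R I - (lam R I)^-1) *: C.
    rewrite mulmx_diag; apply/matrixP => i j; rewrite !mxE.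
    have [ij|ij] := eqVneq i j; last by rewrite !mulr0n mulr0 addr0.
    by rewrite !mulr1n -expr2 ij curv_quad.
  by rewrite mulmxDl mulmxDr mul1mx QQ -scalemxAl -scalemxAr.
- rewrite mxtrace_mulC mulmxA (mulmx1C QQ) mul1mx mxtrace_diag -curv_sum //.
  by apply: eq_bigr => i _; rewrite mxE.
move=> x Xx; have : torus I (T x) by rewrite -tE -TX; exists x.
rewrite TQ ?X1 // => /(curv_torus _ aI) [_ <-].
transitivity (dotv (x *m Q *m C) (x *m Q)).
  by rewrite dotvC !dotvE [(x *m Q)^T]trmx_mul !mulmxA.
by apply: eq_bigr => i _; rewrite mul_mx_diag [X in X * _]mxE [X in _ * X * _]mxE expr2 mulrAC mulrC.
Qed.

End CliffordMatrix.

(** * Curvature of a hypersurface contained in the quadric *)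

Section QuadricHypersurface.
Local Opaque minimal.
Variables (R : realType) (n : nat) (M : ptopologicalType).
Variables (A : oriented_atlas R n M) (f : M -> 'rV[R]_n.+2).
Hypothesis fe : embedded_hypersurface A f.
Implicit Types (p q : M) (y z : 'rV[R]_n.+2).
Local Notation nu := (nu A f).
Local Notation gradM := (gradM A f).

Definition tangent_proj p : 'M[R]_n.+2 := 1%:M - (f p)^T *m f p - (nu p)^T *m nu p.

Lemma tangent_projE z p :
  z *m tangent_proj p = z - dotv z (f p) *: f p - dotv z (nu p) *: nu p.
Proof. by rewrite /tangent_proj !mulmxBr mulmx1 !mulmxA !mx11_dotv !mul_scalar_mx. Qed.

Lemma tangent_projT p : (tangent_proj p)^T = tangent_proj p.
Proof. by rewrite /tangent_proj !raddfB /= trmx1 !trmx_mul !trmxK. Qed.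

Lemma tangent_proj_idem p : tangent_proj p *m tangent_proj p = tangent_proj p.
Proof.
apply/row_matrixP => i; rewrite row_mul tangent_projE.
rewrite [row i _](rowE i) tangent_projE.
rewrite !dotvBl !dotvZl (f_sphere fe) (nu_norm fe) (dotvC (f p)) (nu_pos fe).
by rewrite !mulr0 !mulr1 !subr0 !subrr !scale0r !subr0.
Qed.

Lemma gradM_sum (I : Type) (s : seq I) (F : I -> M -> R) p : (forall i, C1M A (F i)) ->
  gradM (fun q => \sum_(i <- s) F i q) p = \sum_(i <- s) gradM (F i) p.
Proof.
move=> cF; elim: s => [|i s IH].
  rewrite big_nil (_ : (fun q => _) = fun=> 0) ?gradM_cst //.
  by apply/funext => q; rewrite big_nil.
rewrite big_cons -IH -(gradMD f p (cF i) (C1M_sum s cF)).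
by congr (gradM _ p); apply/funext => q; rewrite big_cons.
Qed.

Variables (B : 'M[R]_n.+2) (b : R).
Hypotheses (BT : B^T = B) (BB : B *m B = 1%:M + b *: B) (trB : \tr B = b).
Hypothesis fB : forall p, dotv (f p) (f p *m B) = 0.

Let fBc p c : (f p *m B) 0 c = dotv (row c B) (f p).
Proof.
by rewrite mxE dotvC; apply: eq_bigr => d _; rewrite [row c B _ _]mxE -{1}BT [_^T _ _]mxE.
Qed.

Let fBB p : dotv (f p *m B) (f p *m B) = 1.
Proof.
rewrite dotvE trmx_mul BT -mulmxA (mulmxA B) BB mulmxDl mul1mx mulmxDr -scalemxAl -scalemxAr.
have -> : f p *m (B *m (f p)^T) = 0.
  by rewrite -{1}BT -trmx_mul mx11_dotv fB raddf0.
by rewrite scaler0 addr0 -dotvE (f_sphere fe).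
Qed.

Let side p := dotv (f p *m B) (nu p).

(** The quadratic form of [B] is constant on M, so half of its gradient, the tangential part of
    [f p *m B], is 0; the component along [f p] is 0 by [fB]. *)
Lemma quadric_normal p : f p *m B = side p *: nu p.
Proof.
have cB c : C1M A (fun q => dotv (row c B) (f q)) by exact: C1M_dot.
have g0 : gradM (fun q => \sum_c f q 0 c * dotv (row c B) (f q)) p = 0.
  rewrite (_ : (fun q => _) = fun=> 0) ?gradM_cst //; apply/funext => q.
  by rewrite -[RHS](fB q); apply: eq_bigr => c _; rewrite fBc.
have E : f p *m B *m tangent_proj p = 0.
  suff : (f p *m B *m tangent_proj p) *+ 2 = 0 by move/eqP; rewrite -scaler_nat scaler_eq0 pnatr_eq0 => /eqP.
  rewrite -g0 gradM_sum => [|c]; last by apply: C1MM; [exact: C1M_f|exact: cB].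
  rewrite (eq_bigr (fun c => (f p *m B) 0 c *: (delta_mx 0 c *m tangent_proj p) +
    f p 0 c *: (row c B *m tangent_proj p))); last first.
    move=> c _; rewrite (gradMM f p (C1M_f fe c) (cB c)) fBc; congr (_ *: _ + _ *: _).
      rewrite (gradM_f fe) tangent_projE !(dotvC (delta_mx 0 c)) !dotv_delta; by [].
    by rewrite (gradM_dot fe) tangent_projE.
  rewrite big_split /= mulr2n; congr (_ + _).
    by rewrite mulmx_sum_row; apply: eq_bigr => c _; rewrite rowE.
  by rewrite -mulmxA mulmx_sum_row; apply: eq_bigr => c _; rewrite row_mul.
move: E; rewrite tangent_projE dotvC fB scale0r subr0 => /eqP.
by rewrite subr_eq0 => /eqP.
Qed.

Let side_sqr p : side p ^+ 2 = 1.
Proof.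
by rewrite -(fBB p) quadric_normal dotvZl dotvZr (nu_norm fe) mulr1 expr2.
Qed.

Let nu_fB p : nu p = side p *: (f p *m B).
Proof. by rewrite quadric_normal scalerA -expr2 side_sqr scale1r. Qed.

(** A continuous function with square 1 is locally constant. The sign can therefore be pulled out
    when the normal is differentiated. *)
Let side_near p : \forall q \near p, side q = side p.
Proof.
have cs : continuous side.
  apply: (@C1M_continuous _ _ _ A); rewrite (_ : side = fun q => \sum_c dotv (row c B) (f q) * nu q 0 c).
    by apply: C1M_sum => c; apply: C1MM; [exact: (C1M_dot fe)|exact: (C1M_nu fe)].
  by apply/funext => q; apply: eq_bigr => c _; rewrite fBc.
have oW : open (~` [set q | side q = - side p]).
  apply: closed_openC; apply: (@preimage_closed M R side [set - side p]); last exact: closed_eq.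
  by move=> q _; exact: cs.
have Wp : (~` [set q | side q = - side p]) p.
  move=> /= h; have : side p = 0 by lra.
  by move=> h0; have := side_sqr p; rewrite h0 expr0n /= => /esym/eqP; rewrite oner_eq0.
apply: filterS (open_nbhs_nbhs (conj oW Wp)) => q Wq.
have /eqP := etrans (side_sqr q) (esym (side_sqr p)).
rewrite eqf_sqr => /orP[/eqP h|/eqP h]; [exact: h|case: (Wq h)].
Qed.

Lemma quadric_grad_nu p : grad_nu A f p = side p *: (B *m tangent_proj p).
Proof.
apply/row_matrixP => c; rewrite rowK linearZ /= row_mul scalemxAl.
rewrite tangent_projE -(gradM_dot fe); apply: gradM_near.
apply: filterS (side_near p) => q qp.
by rewrite nu_fB qp [LHS]mxE fBc dotvZl.
Qed.

(** With P the tangential projection, |B P|^2 = tr (B^2 P) = tr P + b tr (B P). Here tr P = n, and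
    tr (B P) = tr B - f B f - nu B nu = b - 0 - b = 0, since nu = +- f B and B^2 = 1 + b B. *)
Lemma quadric_sff p : sff_sqnorm A f p = n%:R.
Proof.
rewrite -(grad_nu_sqnorm fe) quadric_grad_nu.
set P := tangent_proj p.
transitivity (\tr ((B *m P) *m (B *m P)^T)).
  rewrite /mxtrace; apply: eq_bigr => c _.
  rewrite linearZ /= dotvZl dotvZr mulrA -expr2 side_sqr mul1r mxE.
  by apply: eq_bigr => d _; rewrite [_^T _ _]mxE !mxE.
have tyy (C : 'M[R]_n.+2) (y : 'rV[R]_n.+2) : \tr (C *m (y^T *m y)) = dotv y (y *m C).
  by rewrite mulmxA mxtrace_mulC mulmxA mx11_dotv mxtrace_scalar dotvC.
have trP : \tr P = n%:R.
  rewrite /P /tangent_proj !raddfB /= mxtrace1 -[(f p)^T *m f p]mul1mx -[(nu p)^T *m nu p]mul1mx.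
  rewrite !tyy !mulmx1 (f_sphere fe) (nu_norm fe) -(natrB _ (n := 1)) //.
  by rewrite -(natrB _ (n := 1)) // !subn1.
have trBP : \tr (B *m P) = 0.
  rewrite /P /tangent_proj !mulmxBr !raddfB /= mulmx1 trB !tyy fB subr0.
  rewrite nu_fB -!scalemxAl dotvZl dotvZr mulrA -expr2 side_sqr mul1r.
  rewrite -mulmxA BB mulmxDr mulmx1 -scalemxAr dotvDr dotvZr (dotvC (f p *m B) (f p)) fB.
  by rewrite fBB mulr1 add0r subrr.
rewrite trmx_mul BT tangent_projT mulmxA mxtrace_mulC -(mulmxA B) tangent_proj_idem mulmxA.
by rewrite BB mulmxDl mul1mx -scalemxAl mxtraceD mxtraceZ trBP mulr0 addr0.
Qed.

End QuadricHypersurface.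

Theorem theorem1p2 (R : realType) (n : nat) (M : ptopologicalType)
  (A : oriented_atlas R n M) (f : M -> 'rV[R]_n.+2)
  (dM : {measure set (borel M) -> \bar R})
  (M_closed : closed_manifold M)
  (f_embedded : embedded_hypersurface A f)
  (dM_volume : volume_element A f dM)
  (f_minimal : minimal A f)
  (f_symmetric : reflection_symmetric (range f))
  (f_not_geodesic : ~ totally_geodesic A f) :
  n%:R <= average dM (sff_sqnorm A f) /\
  (average dM (sff_sqnorm A f) = n%:R <->
   exists m : nat, (1 <= m <= n - 1)%N /\
     congruent (range f) (clifford_torus R n m)).
Proof.
have n0 := dim_gt0 f_not_geodesic.
split; first exact: (average_ge M_closed f_embedded dM_volume f_minimal f_symmetric f_not_geodesic).
split=> [S_eq|[m [mn congr_f]]].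
  have nu0 := @nu_vanish _ _ _ _ _ _ M_closed f_embedded dM_volume f_minimal f_symmetric f_not_geodesic.
  have par := average_eq M_closed f_embedded dM_volume f_minimal f_symmetric f_not_geodesic S_eq.
  have [I aI ->] := range_torus M_closed f_embedded f_minimal n0 (fun p i => @nu0 i p) par.
  exact: torus_congruent.
have [|B [b [BT BB trB fB]]] := clifford_matrix mn _ congr_f.
  by move=> x [p _ <-]; exact: (f_sphere f_embedded p).
have S_n := quadric_sff f_embedded BT BB trB (fun p => fB (f p) (ex_intro2 _ _ p Logic.I erefl)).
have V0 := volume_gt0 M_closed f_embedded dM_volume.
rewrite /average (_ : sff_sqnorm A f = fun=> n%:R); last by apply/funext => p; exact: S_n.
by rewrite -/(integralM dM (fun=> n%:R)) integralM_cst mulrC mulfK ?gt_eqF.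
Qed.
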